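(* The set $S^*[\mathbf Y^2(\Omega;E)]$ consists precisely of all positive measures $\mu\in\mathcal M^+(\overline{\Omega\times Z\times\mathbb B_E})$ satisfying the following property: for all $\varphi\in C(\overline\Omega)$ and all $g\in C(Z)$, $$\int_{\overline{\Omega\times Z\times\mathbb B_E}}\varphi(x)g(\xi)(1-|\hat z|)\,d\mu(x,\xi,\hat z)=\int_\Omega\varphi(x)\,dx\int_Zg(\xi)\,d\xi.$$
   Context: $\Omega\subset\mathbb R^d$ is open and bounded with $\mathscr L^d(\partial\Omega)=0$; $Z=\mathbb T^d=\mathbb R^d/\mathbb Z^d$ with Lebesgue measure $d\xi$; $E$ is a finite-dimensional Euclidean space with open unit ball $\mathbb B_E$. A two-scale* Young measure is a four-tuple $\boldsymbol\nu=(\nu,\lambda,\rho,\nu^\infty)$ where: (i) $(x,\xi)\mapsto\nu_{x,\xi}$ is a weak-* measurable (w.r.t. Lebesgue measure) map from $\overline\Omega\times Z$ to $\mathrm{Prob}(E)$ with $(x,\xi)\mapsto\int_E|z|\,d\nu_{x,\xi}(z)$ integrable; (ii) $\lambda$ is a bounded positive measure on $\overline\Omega$; (iii) $x\mapsto\rho_x$ is a weak-* $\lambda$-measurable map from $\overline\Omega$ to $\mathrm{Prob}(Z)$; (iv) $(x,\xi)\mapsto\nu^\infty_{x,\xi}$ is a weak-* $(\lambda\otimes\rho_x)$-measurable map from $\overline\Omega\times Z$ to $\mathrm{Prob}(\partial\mathbb B_E)$. The set of these is $\mathbf Y^2(\Omega;E)$. For $f\in C(\Omega\times Z\times E)$ put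 $(Tf)(x,\xi,\hat z)=(1-|\hat z|)f(x,\xi,\hat z/(1-|\hat z|))$. $\mathbf E^2(\Omega;E)$ is the Banach space of those $f$ for which $Tf$ extends continuously to $\overline{\Omega\times Z\times\mathbb B_E}$, with norm $\|Tf\|_\infty$; for such $f$, $f^\infty(x,\xi,z)=\lim_{x'\to x,\xi'\to\xi,t\to\infty}f(x',\xi',tz)/t$ exists. $T:\mathbf E^2(\Omega;E)\to C(\overline{\Omega\times Z\times\mathbb B_E})$ is an isometric isomorphism with inverse $(Sg)(x,\xi,z)=(1+|z|)g(x,\xi,z/(1+|z|))$. $\boldsymbol\nu\in\mathbf Y^2(\Omega;E)$ is identified with the element of $\mathbf E^2(\Omega;E)^*$ given by $$\langle\!\langle f,\boldsymbol\nu\rangle\!\rangle=\int_\Omega\int_Z\Big(\int_Ef(x,\xi,\cdot)\,d\nu_{x,\xi}\Big)d\xi\,dx+\int_{\overline\Omega}\int_Z\Big(\int_{\partial\mathbb B_E}f^\infty(x,\xi,\cdot)\,d\nu^\infty_{x,\xi}\Big)d\rho_x(\xi)\,d\lambda(x).$$ $S^*\boldsymbol\nu\in\mathcal M(\overline{\Omega\times Z\times\mathbb B_E})$ is the measure determined by $\int g\,d(S^*\boldsymbol\nu)=\langle\!\langle Sg,\boldsymbol\nu\rangle\!\rangle$ for all $g\in C(\overline{\Omega\times Z\times\mathbb B_E})$. *)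

(* Defs.v *)
From HB Require Import structures.
From mathcomp Require Import all_boot all_order all_algebra.
From mathcomp Require Import all_classical all_reals all_analysis measurable_realfun.

Set Implicit Arguments.
Unset Strict Implicit.
Unset Printing Implicit Defensive.

Import Order.TTheory GRing.Theory Num.Theory.
Import numFieldNormedType.Exports.

Local Open Scope classical_set_scope.
Local Open Scope ring_scope.

Notation borel T := (g_sigma_algebraType (@open T)).

Section lebesgue_rV.
Context {R : realType}.

Lemma borel_open (T : ptopologicalType) (U : set T) :
  open U -> measurable (U : set (borel T)).
Proof. by move=> oU; exact: sub_sigma_algebra. Qed.

Lemma borel_continuous (T U : ptopologicalType) (f : T -> U) :
  continuous f -> @measurable_fun _ _ (borel T) (borel U) setT f.
Proof.
move=> /continuousP cf.
apply: (@measurability _ _ (borel T) (borel U) setT f (@open U)) => //.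
by move=> _ [V oV <-]; rewrite setTI; apply: borel_open; exact: cf.
Qed.

Definition consrV n (p : measurableTypeR R * borel 'rV[R]_n) : borel 'rV[R]_n.+1 :=
  \row_i oapp (fun j => (p.2 : 'rV[R]_n) ord0 j) p.1 (unlift ord0 i).

Lemma consrV0 n p : (@consrV n p : 'rV[R]_n.+1) ord0 ord0 = p.1.
Proof. by rewrite mxE unlift_none. Qed.

Lemma consrV_lift n p i :
  (@consrV n p : 'rV[R]_n.+1) ord0 (lift ord0 i) = (p.2 : 'rV[R]_n) ord0 i.
Proof. by rewrite mxE liftK. Qed.

Definition headrV n (w : borel 'rV[R]_n.+1) : measurableTypeR R := w ord0 ord0.
Definition tailrV n (w : borel 'rV[R]_n.+1) : borel 'rV[R]_n :=
  \row_i w ord0 (lift ord0 i).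

Lemma head_consrV n p : headrV (@consrV n p) = p.1.
Proof. exact: consrV0. Qed.

Lemma tail_consrV n p : tailrV (@consrV n p) = p.2.
Proof. by apply/rowP => i; rewrite mxE consrV_lift. Qed.

Lemma borel_coord n i : @measurable_fun _ _ (borel 'rV[R]_n) (measurableTypeR R)
  setT (fun v : 'rV[R]_n => v ord0 i).
Proof.
apply: (measurability _ (RGenOpens.measurableE R)).
move=> _ [V [a [b ->]] <-]; rewrite setTI; apply: borel_open.
move/continuousP: (@coord_continuous R 1 n ord0 i); apply.
exact: interval_open.
Qed.

Lemma borel_tail n : measurable_fun setT (@tailrV n).
Proof.
apply: borel_continuous => v A /nbhs_ballP[e e0 eA].
apply/nbhs_ballP; exists e => //= w [_ vw]; apply: eA; split => // i j.
by rewrite !mxE; exact: vw.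
Qed.

Lemma ball_rat n (v : 'rV[R]_n) (e : R) : 0 < e ->
  exists (q : 'rV[rat]_n), ball (map_mx ratr q : 'rV[R]_n) e v.
Proof.
move=> e0; have H i : exists r : rat, ball (ratr r : R) e (v ord0 i).
  have /rat_in_itvoo[r] : v ord0 i - e < v ord0 i + e by rewrite ltrD2l gtrN.
  rewrite in_itv/= => /andP[h1 h2]; exists r.
  by rewrite /ball/= ltr_distlC; apply/andP; split; rewrite ?ltrBlDr// -ltrBlDr.
exists (\row_i sval (cid (H i))); split => // i j.
by rewrite !mxE; case: (cid (H j)) => r /=; rewrite (ord1 i).
Qed.

Lemma measurable_consrV n : measurable_fun setT (@consrV n).
Proof.
apply: (@measurability _ _ _ (borel 'rV[R]_n.+1) setT _ (@open 'rV[R]_n.+1)) => //.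
move=> _ [V oV <-]; rewrite setTI.
pose B (m : nat) : set 'rV[R]_n.+1 :=
  if unpickle m is Some (q, k) then
    let D := @ball R 'rV[R]_n.+1 (map_mx ratr (q : 'rV[rat]_n.+1)) k.+1%:R^-1 in
    if `[< D `<=` V >] then D else set0
  else set0.
have -> : V = \bigcup_m B m.
  apply/seteqP; split => [v Vv|v [m _]]; last first.
    rewrite /B; case: unpickle => [[q k]|//]; case: ifPn => // /asboolP; exact.
  have /nbhs_ballP[e /= e0 eV] : nbhs v V by exact: open_nbhs_nbhs.
  have [k ke] : exists k : nat, k.+1%:R^-1 + k.+1%:R^-1 < e.
    have e2 : 0 < e / 2 by rewrite divr_gt0.
    have [k _ /(_ k (leqnn _))/= hk] := near_infty_natSinv_lt (PosNum e2).
    by exists k; rewrite (splitr e) ltrD.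
  have [|q qv] := @ball_rat n.+1 v k.+1%:R^-1; first by rewrite invr_gt0.
  exists (pickle (q, k)) => //; rewrite /B pickleK asboolT// => w qw.
  apply: eV; apply: le_ball (ltW ke) _ _.
  by apply: ball_triangle qw; exact: ball_sym.
rewrite preimage_bigcup; apply: bigcupT_measurable => m; rewrite /B.
case: unpickle => [[q k]|]; last by rewrite preimage_set0.
case: ifPn => _; last by rewrite preimage_set0.
set v := map_mx _ q.
rewrite (_ : _ @^-1` _ = @ball R R (v ord0 ord0) k.+1%:R^-1 `*`
    @ball R 'rV[R]_n (tailrV v) k.+1%:R^-1).
  apply: measurableX; first by apply: open_measurable; exact: ball_open.
  by apply: borel_open; exact: ball_open.
apply/seteqP; split => [p [_ vp]|p [h1 [_ h2]]].
  split => /=; first by have := vp ord0 ord0; rewrite consrV0.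
  split=> // i j; rewrite mxE (ord1 i).
  by have := vp ord0 (lift ord0 j); rewrite consrV_lift.
split => // i j; rewrite (ord1 i).
case: (unliftP ord0 j) => [k' ->|->]; last by rewrite consrV0.
by rewrite consrV_lift; have := h2 ord0 k'; rewrite mxE.
Qed.

Section lebesgue_step.
Local Open Scope ereal_scope.
Variables (n : nat) (m : {sigma_finite_measure set (borel 'rV[R]_n) -> \bar R}).

Definition leb_step : set (borel 'rV[R]_n.+1) -> \bar R :=
  pushforward (@lebesgue_measure R \x m) (@consrV n).

Let leb_step0 : leb_step set0 = 0.
Proof. by rewrite /leb_step /pushforward preimage_set0 measure0. Qed.

Let leb_step_ge0 A : 0 <= leb_step A.
Proof. by rewrite /leb_step /pushforward measure_ge0. Qed.

Let leb_step_sigma_additive : semi_sigma_additive leb_step.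
Proof.
move=> F mF tF mUF; rewrite /leb_step /pushforward preimage_bigcup.
apply: measure_semi_sigma_additive.
- by move=> i; rewrite -[X in measurable X]setTI; exact: measurable_consrV.
- apply/trivIsetP => /= i j _ _ ij; rewrite -preimage_setI.
  by move/trivIsetP : tF => /(_ _ _ _ _ ij) ->//; rewrite preimage_set0.
- rewrite -preimage_bigcup -[X in measurable X]setTI.
  exact: measurable_consrV.
Qed.

HB.instance Definition _ := isMeasure.Build _ _ _ leb_step
  leb_step0 leb_step_ge0 leb_step_sigma_additive.

Lemma leb_stepX (A : set (measurableTypeR R)) (B : set (borel 'rV[R]_n)) :
  measurable A -> measurable B ->
  leb_step (@headrV n @^-1` A `&` @tailrV n @^-1` B) = lebesgue_measure A * m B.
Proof.
move=> mA mB; rewrite -product_measure1E// /leb_step /pushforward.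
congr (_ _); apply/seteqP; split => p /=;
  by rewrite head_consrV tail_consrV.
Qed.

Let leb_step_sigma_finite : sigma_finite setT leb_step.
Proof.
have /sigma_finiteP[F [FT ndF mF]] := sigma_finiteT (@lebesgue_measure R).
have /sigma_finiteP[G [GT ndG mG]] := sigma_finiteT m.
exists (fun k => @headrV n @^-1` F k `&` @tailrV n @^-1` G k).
  apply/seteqP; split => // w _.
  have [i _ Fi] : (\bigcup_i F i) (headrV w) by rewrite -FT.
  have [j _ Gj] : (\bigcup_i G i) (tailrV w) by rewrite -GT.
  exists (maxn i j) => //; split => /=.
    by apply: (subsetPset _ _ (ndF i _ (leq_maxl i j))).
  by apply: (subsetPset _ _ (ndG j _ (leq_maxr i j))).
move=> k; have [mFk Fk] := mF k; have [mGk Gk] := mG k; split.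
  apply: measurableI; rewrite -[X in measurable X]setTI.
    exact: (@borel_coord n.+1 ord0).
  exact: borel_tail.
by rewrite leb_stepX// lte_mul_pinfty// ge0_fin_numE.
Qed.

HB.instance Definition _ := Measure_isSigmaFinite.Build _ _ _ leb_step
  leb_step_sigma_finite.

End lebesgue_step.

(* The d-dimensional Lebesgue measure on the Borel sets of 'rV[R]_d: the iterated
   product of the one-dimensional one (a Dirac mass on the one-point space when
   d = 0). *)
Fixpoint leb d : {sigma_finite_measure set (borel 'rV[R]_d) -> \bar R} :=
  if d is n.+1 then leb_step (leb n)
  else @dirac _ (borel 'rV[R]_0) (0 : 'rV[R]_0) R.

Lemma measurable_boxrV d (A : 'I_d -> set R) : (forall i, measurable (A i)) ->
  measurable ([set v : 'rV[R]_d | forall i, A i (v ord0 i)] : set (borel 'rV[R]_d)).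
Proof.
move=> mA.
rewrite (_ : mkset _ = \bigcap_(i in [set: 'I_d])
    (fun v : 'rV[R]_d => v ord0 i) @^-1` A i); last first.
  by apply/seteqP; split => [v Av i _|v Av i]; [exact: Av|exact: (Av i)].
apply: fin_bigcap_measurable => // i _; rewrite -[X in measurable X]setTI.
exact: (@borel_coord d i measurableT _ (mA i)).
Qed.

Lemma leb_box d (A : 'I_d -> set R) : (forall i, measurable (A i)) ->
  leb d [set v : 'rV[R]_d | forall i, A i (v ord0 i)] =
  (\prod_(i < d) lebesgue_measure (A i))%E.
Proof.
elim: d A => [|d IH] A mA.
  by rewrite big_ord0 /= diracE mem_set// => -[].
rewrite big_ord_recl -IH => [|i]; last exact: mA.
rewrite -leb_stepX; last 2 first.
- exact: mA.
- exact: (@measurable_boxrV d (fun i => A (lift ord0 i)) (fun i => mA _)).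
congr (leb_step _ _); apply/seteqP; split => [v Av|v [A0 A1] i].
  by split => [|i] /=; [exact: Av|rewrite mxE; exact: Av].
case: (unliftP ord0 i) => [j ->|->]; last exact: A0.
by have := A1 j; rewrite mxE.
Qed.

End lebesgue_rV.

Section torus.
Context {R : realType} (d : nat).

Definition lattice_eq (x y : 'rV[R]_d) : bool :=
  [forall i, x ord0 i - y ord0 i \is a Num.int].

Lemma lattice_eq_equiv : equiv_class_of lattice_eq.
Proof.
split.
- by move=> x; apply/forallP => i; rewrite subrr.
- suff h x y : lattice_eq x y -> lattice_eq y x by move=> x y; apply/idP/idP; exact: h.
  by move=> /forallP xy; apply/forallP => i; rewrite -opprB rpredN.
- move=> y x z /forallP xy /forallP yz; apply/forallP => i.
  by rewrite -(subrK (y ord0 i) (x ord0 i)) -addrA rpredD.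
Qed.

Canonical lattice_equiv := EquivRelPack lattice_eq_equiv.

Definition torus := quotient_topology {eq_quot lattice_equiv}%qT.

HB.instance Definition _ := PointedTopological.on torus.

Definition to_torus (x : 'rV[R]_d) : torus := (\pi_torus x)%qT.

Lemma measurable_to_torus :
  @measurable_fun _ _ (borel 'rV[R]_d) (borel torus) setT to_torus.
Proof. by apply: borel_continuous; exact: pi_continuous. Qed.

Definition unit_cube : set 'rV[R]_d :=
  [set x | forall i, `[0, 1[%classic (x ord0 i)].

Lemma measurable_unit_cube : measurable (unit_cube : set (borel 'rV[R]_d)).
Proof.
by apply: (@measurable_boxrV R d (fun=> `[0, 1[%classic)) => i.
Qed.

Local Open Scope ereal_scope.

(* Lebesgue measure of the torus, i.e. the image of the Lebesgue measure of a
   fundamental domain. *)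
Definition torus_measure (A : set (borel torus)) : \bar R :=
  leb d (unit_cube `&` to_torus @^-1` A).

Let torus_measure0 : torus_measure set0 = 0.
Proof. by rewrite /torus_measure preimage_set0 setI0 measure0. Qed.

Let torus_measure_ge0 A : 0 <= torus_measure A.
Proof. by rewrite /torus_measure measure_ge0. Qed.

Let torus_measure_sigma_additive : semi_sigma_additive torus_measure.
Proof.
have mpre (A : set (borel torus)) : measurable A ->
    measurable (to_torus @^-1` A : set (borel 'rV[R]_d)).
  move=> mA; rewrite -[X in measurable X]setTI.
  exact: measurable_to_torus.
move=> F mF tF mUF; rewrite /torus_measure preimage_bigcup setI_bigcupr.
apply: measure_semi_sigma_additive.
- by move=> i; apply: measurableI; [exact: measurable_unit_cube|exact: mpre].
- apply/trivIsetP => /= i j _ _ ij; apply/seteqP; split => // x [[_ Fi] [_ Fj]].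
  by move/trivIsetP : tF => /(_ i j I I ij)/seteqP[+ _] => /(_ (to_torus x)); apply.
- rewrite -setI_bigcupr -preimage_bigcup.
  by apply: measurableI; [exact: measurable_unit_cube|exact: mpre].
Qed.

HB.instance Definition _ := isMeasure.Build _ _ _ torus_measure
  torus_measure0 torus_measure_ge0 torus_measure_sigma_additive.

Let torus_measureT : torus_measure setT = 1.
Proof.
rewrite /torus_measure preimage_setT setIT.
rewrite (@leb_box R d (fun=> `[0%R, 1%R[%classic)) => [|i]; last exact: measurable_itv.
by apply: big1 => i _; rewrite lebesgue_measure_itv/= lte_fin ltr01 sube0.
Qed.

HB.instance Definition _ := Measure_isProbability.Build _ _ _ torus_measure
  torus_measureT.

End torus.
Arguments torus R d : clear implicits.
Arguments torus_measure R d : clear implicits.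

Definition boundary (T : topologicalType) (A : set T) : set T :=
  closure A `\` interior A.

Definition euclidean (R : realType) (E : normedModType R) : Prop :=
  (exists n (e : 'I_n -> E), forall z, exists c : 'I_n -> R,
    z = \sum_(i < n) c i *: e i) /\
  (exists ip : E -> E -> R, [/\ forall x y, ip x y = ip y x,
    forall a x y z, ip (a *: x + y) z = a * ip x z + ip y z
    & forall x, ip x x = `|x| ^+ 2]).

Section measurability.
Context {R : realType} {d : measure_display} {T : measurableType d}.
Variable mu : set T -> \bar R.

(* Membership in the mu-completion of the sigma-algebra of T. *)
Definition completed_measurable (A : set T) : Prop :=
  exists2 B, measurable B & mu.-negligible (A `+` B).

Definition completed_measurable_fun (D : set T) (f : T -> \bar R) : Prop :=
  forall B, measurable B -> completed_measurable (D `&` f @^-1` B).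

Definition C0 (X : topologicalType) (S : set X) (phi : X -> R) : Prop :=
  {within S, continuous phi} /\
  forall e : R, 0 < e -> exists K, [/\ compact K, K `<=` S &
    forall x, (S `\` K) x -> `|phi x| < e].

(* Weak-* mu-measurability on D of a map into Prob(S), as a subset of the dual of
   C_0(S). *)
Definition weakstar_measurable (D : set T) (X : ptopologicalType) (S : set X)
    (nu : T -> probability (borel X) R) : Prop :=
  forall phi : X -> R, C0 S phi ->
    completed_measurable_fun D (fun t => \int[nu t]_(x in S) (phi x)%:E)%E.

End measurability.

(* The measure lambda (x) rho_x on the product. *)
Definition semidirect (R : realType) (d1 d2 : measure_display)
    (X : measurableType d1) (Y : measurableType d2)
    (lambda : {measure set X -> \bar R}) (rho : X -> probability Y R)
    (A : set (X * Y)) : \bar R :=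
  (\int[lambda]_x rho x (xsection A x))%E.

(* Integral of a real function against a signed measure. *)
Definition cintegral (R : realType) (d : measure_display) (T : measurableType d)
    (mu : {charge set T -> \bar R}) (D : set T) (f : T -> R) : \bar R :=
  let: exist P hP := cid (Hahn_decomposition mu) in
  let: exist N hPN := cid hP in
  (\int[jordan_pos hPN]_(x in D) (f x)%:E - \int[jordan_neg hPN]_(x in D) (f x)%:E)%E.

(* Charges are set functions on all subsets: only their values on measurable sets
   are meaningful. *)
Definition charge_eq (R : realType) (d : measure_display) (T : measurableType d)
    (mu1 mu2 : {charge set T -> \bar R}) : Prop :=
  forall A, measurable A -> mu1 A = mu2 A.

Definition positive_charge (R : realType) (d : measure_display)
    (T : measurableType d) (mu : {charge set T -> \bar R}) : Prop :=
  forall A, measurable A -> (0 <= mu A)%E.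

Section young.
Context {R : realType} {d : nat} (Omega : set 'rV[R]_d) (E : normedModType R).

Notation X := 'rV[R]_d.
Notation Z := (torus R d).

Definition uball : set E := [set z | `|z| < 1].
Definition usphere : set E := [set z | `|z| = 1].

(* Maps defined on closure Omega (times Z) are represented by total functions of
   which only the restriction matters, and measures on a subset by measures of the
   ambient space concentrated on it. As is usual for maps measurable with respect
   to a measure, nuinf is required to take its values in Prob(usphere) almost
   everywhere only. *)
Record young2 := Young2 {
  y_nu : X * Z -> probability (borel E) R ;
  y_lambda : {finite_measure set (borel X) -> \bar R} ;
  y_rho : X -> probability (borel Z) R ;
  y_nuinf : X * Z -> probability (borel E) R ;
  y_nu_measurable :
    weakstar_measurable (leb d \x torus_measure R d)%E
      (closure Omega `*` [set: Z] : set (borel X * borel Z)) [set: E] y_nu ;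
  y_nu_moment_measurable :
    completed_measurable_fun (leb d \x torus_measure R d)%E
      (closure Omega `*` [set: Z] : set (borel X * borel Z))
      (fun p => \int[y_nu p]_z `|z|%:E)%E ;
  y_nu_moment :
    (\int[leb d \x torus_measure R d]_(p in closure Omega `*` [set: Z])
      \int[y_nu p]_z `|z|%:E < +oo)%E ;
  y_lambda_supp : y_lambda (~` closure Omega) = 0 ;
  y_rho_measurable :
    weakstar_measurable y_lambda (closure Omega : set (borel X)) [set: Z] y_rho ;
  y_nuinf_sphere :
    (semidirect y_lambda y_rho).-negligible
      [set p : borel X * borel Z | closure Omega p.1 /\ y_nuinf p usphere != 1%E] ;
  y_nuinf_measurable :
    weakstar_measurable (semidirect y_lambda y_rho)
      (closure Omega `*` [set: Z] : set (borel X * borel Z)) usphere y_nuinf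
}.

Definition recession (f : X * Z * E -> R) (p : X * Z * E) : R :=
  lim ((fun q : X * Z * R => f (q.1, q.2 *: p.2) / q.2)
    @ filter_prod
        (filter_prod (within Omega (nbhs p.1.1)) (nbhs p.1.2)) (pinfty_nbhs R)).

Definition pairing (f : X * Z * E -> R) (y : young2) : \bar R :=
  (\int[leb d]_(x in Omega) \int[torus_measure R d]_xi
     \int[y_nu y (x, xi)]_z (f (x, xi, z))%:E +
   \int[y_lambda y]_(x in closure Omega) \int[y_rho y x]_xi
     \int[y_nuinf y (x, xi)]_(z in usphere) (recession f (x, xi, z))%:E)%E.

Definition Smap (g : X * Z * E -> R) (p : X * Z * E) : R :=
  (1 + `|p.2|) * g (p.1, (1 + `|p.2|)^-1 *: p.2).

Definition Kbar : set (X * Z * E) := closure (Omega `*` [set: Z] `*` uball).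

Definition on_Kbar (mu : {charge set (borel (X * Z * E)%type) -> \bar R}) : Prop :=
  forall A : set (borel (X * Z * E)%type),
    measurable A -> A `&` Kbar = set0 -> mu A = 0.

Definition is_Sstar (y : young2)
    (mu : {charge set (borel (X * Z * E)%type) -> \bar R}) : Prop :=
  on_Kbar mu /\ forall g : X * Z * E -> R, {within Kbar, continuous g} ->
    cintegral mu Kbar g = pairing (Smap g) y.

(* The measure determined by is_Sstar; czero is a dummy value. *)
Definition Sstar (y : young2) : {charge set (borel (X * Z * E)%type) -> \bar R} :=
  if pselect (exists mu, is_Sstar y mu) is left ex then sval (cid ex) else czero.

End young.
Arguments Kbar {R d} Omega E.

(* Main.v *)
(* Given a Young measure, replace its components by Borel kernels off null sets.
   The pairing with [Smap h], h >= 0 Borel, is then additive and countably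
   additive in h, hence is the integral of h against a finite measure, which is the
   image of the Young measure; testing against phi(x) g(xi) (1 - |z|), whose
   recession function vanishes, gives the marginal identity.

   Conversely, a positive measure m on the compactified space splits into its parts
   on |z| < 1 and on |z| = 1. The image of (1 - |z|) m under
   (x, xi, z) |-> (x, xi, z / (1 - |z|)) has, by the marginal identity, the Lebesgue
   measure of Omega x Z as its marginal, and its disintegration is nu. The part on
   |z| = 1 is disintegrated twice to yield lambda, rho and nu^infinity. Disintegration
   is proved on the real line by Radon-Nikodym derivatives of the distribution
   function, and then transported through products and Borel retracts. *)

Require Import Defs.
From HB Require Import structures.
From mathcomp Require Import all_boot all_order all_algebra.
From mathcomp Require Import all_classical all_reals all_analysis measurable_realfun.
From mathcomp Require Import ring lra zify.

Set Implicit Arguments.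
Unset Strict Implicit.
Unset Printing Implicit Defensive.

Import Order.TTheory GRing.Theory Num.Theory.
Import numFieldNormedType.Exports.
Import HBNNSimple.

Local Open Scope classical_set_scope.
Local Open Scope ring_scope.

(** * Measures represented by their integrals *)

Section functional.
Context {R : realType}.
Local Open Scope ereal_scope.

(** Most measures here are iterated integrals, so they are built as functionals on nonnegative
    measurable functions: additivity, homogeneity and countable additivity pass through kernels one
    integral at a time, and [imeas_integral] then yields a measure together with its integration
    formula. Four obstacles shape the rest. The components of a Young measure are measurable for
    completions only, and the completion used for nu^infinity depends on rho, so rho has to be made
    Borel before nu^infinity. [Sstar] is selected by choice among signed charges, so both inclusions
    rest on the fact that a charge on [Kbar] is determined by its integrals of continuous functions.
    Kernels live on products of Borel sigma-algebras, whereas the charge lives on the Borel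
    sigma-algebra of the product; second countability identifies the two. The torus carries a
    quotient topology and no metric, so continuous approximations of indicators are made on R^d from
    lattice-invariant distances. *)

Definition nnm {d} {T : measurableType d} (f : T -> \bar R) : Prop :=
  (forall x, 0 <= f x) /\ measurable_fun setT f.

(** Countable additivity over series takes the place of monotone convergence: increments of an
    increasing sequence are again nonnegative, and series commute with sums, scalings and
    integrals. *)
Definition integral_like {d} {T : measurableType d}
    (L : (T -> \bar R) -> \bar R) : Prop :=
  [/\ forall f, nnm f -> 0 <= L f,
      forall f g, nnm f -> nnm g -> L (fun x => f x + g x) = L f + L g,
      forall c f, (0 <= c)%R -> nnm f -> L (fun x => c%:E * f x) = c%:E * L f
    & forall f_ : (T -> \bar R)^nat, (forall n, nnm (f_ n)) ->
        L (fun x => \sum_(n <oo) f_ n x) = \sum_(n <oo) L (f_ n)].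

Lemma nnm_indic {d} {T : measurableType d} (A : set T) :
  measurable A -> nnm (fun x => (\1_A x)%:E).
Proof.
move=> mA; split => [x|]; first by rewrite lee_fin.
by apply/measurable_EFinP; exact: measurable_indic.
Qed.

Lemma nnm_cst {d} {T : measurableType d} (c : \bar R) : 0 <= c ->
  nnm (cst c : T -> \bar R).
Proof. by move=> c0; split => // x. Qed.

Lemma nnmM {d} {T : measurableType d} (f g : T -> \bar R) :
  nnm f -> nnm g -> nnm (fun x => f x * g x).
Proof.
move=> [f0 mf] [g0 mg]; split => [x|]; first exact: mule_ge0.
exact: emeasurable_funM.
Qed.

Lemma nnm_comp {d d'} {T : measurableType d} {U : measurableType d'}
    (f : U -> \bar R) (h : T -> U) :
  measurable_fun setT h -> nnm f -> nnm (fun x => f (h x)).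
Proof. by move=> mh [f0 mf]; split => // ; exact: (measurableT_comp mf mh). Qed.

Lemma integral_like_int {d} {T : measurableType d}
    (mu : {measure set T -> \bar R}) (D : set T) :
  measurable D -> integral_like (fun f => \int[mu]_(x in D) f x).
Proof.
move=> mD.
have mS f : measurable_fun setT f -> measurable_fun D f.
  by move=> h; exact: (measurable_funS measurableT).
split.
- by move=> f [f0 _]; apply: integral_ge0.
- by move=> f g [f0 mf] [g0 mg]; apply: ge0_integralD => //; exact: mS.
- by move=> c f c0 [f0 mf]; apply: ge0_integralZl_EFin => //; exact: mS.
- move=> f_ nf; apply: integral_nneseries => // [n|n x _]; last exact: (nf n).1.
  by apply: mS; exact: (nf n).2.
Qed.

Lemma integral_like_eval {d d'} {T : measurableType d} {U : measurableType d'}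
  (h : U -> T) (u : U) : integral_like (fun f => f (h u)).
Proof. by split => // f [f0 _]. Qed.

Lemma integral_like_scale {d} {T : measurableType d} (L : (T -> \bar R) -> \bar R)
  (c : R) : (0 <= c)%R -> integral_like L -> integral_like (fun f => c%:E * L f).
Proof.
move=> c0 [L0 LD LZ LS]; split.
- by move=> f nf; apply: mule_ge0; [rewrite lee_fin|exact: L0].
- by move=> f g nf ng; rewrite LD// ge0_muleDr//; exact: L0.
- by move=> a f a0 nf; rewrite LZ// !muleA (muleC c%:E).
- move=> f_ nf; rewrite LS// nneseriesZl// => n _; exact: L0.
Qed.

Lemma integral_like_add {d} {T : measurableType d} (L L' : (T -> \bar R) -> \bar R) :
  integral_like L -> integral_like L' -> integral_like (fun f => L f + L' f).
Proof.
move=> [L0 LD LZ LS] [L'0 L'D L'Z L'S]; split.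
- by move=> f nf; apply: adde_ge0; [exact: L0|exact: L'0].
- by move=> f g nf ng; rewrite LD// L'D// addeACA.
- by move=> a f a0 nf; rewrite LZ// L'Z// ge0_muleDr//; [exact: L0|exact: L'0].
- move=> f_ nf; rewrite LS// L'S// nneseriesD// => n _ _; [exact: L0|exact: L'0].
Qed.

Lemma integral_like_comp {d d'} {T : measurableType d} {U : measurableType d'}
    (L : (T -> \bar R) -> \bar R) (G : (U -> \bar R) -> T -> \bar R) :
  integral_like L -> (forall f, nnm f -> measurable_fun setT (G f)) ->
  (forall t, integral_like (fun f => G f t)) ->
  integral_like (fun f => L (G f)).
Proof.
move=> [L0 LD LZ LS] mG iG.
have nG f : nnm f -> nnm (G f).
  by move=> nf; split; [move=> t; case: (iG t) => + _ _ _; apply|exact: mG].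
split.
- by move=> f nf; apply/L0/nG.
- move=> f g nf ng; rewrite -LD; [|exact: nG..]; congr L.
  by apply/funext => t; case: (iG t) => _ + _ _; apply.
- move=> c f c0 nf; rewrite -LZ//; last exact: nG.
  by congr L; apply/funext => t; case: (iG t) => _ _ + _; apply.
- move=> f_ nf; rewrite -LS; last by move=> n; exact: nG.
  by congr L; apply/funext => t; case: (iG t) => _ _ _; apply.
Qed.

Section measure_of.
Context {d} {T : measurableType d} (L : (T -> \bar R) -> \bar R).
Hypothesis iL : integral_like L.

(** The proof argument lets the measure structure be attached to the term itself. The value 0 off
    the sigma-algebra keeps the set function nonnegative on every set. *)
Definition imeas (_ : integral_like L) (A : set T) : \bar R :=
  if pselect (measurable A) then L (fun x => (\1_A x)%:E) else 0.

Let m := imeas iL.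

Lemma imeasE A : measurable A -> m A = L (fun x => (\1_A x)%:E).
Proof. by move=> mA; rewrite /m /imeas; case: pselect. Qed.

Lemma integral_like0 : L (cst 0) = 0.
Proof.
have [_ _ LZ _] := iL.
have := LZ 0%R (cst 0) (lexx _) (nnm_cst (lexx _)); rewrite mul0e => H.
by rewrite -[RHS]H; congr L; apply/funext => x /=; rewrite mul0e.
Qed.

Let m0 : m set0 = 0.
Proof.
rewrite imeasE//; transitivity (L (cst 0)); last exact: integral_like0.
by congr L; apply/funext => x; rewrite indic0.
Qed.

Let m_ge0 A : 0 <= m A.
Proof.
rewrite /m /imeas; case: pselect => // mA; have [+ _ _ _] := iL; apply.
exact: nnm_indic.
Qed.

Let m_sigma : semi_sigma_additive m.
Proof.
move=> F mF tF mUF.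
have -> : m (\bigcup_n F n) = \sum_(n <oo) m (F n).
  rewrite imeasE//; have [_ _ _ LS] := iL.
  under eq_eseriesr do rewrite imeasE//.
  rewrite -LS; last by move=> n; exact: nnm_indic.
  by congr L; apply/funext => x; rewrite indic_bigcup.
by apply: is_cvg_nneseries => n _ _; exact: m_ge0.
Qed.

HB.instance Definition _ := isMeasure.Build _ _ _ m m0 m_ge0 m_sigma.

Lemma imeas_nnsfun (f : {nnsfun T >-> R}) : \int[m]_x (f x)%:E = L (EFin \o f).
Proof.
have [L0 LD LZ LS] := iL.
have LF n (c : 'I_n -> R) (A : 'I_n -> set T) : (forall i, 0 <= c i)%R ->
    (forall i, measurable (A i)) ->
    L (fun x => \sum_(i < n) ((c i)%:E * (\1_(A i) x)%:E)) =
    \sum_(i < n) ((c i)%:E * m (A i)).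
  elim: n c A => [|n IH] c A c0 mA.
    rewrite big_ord0 -[RHS]integral_like0; congr L.
    by apply/funext => x; rewrite big_ord0.
  rewrite big_ord_recl imeasE// -LZ//; last exact: nnm_indic.
  rewrite -(IH (c \o lift ord0) (A \o lift ord0))//= -LD.
  + by congr L; apply/funext => x; rewrite big_ord_recl.
  + apply: nnmM; last exact: nnm_indic.
    by apply: nnm_cst; rewrite lee_fin.
  + split => [x|]; first by apply: sume_ge0 => i _; rewrite -EFinM lee_fin mulr_ge0.
    apply: emeasurable_sum => i; apply: measurable_funeM.
    by apply/measurable_EFinP; exact: measurable_indic.
have fE : EFin \o f = fun x => \sum_(i < size (finmap.enum_fset (fset_set (range f))))
   ((nth 0%R (finmap.enum_fset (fset_set (range f))) i)%:E * 
   (\1_(f @^-1` [set nth 0%R (finmap.enum_fset (fset_set (range f))) i]) x)%:E).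
  by apply/funext => x /=; rewrite {1}(fimfunEord f) -sumEFin; apply: eq_bigr.
have c0 i : (i < size (finmap.enum_fset (fset_set (range f))))%N ->
    (0 <= nth 0%R (finmap.enum_fset (fset_set (range f))) i)%R.
  move=> /(mem_nth 0%R); rewrite in_fset_set// inE => -[x _ <-].
  by [].
rewrite -[LHS]/(\int[m]_x (EFin \o f) x) fE LF//; last by move=> i; exact: c0.
rewrite ge0_integral_sum//.
- apply: eq_bigr => i _; rewrite ge0_integralZl_EFin//; last exact: c0.
  + by rewrite integral_indic// setIT.
  + by apply/measurable_EFinP; exact: measurable_indic.
- move=> i; apply: measurable_funeM.
  by apply/measurable_EFinP; exact: measurable_indic.
- by move=> i x _; rewrite -EFinM lee_fin mulr_ge0// c0.
Qed.

(** A nonnegative measurable function is the series of the increments of its simple approximations;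
    both sides are countably additive, and partial sums are simple functions again. *)
Lemma imeas_integral (f : T -> \bar R) : nnm f -> \int[m]_x f x = L f.
Proof.
move=> [f0 mf]; have [L0 LD LZ LS] := iL.
pose g := nnsfun_approx measurableT mf.
have ndg n x : (g n x <= g n.+1 x)%R.
  by have /lefP := nd_nnsfun_approx measurableT mf (leqnSn n); apply.
(* The increments, with the first approximant itself at index 0, so that the partial sums telescope
   to [g n]. *)
pose h n x : \bar R := if n is k.+1 then (g k.+1 x - g k x)%:E else (g 0%N x)%:E.
have nh n : nnm (h n).
  split => [x|]; case: n => [|n] /=; rewrite ?lee_fin ?subr_ge0//.
    by apply/measurable_EFinP.
  by apply/measurable_EFinP; exact: measurable_funB.
have hg n x : \sum_(0 <= i < n.+1) h i x = (g n x)%:E.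
  elim: n => [|n IH]; first by rewrite big_nat1.
  by rewrite big_nat_recr//= IH -EFinD addrC subrK.
have fE : f = fun x => \sum_(n <oo) h n x.
  apply/funext => x; apply/esym/cvg_lim => //.
  rewrite -cvg_shiftS /=.
  apply: cvg_trans (cvg_nnsfun_approx measurableT mf (fun x _ => f0 x) (I : setT x)).
  by apply: near_eq_cvg; near=> n; rewrite /= hg.
have sumE (K : (T -> \bar R) -> \bar R) : integral_like K -> forall n,
    \sum_(0 <= i < n.+1) K (h i) = K (EFin \o g n).
  move=> [_ KD _ _] n; rewrite -[EFin \o _](funext (hg n)).
  elim: n => [|n IH].
    by rewrite big_nat1; congr K; apply/funext => x; rewrite big_nat1.
  rewrite big_nat_recr//= IH -KD//.
    by congr K; apply/funext => x; rewrite [RHS]big_nat_recr.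
  split => [x|]; first by apply: sume_ge0 => i _; exact: (nh i).1.
  by apply: emeasurable_sum => i; exact: (nh i).2.
rewrite fE LS//; rewrite integral_nneseries//; last 2 first.
  by move=> n; exact: (nh n).2.
  by move=> n x _; exact: (nh n).1.
congr (lim (_ @ \oo)); apply/funext => -[|n]; first by rewrite !big_nil.
rewrite (sumE L)// (sumE _ (integral_like_int m measurableT)).
exact: imeas_nnsfun.
Unshelve. all: by end_near. Qed.

End measure_of.

Lemma integral_like_measure {d} {T : measurableType d} (L : (T -> \bar R) -> \bar R) :
  integral_like L -> exists m : {measure set T -> \bar R},
    forall f, nnm f -> \int[m]_x f x = L f.
Proof. by move=> iL; exists (imeas iL) => f nf; exact: imeas_integral. Qed.

Section finite_measure_of.
Context {d} {T : measurableType d} (m : {measure set T -> \bar R}).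
Hypothesis mT : m setT < +oo.

Definition finmeas (_ : m setT < +oo) : set T -> \bar R := m.
Let m' := finmeas mT.
HB.instance Definition _ := Measure.on m'.
Let m'fin : fin_num_fun m'.
Proof.
move=> A mA; rewrite ge0_fin_numE//; apply: le_lt_trans mT.
by apply: le_measure; rewrite ?inE.
Qed.
HB.instance Definition _ := Measure_isFinite.Build _ _ _ m' m'fin.

Lemma finite_measure_of : exists n : {finite_measure set T -> \bar R}, n = m :> (set T -> \bar R).
Proof. by exists m'. Qed.
End finite_measure_of.

Section probability_of.
Context {d} {T : measurableType d} (m : {measure set T -> \bar R}).
Hypothesis mT : m setT = 1.

Definition probmeas (_ : m setT = 1) : set T -> \bar R := m.
Let m' := probmeas mT.
HB.instance Definition _ := Measure.on m'.
HB.instance Definition _ := Measure_isProbability.Build _ _ _ m' mT.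

Lemma probability_of : exists n : probability T R, n = m :> (set T -> \bar R).
Proof. by exists m'. Qed.
End probability_of.

Lemma integral_like_finite_measure {d} {T : measurableType d}
    (L : (T -> \bar R) -> \bar R) :
  integral_like L -> L (cst 1) < +oo -> exists m : {finite_measure set T -> \bar R},
    forall f, nnm f -> \int[m]_x f x = L f.
Proof.
move=> iL L1; have [m mE] := integral_like_measure iL.
have [|n nm] := @finite_measure_of _ _ m.
  by rewrite -(mul1e (m setT)) -integral_cst// mE//; exact: nnm_cst.
exists n => f nf; rewrite -mE//.
by apply: eq_measure_integral => A mA _; exact: (congr1 (@^~ A) nm).
Qed.

Lemma integral_like_probability {d} {T : measurableType d}
    (L : (T -> \bar R) -> \bar R) :
  integral_like L -> L (cst 1) = 1 -> exists m : probability T R,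
    forall f, nnm f -> \int[m]_x f x = L f.
Proof.
move=> iL L1; have [m mE] := integral_like_measure iL.
have [|n nm] := @probability_of _ _ m.
  by rewrite -(mul1e (m setT)) -integral_cst// mE//; exact: nnm_cst.
exists n => f nf; rewrite -mE//.
by apply: eq_measure_integral => A mA _; exact: (congr1 (@^~ A) nm).
Qed.

Definition mker {d d'} {T : measurableType d} {Y : measurableType d'}
    (k : T -> probability Y R) : Prop :=
  forall A, measurable A -> measurable_fun setT (fun t => k t A).

Section mker_kernel.
Context {d d'} {T : measurableType d} {Y : measurableType d'}.
Variable k : T -> probability Y R.
Hypothesis mk : mker k.

(** A copy of [k] indexed by its measurability proof, on which the kernel instances live; they give
    measurability of parameterised integrals. *)
Definition kfam (_ : mker k) : T -> {measure set Y -> \bar R} := k.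
HB.instance Definition _ := isKernel.Build _ _ _ _ R (kfam mk) mk.
Let kfam1 t : kfam mk t setT = 1.
Proof. exact: probability_setT. Qed.
HB.instance Definition _ := Kernel_isProbability.Build _ _ _ _ R (kfam mk) kfam1.

Lemma mker_integral (f : T * Y -> \bar R) : nnm f ->
  measurable_fun setT (fun t => \int[k t]_y f (t, y)).
Proof.
by move=> [f0 mf]; exact: (measurable_fun_integral_finite_kernel f (kfam mk)).
Qed.

End mker_kernel.

(* The integral of a nonnegative function is a lower integral when the function is
   not measurable, so modifications on a null set do not need measurability. *)
Lemma integral_eq_off_null {d} {T : measurableType d}
    (m : {measure set T -> \bar R}) (D N : set T) (f g : T -> \bar R) :
  measurable N -> m N = 0 -> (forall x, D x -> ~ N x -> f x = g x) ->
  \int[m]_(x in D) f x = \int[m]_(x in D) g x.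
Proof.
move=> mN N0.
have key (u v : T -> \bar R) : (forall x, 0 <= u x) -> (forall x, 0 <= v x) ->
    (forall x, ~ N x -> u x = v x) -> \int[m]_x u x <= \int[m]_x v x.
  move=> u0 v0 uv; rewrite !ge0_integralTE//.
  apply: ge_ereal_sup => _ [h /= hu <-].
  have mNC : measurable (~` N) by exact: measurableC.
  pose h' := proj_nnsfun h mNC.
  apply: ereal_sup_ubound; exists h' => /=.
    move=> x; rewrite /h'/= mindicE.
    have [xN|xN] := boolP (x \in ~` N); last by rewrite mulr0.
    by rewrite mulr1 -uv//; move: xN; rewrite inE.
  rewrite -!integralT_nnsfun; apply: ae_eq_integral => //.
  - by apply/measurable_EFinP.
  - by apply/measurable_EFinP.
  - exists N; split => // x /= /not_implyP[_]; apply: contra_notP => xN.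
    by rewrite /h'/= mindicE mem_set// mulr1.
move=> fg.
have E (u v : T -> \bar R) : (forall x, 0 <= u x) -> (forall x, 0 <= v x) ->
    (forall x, ~ N x -> u x = v x) -> \int[m]_x u x = \int[m]_x v x.
  move=> u0 v0 uv; apply/eqP; rewrite eq_le !key// => x xN; exact/esym/uv.
rewrite integral_mkcond [RHS]integral_mkcond integralE [RHS]integralE.
have H x : ~ N x -> (f \_ D) x = (g \_ D) x.
  by move=> xN; rewrite !patchE; case: ifPn => // /[!inE] Dx; exact: fg.
congr (_ - _); apply: E => // x xN; by rewrite ?funeposE ?funenegE H.
Qed.

End functional.

(** * Disintegration of finite measures *)

Section disintegration.
Context {R : realType}.
Local Open Scope ereal_scope.

Lemma nnm_pair1 {d d'} {T : measurableType d} {Y : measurableType d'}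
  (f : T * Y -> \bar R) t : nnm f -> nnm (fun y => f (t, y)).
Proof. by apply: nnm_comp; exact: pair1_measurable. Qed.

Lemma prob_integral1 {d} {T : measurableType d} (P : probability T R)
  (f : T -> \bar R) : (forall x, f x = 1) -> \int[P]_x f x = 1.
Proof.
move=> f1; rewrite (eq_integral (cst 1)) => [|x _]; last exact: f1.
by rewrite integral_cst// mul1e; exact: probability_setT.
Qed.

(** Choosing a representing probability separately at each t costs no measurability: its value on A
    is [G] at the indicator of A, which is measurable in t by hypothesis. *)
Lemma mker_of_functional {d d'} {T : measurableType d} {Y : measurableType d'}
    (G : (Y -> \bar R) -> T -> \bar R) :
  (forall t, integral_like (fun f => G f t)) ->
  (forall t, G (cst 1) t = 1) ->
  (forall f, nnm f -> measurable_fun setT (G f)) ->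
  exists k : T -> probability Y R, mker k /\
    forall t f, nnm f -> \int[k t]_y f y = G f t.
Proof.
move=> iG G1 mG.
exists (fun t => sval (cid (integral_like_probability (iG t) (G1 t)))).
set k := fun t => _.
have kE t f : nnm f -> \int[k t]_y f y = G f t.
  by move=> nf; exact: (svalP (cid (integral_like_probability (iG t) (G1 t))) f nf).
split => // A mA.
rewrite (_ : (fun t => k t A) = G (fun y => (\1_A y)%:E)).
  by apply: mG; exact: nnm_indic.
apply/funext => t; rewrite -kE; last exact: nnm_indic.
by rewrite integral_indic// setIT.
Qed.

(** The base [T] is arbitrary so that products can be treated by enlarging it. Integrating the
    kernel against [M] itself, through the first coordinate, avoids naming the marginal. [P] is a
    set that carries the second coordinate. *)
Definition disintegrable_on {d'} (Y : measurableType d') (P : set Y) : Prop :=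
  forall (d : measure_display) (T : measurableType d)
    (M : {finite_measure set (T * Y)%type -> \bar R}),
  M [set p | ~ P p.2] = 0 ->
  exists k : T -> probability Y R, mker k /\
    forall f, nnm f -> \int[M]_p f p = \int[M]_p \int[k p.1]_y f (p.1, y).

Definition disintegrable {d'} (Y : measurableType d') := @disintegrable_on d' Y setT.

(** The bound by 1 on the weight keeps the mass finite. It serves both for restrictions, with an
    indicator as weight, and for the density 1 - |z|. *)
Lemma weighted_pushforward {d d'} {T : measurableType d} {U : measurableType d'}
    (M : {finite_measure set T -> \bar R}) (w : T -> R) (h : T -> U) :
  measurable_fun setT w -> (forall t, 0 <= w t <= 1)%R -> measurable_fun setT h ->
  exists N : {finite_measure set U -> \bar R},
    forall f, nnm f -> \int[N]_u f u = \int[M]_t ((w t)%:E * f (h t)).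
Proof.
move=> mw w01 mh.
have w0 t : (0 <= w t)%R by have /andP[] := w01 t.
apply: (@integral_like_finite_measure _ _ _ (fun f => \int[M]_t ((w t)%:E * f (h t)))).
- apply: (@integral_like_comp _ _ _ _ _ (fun f => \int[M]_t f t)
    (fun f t => (w t)%:E * f (h t))); first exact: integral_like_int.
  + move=> f nf; have nw : nnm (fun t => (w t)%:E).
      by split; [move=> t; rewrite lee_fin|exact/measurable_EFinP].
    exact: (nnmM nw (nnm_comp mh nf)).2.
  + by move=> t; apply: integral_like_scale => //; exact: integral_like_eval.
- apply: (@le_lt_trans _ _ (\int[M]_t cst 1 t)); last first.
    by rewrite integral_cst// mul1e -ge0_fin_numE// fin_num_measure.
  apply: ge0_le_integral => //.
  + by move=> t _; rewrite mule1 lee_fin.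
  + apply: emeasurable_funM => //; exact/measurable_EFinP.
  + by move=> t _; rewrite mule1 lee_fin; have /andP[] := w01 t.
Qed.

Lemma pushforward_finite {d d'} {T : measurableType d} {U : measurableType d'}
    (M : {finite_measure set T -> \bar R}) (h : T -> U) :
  measurable_fun setT h ->
  exists N : {finite_measure set U -> \bar R},
    forall f, nnm f -> \int[N]_u f u = \int[M]_t f (h t).
Proof.
move=> mh; have [||N NE] := @weighted_pushforward _ _ _ _ M (cst 1%R) h _ _ mh => //.
  by move=> t; rewrite /= ler01 lexx.
by exists N => f nf; rewrite NE//; apply: eq_integral => t _; rewrite mul1e.
Qed.

Lemma restricted_pushforward {d d'} {T : measurableType d} {U : measurableType d'}
    (M : {finite_measure set T -> \bar R}) (C : set T) (h : T -> U) :
  measurable C -> measurable_fun setT h ->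
  exists N : {finite_measure set U -> \bar R},
    (forall f, nnm f -> \int[N]_u f u = \int[M]_t ((\1_C t)%:E * f (h t))) /\
    (forall A, measurable A -> N A = M (C `&` h @^-1` A)).
Proof.
move=> mC mh; have [||N NE] := @weighted_pushforward _ _ _ _ M (\1_C) h _ _ mh.
- exact: measurable_indic.
- by move=> t; rewrite indicE; case: (t \in C) => /=; rewrite ?lexx ?ler01.
exists N; split => // A mA.
have := NE _ (nnm_indic mA); rewrite integral_indic// setIT => ->.
have mhA : measurable (h @^-1` A) by rewrite -[X in measurable X]setTI; exact: mh.
rewrite -[X in _ = M X]setIT -integral_indic//; last exact: measurableI.
by apply: eq_integral => t _; rewrite -EFinM indicI.
Qed.

Lemma null_bigcup {d} {T : measurableType d} (m : {measure set T -> \bar R})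
    (I : countType) (F : I -> set T) :
  (forall i, measurable (F i)) -> (forall i, m (F i) = 0) ->
  measurable (\bigcup_i F i) /\ m (\bigcup_i F i) = 0.
Proof.
move=> mF F0.
have mU : measurable (\bigcup_i F i) by exact: countable_bigcupT_measurable.
split => //; apply: measure_negligible => //.
have -> : \bigcup_i F i = \bigcup_n oapp F set0 (unpickle n).
  apply/seteqP; split => [t [i _ Fi]|t [n _]].
    by exists (pickle i) => //; rewrite pickleK.
  by case: unpickle => //= i Fi; exists i.
apply: negligible_bigcup => n; case: (unpickle n) => [i|] /=.
  by exists (F i); split.
exact: negligible_set0.
Qed.

Lemma nnm_mker_integral {d d'} {T : measurableType d} {Y : measurableType d'}
  (k : T -> probability Y R) (f : T * Y -> \bar R) : mker k -> nnm f ->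
  nnm (fun t => \int[k t]_y f (t, y)).
Proof.
move=> mk nf; split; last exact: mker_integral.
by move=> t; apply: integral_ge0 => y _; exact: nf.1.
Qed.

(** Push [M] forward along [b], disintegrate there, and push the kernel back along [s]; since [s]
    undoes [b], the result disintegrates [M]. *)
Lemma disintegrable_retract {d1 d2} (Y : measurableType d1) (Y' : measurableType d2)
    (P : set Y) (b : Y' -> Y) (s : Y -> Y') :
  measurable_fun setT b -> measurable_fun setT s -> cancel b s ->
  measurable P -> (forall y, P (b y)) ->
  disintegrable_on P -> disintegrable Y'.
Proof.
move=> mb ms bs mP Pb DY d T M _.
have mtb : measurable_fun setT (fun p : T * Y' => (p.1, b p.2)).
  by apply/measurable_fun_pair => //; exact: (measurableT_comp mb).
have mts : measurable_fun setT (fun p : T * Y => (p.1, s p.2)).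
  by apply/measurable_fun_pair => //; exact: (measurableT_comp ms).
have [N [NE0 NA]] := restricted_pushforward M measurableT mtb.
have NE f : nnm f -> \int[N]_p f p = \int[M]_t f (t.1, b t.2).
  by move=> nf; rewrite NE0//; apply: eq_integral => t _; rewrite indicT mul1e.
have [|k [mk kE]] := DY _ _ N.
  rewrite NA; last first.
    rewrite (_ : mkset _ = setT `&` snd @^-1` (~` P)); last by rewrite setTI.
    by apply: measurable_snd => //; exact: measurableC.
  by rewrite -[RHS](measure0 M); congr (M _); apply/seteqP; split => // p [_ /=]; exact.
have [k' [mk' k'E]] := @mker_of_functional _ _ T Y' (fun f t => \int[k t]_y f (s y))
  (fun t => @integral_like_comp _ _ _ _ _ _ (fun f t => f (s t)) 
    (integral_like_int (k t) measurableT)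
    (fun f nf => (nnm_comp ms nf).2) (fun t => integral_like_eval s t))
  (fun t => prob_integral1 (k t) (fun=> erefl))
  (fun f nf => mker_integral mk (nnm_comp (measurableT_comp ms measurable_snd) nf)).
exists k'; split => // f nf.
have nfs := nnm_comp mts nf.
have -> : \int[M]_p f p = \int[N]_p f (p.1, s p.2).
  by rewrite NE//; apply: eq_integral => -[t y] _ /=; rewrite bs.
rewrite kE// NE/=; last first.
  apply: (nnm_comp (h := fst) _ (nnm_mker_integral mk nfs)) => //.
apply: eq_integral => -[t y] _ /=; rewrite k'E//.
exact: nnm_pair1.
Qed.

(** Disintegrate the [Y2] coordinate over the base [T * Y1], then the marginal on [T * Y1] over [T],
    and compose the two kernels. *)
Lemma disintegrable_prod {d1 d2} (Y1 : measurableType d1) (Y2 : measurableType d2) :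
  disintegrable Y1 -> disintegrable Y2 -> disintegrable (Y1 * Y2)%type.
Proof.
move=> D1 D2 d T M _.
have setTN T' : [set p : T' | ~ True] = set0 by apply/seteqP; split => // p; exact.
have ma : measurable_fun setT (fun p : T * (Y1 * Y2) => ((p.1, p.2.1), p.2.2)).
  apply/measurable_fun_pair => /=; last exact: (measurableT_comp measurable_snd).
  by apply/measurable_fun_pair => //=; exact: (measurableT_comp measurable_fst).
have mb : measurable_fun setT (fun p : T * Y1 * Y2 => (p.1.1, (p.1.2, p.2))).
  apply/measurable_fun_pair => /=; first exact: (measurableT_comp measurable_fst).
  by apply/measurable_fun_pair => //=; exact: (measurableT_comp measurable_snd).
have [M1 M1E] := pushforward_finite M ma.
have [|k2 [mk2 k2E]] := D2 _ _ M1; first by rewrite setTN measure0.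
have mc : measurable_fun setT (fun p : T * (Y1 * Y2) => (p.1, p.2.1)).
  by apply/measurable_fun_pair => //=; exact: (measurableT_comp measurable_fst).
have [M2 M2E] := pushforward_finite M mc.
have [|k1 [mk1 k1E]] := D1 _ _ M2; first by rewrite setTN measure0.
have me t y1 : measurable_fun setT (fun y2 : Y2 => (y1, y2) : Y1 * Y2).
  exact: pair1_measurable.
have nG (f : T * (Y1 * Y2) -> \bar R) : nnm f ->
    nnm (fun p : T * Y1 => \int[k2 p]_y2 f (p.1, (p.2, y2))).
  move=> nf; exact: (nnm_mker_integral mk2 (nnm_comp mb nf)).
have [k [mk kE]] : exists k : T -> probability (Y1 * Y2)%type R, mker k /\
    forall t f, nnm f -> \int[k t]_y f y = \int[k1 t]_y1 \int[k2 (t, y1)]_y2 f (y1, y2).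
  apply: mker_of_functional.
  - move=> t.
    apply: (@integral_like_comp _ _ _ _ _ (fun f => \int[k1 t]_y f y)
      (fun f y1 => \int[k2 (t, y1)]_y2 f (y1, y2))); first exact: integral_like_int.
    + move=> f nf; have nf' : nnm (fun p : T * (Y1 * Y2) => f p.2) by exact: nnm_comp.
      by have [] := nnm_pair1 t (nG _ nf').
    + move=> y1; apply: (@integral_like_comp _ _ _ _ _ (fun f => \int[k2 (t, y1)]_y f y)
        (fun f y => f (y1, y))); first exact: integral_like_int.
      * by move=> f nf; have [] := nnm_comp (pair1_measurable y1) nf.
      * by move=> y2; exact: (integral_like_eval (fun y => (y1, y))).
  - by move=> t; apply: prob_integral1 => y1; exact: prob_integral1.
  - move=> f nf; have nf' : nnm (fun p : T * (Y1 * Y2) => f p.2) by exact: nnm_comp.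
    exact: (mker_integral mk1 (nG _ nf')).
exists k; split => // f nf.
transitivity (\int[M1]_q f (q.1.1, (q.1.2, q.2))).
  rewrite M1E//; last exact: (nnm_comp mb nf).
  by apply: eq_integral => -[t [y1 y2]].
rewrite k2E; last exact: (nnm_comp mb nf).
rewrite M1E/=; last exact: (nnm_comp (h := fst) measurable_fst (nG _ nf)).
transitivity (\int[M2]_p \int[k2 p]_y2 f (p.1, (p.2, y2))).
  by rewrite M2E//; exact: nG.
rewrite k1E; last exact: nG.
rewrite M2E/=; last exact: (nnm_comp (h := fst) measurable_fst (nnm_mker_integral mk1 (nG _ nf))).
by apply: eq_integral => -[t [y1 y2]] _ /=; rewrite kE//; exact: nnm_pair1.
Qed.

(** Testing on the exceptional set where g < f: there f - g is positive with integral at most 0, so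
    the set is null. *)
Lemma ae_le_of_integral_le {d} {T : measurableType d} (m : {measure set T -> \bar R})
    (f g : T -> \bar R) :
  (forall x, f x \is a fin_num) -> (forall x, g x \is a fin_num) ->
  m.-integrable setT f -> m.-integrable setT g ->
  (forall A, measurable A -> \int[m]_(x in A) f x <= \int[m]_(x in A) g x) ->
  exists N, [/\ measurable N, m N = 0 & forall x, ~ N x -> f x <= g x].
Proof.
move=> ff gf intf intg fg; exists [set x | g x < f x].
have mf := measurable_int _ intf; have mg := measurable_int _ intg.
have mN : measurable [set x | g x < f x].
  by rewrite -[X in measurable X]setTI; exact: measurable_lte.
split => //; last by move=> x /= /negP; rewrite -leNgt.
set N := [set x | _].
have i1 : m.-integrable N f by exact: (integrableS measurableT).
have i2 : m.-integrable N g by exact: (integrableS measurableT).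
have H : \int[m]_(x in N) (f x - g x) <= 0.
  by rewrite integralB// sube_le0; exact: fg.
have H0 : \int[m]_(x in N) `|f x - g x| = 0.
  apply/eqP; rewrite eq_le integral_ge0// andbT.
  rewrite (eq_integral (fun x => f x - g x))// => x; rewrite inE => Nx.
  move: Nx; rewrite /N/= -(fineK (ff x)) -(fineK (gf x)) lte_fin -EFinB => gf'.
  by rewrite abse_EFin ger0_norm// subr_ge0 ltW.
have mfg : measurable_fun N (fun x => f x - g x).
  by apply: emeasurable_funB; [exact: (measurable_int _ i1)|exact: (measurable_int _ i2)].
have [A [mA A0 NA]] := (ae_eq_integral_abs m mN mfg).1 H0.
apply: (subset_measure0 mN mA) => // x Nx.
apply: NA => /= /(_ Nx); move: Nx; rewrite /N/=.
rewrite -(fineK (ff x)) -(fineK (gf x)) lte_fin -EFinB => gf' [] /eqP.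
by rewrite subr_eq0 gt_eqF.
Qed.

Lemma measure_unique_prod {d1 d2} {T1 : measurableType d1} {T2 : measurableType d2}
    (m1 m2 : {measure set (T1 * T2)%type -> \bar R}) :
  m1 setT < +oo ->
  (forall A B, measurable A -> measurable B -> m1 (A `*` B) = m2 (A `*` B)) ->
  forall C, measurable C -> m1 C = m2 C.
Proof.
move=> m1oo m12.
apply: (measure_unique [set A `*` B | A in measurable & B in measurable] (fun=> setT)).
- exact: measurable_prod_measurableType.
- move=> _ _ [A mA [B mB <-]] [A' mA' [B' mB' <-]].
  by rewrite -setXI; exists (A `&` A'); [exact: measurableI|exists (B `&` B') => //; exact: measurableI].
- by move=> _; exists setT => //; exists setT => //; rewrite setXTT.
- by rewrite bigcup_const.
- by move=> _ [A mA [B mB <-]]; exact: m12.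
- by [].
Qed.

Lemma measure_unique_ray (m1 m2 : {measure set (measurableTypeR R) -> \bar R}) :
  m1 setT < +oo -> (forall b : R, m1 `]-oo, b[%classic = m2 `]-oo, b[%classic) ->
  forall C, measurable C -> m1 C = m2 C.
Proof.
move=> m1oo m12.
apply: (@measure_unique _ R (measurableTypeR R) (@RGenInftyO.G R) (fun n => `]-oo, n%:R[%classic : set R)).
- exact: RGenInftyO.measurableE.
- move=> _ _ [x ->] [y ->]; exists (Order.min x y).
  by apply/seteqP; split => z /=; rewrite !in_itv/= lt_min => /andP.
- by move=> i; exists i%:R.
- apply/seteqP; split => // x _; exists (Num.bound `|x : R|%R) => //=.
  by rewrite in_itv/=; apply: le_lt_trans (ler_norm _) _; apply: archi_boundP.
- by move=> _ [x ->]; exact: m12.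
- by move=> k; apply: le_lt_trans m1oo; apply: le_measure; rewrite ?inE.
Qed.

(** * Disintegration of measures carried by a compact interval of the line *)

Section base.
Context {d} {T : measurableType d} (M : {finite_measure set (T * measurableTypeR R)%type -> \bar R}).
Hypothesis Mb : M [set p | ~ (-1 <= p.2 <= 1)%R] = 0.

Lemma sub_measurable (A : set T) (B : set (measurableTypeR R)) : measurable A ->
  measurable B ->
  measurable ([set p : T * measurableTypeR R | A p.1 /\ B p.2] : set (T * measurableTypeR R)).
Proof. by move=> mA mB; exact: measurableX. Qed.

Lemma ray_measurable (q : R) :
  measurable ([set p : T * measurableTypeR R | (p.2 <= q)%R] : set (T * measurableTypeR R)).
Proof.
rewrite (_ : mkset _ = snd @^-1` [set` `]-oo, q]]); last first.
  by apply/seteqP; split => p /=; rewrite in_itv.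
rewrite -[X in measurable X]setTI; exact: measurable_snd.
Qed.

(** [F q] is the Radon-Nikodym derivative, with respect to the first marginal, of the part of [M]
    below q. Only rational q occur, so the bounds by 1 and the monotonicity, each true almost
    everywhere, hold off one common null set. *)
Lemma conditional_cdf : exists (m : {finite_measure set T -> \bar R}) (F : rat -> T -> \bar R),
  [/\ forall f, nnm f -> \int[m]_t f t = \int[M]_p f p.1,
      forall q, nnm (F q),
      forall q A, measurable A ->
        M [set p | A p.1 /\ (p.2 <= ratr q)%R] = \int[m]_(t in A) F q t &
      exists N, [/\ measurable N, m N = 0 &
        forall t, ~ N t -> (forall q, F q t <= 1) /\
          forall q q', (q <= q')%R -> F q t <= F q' t]].
Proof.
have [m [mE mA]] := restricted_pushforward M measurableT measurable_fst.
have RN q : exists f : T -> \bar R, [/\ forall t, f t >= 0, forall t, f t \is a fin_num,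
    m.-integrable setT f & forall A, measurable A ->
    M [set p | A p.1 /\ (p.2 <= ratr q)%R] = \int[m]_(t in A) f t].
  have [n [_ nA]] := restricted_pushforward M (ray_measurable (ratr q)) measurable_fst.
  have [|f [f0 ff fi fE]] := @radon_nikodym_sigma_finite _ _ _ m n.
    apply/null_content_dominatesP => A mAA A0; rewrite nA//.
    have mfA : measurable (fst @^-1` A : set (T * measurableTypeR R)).
      by rewrite -[X in measurable X]setTI; exact: measurable_fst.
    apply: (subset_measure0 _ mfA) => //.
      apply: measurableI => //; exact: ray_measurable.
    by have E := mA _ mAA; rewrite setTI in E; exact: (etrans (esym E) A0).
  exists f; split => // A mAA; rewrite -fE// nA//.
  by congr (M _); apply/seteqP; split => p [].
have /choice[F FE] := RN.
exists m, F; split.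
- by move=> f nf; rewrite mE//; apply: eq_integral => p _; rewrite indicT mul1e.
- by move=> q; have [f0 _ fi _] := FE q; split => //; exact: (measurable_int _ fi).
- by move=> q; have [] := FE q.
- have N1 q : exists N, [/\ measurable N, m N = 0 & forall t, ~ N t -> F q t <= 1].
    have [f0 ff fi fE] := FE q.
    have [] := @ae_le_of_integral_le _ _ m (F q) (cst 1) ff _ fi _ _ => //.
    + apply/integrableP; split => //; rewrite (eq_integral (cst 1)).
        by rewrite integral_cst// mul1e -ge0_fin_numE// fin_num_measure.
      by move=> t _; rewrite gee0_abs.
    + move=> A mAA; rewrite -fE//.
      have -> : \int[m]_(x in A) cst 1 x = M (setT `&` fst @^-1` A).
        by rewrite integral_cst// mul1e; exact: mA.
      apply: le_measure; rewrite ?inE.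
      * rewrite (_ : mkset _ = [set p | A p.1 /\ [set` `]-oo, ratr q]] p.2]).
          exact: sub_measurable.
        by apply/seteqP; split => p /=; rewrite in_itv.
      * rewrite setTI -[X in measurable X]setTI; exact: measurable_fst.
      * by move=> p [].
    + by move=> N [? ? ?]; exists N.
  have N2 (q : rat * rat) : exists N, [/\ measurable N, m N = 0 &
      forall t, ~ N t -> (q.1 <= q.2)%R -> F q.1 t <= F q.2 t].
    case: q => q q' /=; have [qq|qq] := boolP (q <= q')%R; last first.
      by exists set0; split => // t _.
    have [f0 ff fi fE] := FE q; have [g0 gf gi gE] := FE q'.
    have [] := @ae_le_of_integral_le _ _ m (F q) (F q') ff gf fi gi => //.
    + move=> A mAA; rewrite -fE// -gE//.
      have mS r : measurable ([set p : T * measurableTypeR R | A p.1 /\ (p.2 <= ratr r)%R]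
          : set (T * measurableTypeR R)).
        rewrite (_ : mkset _ = [set p | A p.1 /\ [set` `]-oo, ratr r]] p.2]).
          exact: sub_measurable.
        by apply/seteqP; split => p /=; rewrite in_itv.
      apply: le_measure; rewrite ?inE//.
      move=> p [Ap pq]; split => //; apply: le_trans pq _; by rewrite ler_rat.
    + by move=> N [? ? N2]; exists N; split => // t Nt _; exact: N2.
  have /choice[f1 f1E] := N1; have /choice[f2 f2E] := N2.
  have [mU1 U10] := @null_bigcup _ _ m _ f1 (fun i => ltac:(by case: (f1E i))) (fun i => ltac:(by case: (f1E i))).
  have [mU2 U20] := @null_bigcup _ _ m _ f2 (fun i => ltac:(by case: (f2E i))) (fun i => ltac:(by case: (f2E i))).
  exists (\bigcup_i f1 i `|` \bigcup_i f2 i); split.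
  + exact: measurableU.
  + by apply: null_set_setU.
  + move=> t /not_orP[h1 h2]; split => [q|q q' qq].
      by have [_ _] := f1E q; apply => h; apply: h1; exists q.
    by have [_ _ /(_ t)] := f2E (q, q'); apply => // h; apply: h2; exists (q, q').
Qed.

(** [k t] is the law of the quantile function x |-> Q (t, x) for x uniform on ]0, 1[. It is a
    probability at every t, even where q |-> F q t fails to be a distribution function, and joint
    measurability of [Q] makes it a kernel. The recomposed measure is compared with [M] on rays
    whose endpoints differ slightly, which spares any regularisation of [F] to a right-continuous
    function. *)
Lemma disintegrable_base : exists k : T -> probability (measurableTypeR R) R, mker k /\
    forall f, nnm f -> \int[M]_p f p = \int[M]_p \int[k p.1]_y f (p.1, y).
Proof.
have [m [F [mE nF FE [N [mN N0 NF]]]]] := conditional_cdf.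
(* The point 1 keeps the set nonempty and the constraint -1 <= q bounds it below, so the infimum is
   genuine for every p; both bounds come from the interval carrying [M]. *)
pose Qs (p : T * measurableTypeR R) : set R := [set 1%R] `|`
  [set ratr q | q in [set q : rat | (-1 <= (ratr q : R))%R /\ (p.2 : R)%:E < F q p.1]].
pose Q (p : T * measurableTypeR R) : measurableTypeR R := inf (Qs p).
have QsN p : Qs p !=set0 by exists 1%R; left.
have Qslb p : has_lbound (Qs p).
  by exists (-1)%R => y [->|[q /= [] + _ <-]] //; rewrite (le_trans _ ler01)// oppr_le0.
(* Strict sublevel sets of [Q] are countable unions over rationals, which gives both its
   measurability and the sandwich below. *)
have Qlt p a : (Q p < a)%R <-> (1 < a)%R \/
    exists q : rat, [/\ (-1 <= (ratr q : R))%R, (ratr q < a)%R & (p.2 : R)%:E < F q p.1].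
  split => [/inf_lt[]// y [->|[q /= [q1 qF] <-]] ya|[a1|[q [q1 qa qF]]]].
  - by left.
  - by right; exists q.
  - by apply: le_lt_trans a1; apply: ge_inf => //; left.
  - by apply: le_lt_trans qa; apply: ge_inf => //; right; exists q.
have mQ : measurable_fun setT Q.
  apply: (measurability _ (RGenInftyO.measurableE R)).
  move=> _ [_ [a ->] <-]; rewrite setTI.
  rewrite (_ : _ @^-1` _ = [set p : T * measurableTypeR R | (1 < a)%R] `|`
     \bigcup_(q : rat) ([set p : T * measurableTypeR R | (-1 <= (ratr q : R))%R /\ (ratr q < a)%R] `&`
       [set p | (p.2 : R)%:E < F q p.1])); last first.
    apply/seteqP; split => p /=; rewrite in_itv/= Qlt.
      by move=> [?|[q [? ? ?]]]; [left|right; exists q].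
    by move=> [?|[q _ [[? ?] ?]]]; [left|right; exists q].
  have mP (P : Prop) : measurable ([set p : T * measurableTypeR R | P] : set (T * measurableTypeR R)).
    have [h|h] := pselect P.
      by rewrite (_ : mkset _ = setT)//; apply/seteqP; split.
    by rewrite (_ : mkset _ = set0)//; apply/seteqP; split.
  apply: measurableU; first exact: mP.
  apply: bigcupT_measurable_rat => q; apply: measurableI; first exact: mP.
  rewrite -[X in measurable X]setTI; apply: measurable_lte => //.
    by apply/measurable_EFinP; exact: measurable_snd.
  exact: (measurableT_comp (nF q).2).
pose J : set (measurableTypeR R) := [set` `]0%R, 1%R[].
have mJ : measurable J by exact: measurable_itv.
pose G (f : measurableTypeR R -> \bar R) (t : T) :=
  \int[@lebesgue_measure R]_x ((\1_J x)%:E * f (Q (t, x))).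
have Gi t (B : set (measurableTypeR R)) : measurable B ->
    G (fun y => (\1_B y)%:E) t = lebesgue_measure (J `&` [set x | B (Q (t, x))]).
  move=> mB.
  have mQB : measurable [set x | B (Q (t, x))].
    by rewrite -[X in measurable X]setTI; exact: (measurableT_comp mQ (pair1_measurable t)).
  rewrite -[X in _ = lebesgue_measure X]setIT -integral_indic//; last exact: measurableI.
  by apply: eq_integral => x _; rewrite indicI/= EFinM.
have nJf (f : measurableTypeR R -> \bar R) : nnm f ->
    nnm (fun p : T * measurableTypeR R => (\1_J p.2)%:E * f (Q p)).
  move=> nf; apply: nnmM; last exact: nnm_comp.
  exact: (nnm_comp measurable_snd (nnm_indic mJ)).
have [k [mk kE]] : exists k : T -> probability (measurableTypeR R) R, mker k /\
    forall t f, nnm f -> \int[k t]_y f y = G f t.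
  apply: mker_of_functional.
  - move=> t; apply: (@integral_like_comp _ _ _ _ _ (fun f => \int[@lebesgue_measure R]_x f x)
      (fun f x => (\1_J x)%:E * f (Q (t, x)))); first exact: integral_like_int.
    + by move=> f nf; have [] := nnm_pair1 t (nJf _ nf).
    + by move=> x; apply: integral_like_scale => //; exact: (integral_like_eval (fun x => Q (t, x))).
  - move=> t; rewrite -(_ : (fun y => (\1_setT y)%:E) = cst 1); last first.
      by apply/funext => y; rewrite indicT.
    rewrite Gi// (_ : [set x | _] = setT) ?setIT; last by apply/seteqP; split.
    by rewrite lebesgue_measure_itv/= lte_fin ltr01 sube0.
  - move=> f nf; have [f0 mf] := nJf _ nf.
    exact: (@measurable_fun_fubini_tonelli_F _ _ _ _ _ (@lebesgue_measure R) _ mf f0).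
have kB t B : measurable B -> k t B = lebesgue_measure (J `&` [set x | B (Q (t, x))]).
  move=> mB; rewrite -Gi// -kE; last exact: nnm_indic.
  by rewrite integral_indic// setIT.
have lebJ (c : \bar R) : 0 <= c -> c <= 1 ->
    lebesgue_measure (J `&` [set x | (x : R)%:E < c]) = c.
  case: c => [c| |]//; rewrite !lee_fin => c0 c1.
  rewrite (_ : _ `&` _ = [set` `]0%R, c[]); last first.
    apply/seteqP; split => x /=; rewrite /J/= !in_itv/= lte_fin.
      by move=> [/andP[-> _] ->].
    by move=> /andP[-> xc]; rewrite xc (lt_le_trans xc c1).
  rewrite lebesgue_measure_itv/= lte_fin sube0.
  by move: c0; rewrite le_eqVlt => /predU1P[<-|->//]; rewrite ltxx.
have mJF c : measurable (J `&` [set x : measurableTypeR R | (x : R)%:E < c]).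
  rewrite -[X in _ `&` X]setTI; apply: measurableI => //.
  by apply: measurable_lte => //; exact/measurable_EFinP.
have mJQ t (b : R) : measurable (J `&` [set x | [set` `]-oo, b[] (Q (t, x))]).
  apply: measurableI => //; rewrite -[X in measurable X]setTI.
  by apply: (measurableT_comp mQ (pair1_measurable t)) => //; exact: measurable_itv.
(* Together with [upp], a sandwich of the mass of an open ray under [k t] between values of [F] at
   nearby rationals. *)
have low t q (b : R) : ~ N t -> (-1 <= (ratr q : R))%R -> (ratr q < b)%R ->
    F q t <= k t [set` `]-oo, b[].
  move=> Nt q1 qb; have [F1 _] := NF t Nt.
  rewrite kB; last exact: measurable_itv.
  rewrite -[leLHS]lebJ ?(nF q).1//; apply: le_measure; rewrite ?inE//.
  move=> x [Jx /= xF]; split => //=; rewrite in_itv/=; apply/Qlt; right.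
  by exists q.
have upp t q (a : R) : ~ N t -> (a <= 1)%R -> (a <= ratr q)%R ->
    k t [set` `]-oo, a[] <= F q t.
  move=> Nt a1 aq; have [F1 Fm] := NF t Nt.
  rewrite kB; last exact: measurable_itv.
  rewrite -[leRHS]lebJ ?(nF q).1//; apply: le_measure; rewrite ?inE//.
  move=> x [Jx /=]; rewrite in_itv/= => /Qlt[|[q' [_ q'a xF]]].
    by rewrite ltNge a1.
  split => //=; apply: lt_le_trans xF _; apply: Fm.
  by rewrite -(ler_rat R) ltW// (lt_le_trans q'a).
(* [K] is the measure recomposed from the marginal and the kernel; the remaining goal is that it
   equals [M]. *)
have [K KE] : exists K : {finite_measure set (T * measurableTypeR R)%type -> \bar R},
    forall f, nnm f -> \int[K]_p f p = \int[M]_p \int[k p.1]_y f (p.1, y).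
  apply: integral_like_finite_measure.
  - apply: (@integral_like_comp _ _ _ _ _ (fun f => \int[M]_p f p)
      (fun f p => \int[k p.1]_y f (p.1, y))); first exact: integral_like_int.
    + by move=> f nf; exact: (nnm_comp (h := fst) measurable_fst (nnm_mker_integral mk nf)).2.
    + move=> p; apply: (@integral_like_comp _ _ _ _ _ (fun f => \int[k p.1]_y f y)
        (fun f y => f (p.1, y))); first exact: integral_like_int.
      * by move=> f nf; have [] := nnm_pair1 p.1 nf.
      * by move=> y; exact: (integral_like_eval (fun y => (p.1, y))).
  - under eq_integral do rewrite prob_integral1//.
    by rewrite integral_cst// mul1e -ge0_fin_numE// fin_num_measure.
have KX A B : measurable A -> measurable B ->
    K [set p | A p.1 /\ B p.2] = \int[m]_(t in A) k t B.
  move=> mA mB; have mAB := sub_measurable mA mB.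
  rewrite -[X in K X]setIT -integral_indic// KE; last exact: nnm_indic.
  rewrite [RHS]integral_mkcond.
  have pE : (fun t => k t B) \_ A = fun t => (\1_A t)%:E * k t B.
    by apply/funext => t; rewrite patchE indicE; case: ifPn; rewrite ?mul1e ?mul0e.
  have nk : nnm (fun t => (\1_A t)%:E * k t B).
    apply: nnmM; first exact: nnm_indic.
    by split => //; exact: mk.
  rewrite pE mE//; apply: eq_integral => -[t y] _ /=.
  rewrite (_ : (fun y => _) = fun y => (\1_A t)%:E * (\1_B y)%:E); last first.
    apply/funext => z; rewrite [LHS](_ : _ = (\1_(A `*` B) (t, z))%:E)// !indicE in_setX/=.
    by rewrite -EFinM; case: (t \in A); rewrite ?mul1r ?mul0r.
  rewrite ge0_integralZl_EFin//; first by rewrite integral_indic// setIT.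
  by apply/measurable_EFinP; exact: measurable_indic.
have mcyl A : measurable A -> measurable ([set p | A p.1] : set (T * measurableTypeR R)).
  by move=> mA; rewrite -[X in measurable X]setTI; exact: measurable_fst.
have mbad : measurable ([set p | ~ (-1 <= p.2 <= 1)%R] : set (T * measurableTypeR R)).
  rewrite (_ : mkset _ = snd @^-1` (~` [set` `[(-1)%R, 1%R]])); last first.
    by apply/seteqP; split => p /=; rewrite in_itv.
  rewrite -[X in measurable X]setTI; apply: measurable_snd => //.
  by apply: measurableC; exact: measurable_itv.
have intN (A : set T) (f g : T -> \bar R) : measurable A -> nnm f -> nnm g ->
    (forall t, ~ N t -> f t <= g t) -> \int[m]_(t in A) f t <= \int[m]_(t in A) g t.
  move=> mA [f0 mf] [g0 mg] fg; apply: ae_ge0_le_integral => //.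
  - exact: (measurable_funS measurableT).
  - exact: (measurable_funS measurableT).
  - exists N; split => // t /= /not_implyP[_]; apply: contra_notP => Nt; exact: fg.
have nk B : measurable B -> nnm (fun t => k t B) by move=> mB; split => //; exact: mk.
have MX A (a : R) : measurable A -> measurable ([set p | A p.1 /\ (p.2 <= a)%R] : set (T * measurableTypeR R)).
  move=> mA; rewrite (_ : mkset _ = [set p | A p.1 /\ [set` `]-oo, a]] p.2]).
    by apply: sub_measurable => //; exact: measurable_itv.
  by apply/seteqP; split => p /=; rewrite in_itv.
have mray (b : R) : measurable ([set` `]-oo, b[] : set (measurableTypeR R)) by exact: measurable_itv.
have MX' A (b : R) : measurable A -> measurable ([set p | A p.1 /\ [set` `]-oo, b[] p.2] : set (T * measurableTypeR R)).
  by move=> mA; exact: sub_measurable.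
(* A rational between a and b links the two sides when a >= -1; below -1 the left side is null by
   [Mb]. *)
have lowK A (a b : R) : measurable A -> (a < b)%R ->
    M [set p | A p.1 /\ (p.2 <= a)%R] <= K [set p | A p.1 /\ [set` `]-oo, b[] p.2].
  move=> mA ab; have [a1|a1] := ltP a (-1)%R.
    rewrite (_ : M _ = 0)//; apply: (subset_measure0 _ mbad) => //; first exact: MX.
    move=> p [_ pa] /andP[+ _]; apply/negP; rewrite -ltNge.
    exact: le_lt_trans a1.
  have [q] := rat_in_itvoo ab; rewrite in_itv/= => /andP[aq qb].
  apply: (@le_trans _ _ (M [set p | A p.1 /\ (p.2 <= ratr q)%R])).
    apply: le_measure; rewrite ?inE//; [exact: MX|exact: MX|].
    by move=> p [Ap pa]; split => //; exact: le_trans (ltW aq).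
  rewrite FE// (KX A [set` `]-oo, b[])//; apply: intN => //; first exact: nk.
  by move=> t Nt; apply: low => //; exact: le_trans (ltW aq).
(* A rational between a and b again, when a <= 1; for a > 1 the ray below b already carries all the
   mass of [M]. *)
have uppK A (a b : R) : measurable A -> (a < b)%R ->
    K [set p | A p.1 /\ [set` `]-oo, a[] p.2] <= M [set p | A p.1 /\ [set` `]-oo, b[] p.2].
  move=> mA ab; have [a1|a1] := ltP 1%R a.
    apply: (@le_trans _ _ (M [set p | A p.1])).
      rewrite (KX A [set` `]-oo, a[])//; apply: (@le_trans _ _ (\int[m]_(t in A) cst 1 t)).
        apply: ge0_le_integral => //; last by move=> t _; exact: probability_le1.
        by apply: (measurable_funS measurableT) => //; exact: mk.
      have <- : \int[M]_p (\1_A p.1)%:E = M [set p | A p.1].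
        rewrite -[X in _ = M X]setIT -integral_indic//; exact: mcyl.
      rewrite -(mE (fun t => (\1_A t)%:E)); last exact: nnm_indic.
      by rewrite integral_indic// setIT integral_cst// mul1e.
    apply: (@le_trans _ _ (M ([set p | A p.1 /\ [set` `]-oo, b[] p.2] `|` [set p | ~ (-1 <= p.2 <= 1)%R]))).
      apply: le_measure; rewrite ?inE; [exact: mcyl|by apply: measurableU => //; exact: MX'|].
      move=> p Ap; have [p1|p1] := pselect (-1 <= p.2 <= 1)%R; [left|by right].
      split => //=; rewrite in_itv/=; have /andP[_ pp] := p1.
      exact: le_lt_trans pp (lt_trans a1 ab).
    apply: (le_trans (measureU2 _ _ _)) => //; first exact: MX'.
    by rewrite -[leRHS]adde0 leeD2l// le_eqVlt; apply/orP; left; apply/eqP.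
  have [q] := rat_in_itvoo ab; rewrite in_itv/= => /andP[aq qb].
  apply: (@le_trans _ _ (M [set p | A p.1 /\ (p.2 <= ratr q)%R])).
    rewrite FE// (KX A [set` `]-oo, a[])//; apply: intN => //; first exact: nk.
    by move=> t Nt; apply: upp => //; exact: ltW.
  apply: le_measure; rewrite ?inE//; [exact: MX|exact: MX'|].
  by move=> p [Ap pa]; split => //=; rewrite in_itv/=; exact: le_lt_trans qb.
(* The open ray at b is exhausted by rays ending at b - 1/(n+1), closed for the first inequality and
   open for the second; the gap in [lowK] and [uppK] disappears in the limit. *)
have MK A (b : R) : measurable A ->
    M [set p | A p.1 /\ [set` `]-oo, b[] p.2] = K [set p | A p.1 /\ [set` `]-oo, b[] p.2].
  move=> mA; pose a n : R := (b - n.+1%:R^-1)%R.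
  have ab n : (a n < b)%R by rewrite /a ltrBlDr ltrDl invr_gt0.
  have aa i j : (i <= j)%N -> (a i <= a j)%R.
    by move=> ij; rewrite /a lerB// lef_pV2 ?posrE// ler_nat.
  have ax (x : R) : (x < b)%R -> exists n, (x < a n)%R.
    move=> xb; have bx0 : (0 < b - x)%R by rewrite subr_gt0.
    have [n _ /(_ n (leqnn _))/= hn] := near_infty_natSinv_lt (PosNum bx0).
    by exists n; rewrite /a ltrBrDr addrC -ltrBrDr.
  apply/eqP; rewrite eq_le; apply/andP; split.
  - pose S n : set (T * measurableTypeR R) := [set p | A p.1 /\ (p.2 <= a n)%R].
    have SE : \bigcup_n S n = [set p | A p.1 /\ [set` `]-oo, b[] p.2].
      apply/seteqP; split => [p [n _ [Ap pn]]|p [Ap]] /=; rewrite in_itv/=.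
        by split => //; exact: le_lt_trans (ab n).
      by move=> /ax[n xn]; exists n => //; split => //; exact: ltW.
    rewrite -[X in M X <= _]SE.
    apply: cvge_le (nondecreasing_cvg_mu (mu := M) _ _ _).
    + by near=> n; rewrite /=; apply: lowK.
    + by move=> n; exact: MX.
    + by rewrite SE; exact: MX'.
    + move=> i j ij; apply/subsetPset => p [Ap pi]; split => //; exact: le_trans (aa _ _ ij).
  - pose S n : set (T * measurableTypeR R) := [set p | A p.1 /\ [set` `]-oo, a n[] p.2].
    have SE : \bigcup_n S n = [set p | A p.1 /\ [set` `]-oo, b[] p.2].
      apply/seteqP; split => [p [n _ [Ap]]|p [Ap]] /=; rewrite !in_itv/=.
        by move=> pn; split => //; exact: lt_trans (ab n).
      by move=> /ax[n xn]; exists n => //; split => //=; rewrite in_itv.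
    rewrite -[X in K X <= _]SE.
    apply: cvge_le (nondecreasing_cvg_mu (mu := K) _ _ _).
    + by near=> n; rewrite /=; apply: uppK.
    + by move=> n; exact: MX'.
    + by rewrite SE; exact: MX'.
    + move=> i j ij; apply/subsetPset => p [Ap /=]; rewrite in_itv/= => pi; split => //=.
      by rewrite in_itv/=; exact: lt_le_trans (aa _ _ ij).
(* With A fixed, both sides are finite measures in B that agree on open rays. *)
have MKX A B : measurable A -> measurable B -> M (A `*` B) = K (A `*` B).
  move=> mA mB.
  have [MA [_ MAE]] := restricted_pushforward M (mcyl _ mA) measurable_snd.
  have [KA [_ KAE]] := restricted_pushforward K (mcyl _ mA) measurable_snd.
  have E : forall C, measurable C -> MA C = KA C.
    apply: measure_unique_ray; first by rewrite -ge0_fin_numE// fin_num_measure.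
    by move=> b; exact: (etrans (MAE _ (mray b)) (etrans (MK A b mA) (esym (KAE _ (mray b))))).
  exact: (etrans (esym (MAE _ mB)) (etrans (E _ mB) (KAE _ mB))).
exists k; split => // f nf; rewrite -KE//.
apply: eq_measure_integral => C mC _; apply: measure_unique_prod => //.
by rewrite -ge0_fin_numE// fin_num_measure.
Unshelve. all: by end_near. Qed.

End base.

(** The map x |-> exp(- exp x) sends the line into ]0, 1[, and y |-> ln(- ln y) is a Borel left
    inverse. *)
Lemma disintegrable_R : disintegrable (measurableTypeR R).
Proof.
pose P : set (measurableTypeR R) := [set` `[(-1)%R, 1%R]].
apply: (@disintegrable_retract _ _ _ _ P
  (fun x : measurableTypeR R => expR (- expR (x : R))%R : measurableTypeR R)
  (fun y : measurableTypeR R => ln (- ln (y : R))%R : measurableTypeR R)).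
- apply: (measurableT_comp (@measurable_expR R)); apply: measurable_funN.
  exact: measurable_expR.
- apply: (measurableT_comp (@measurable_ln R)); apply: measurable_funN.
  exact: measurable_ln.
- by move=> x; rewrite expRK opprK expRK.
- exact: measurable_itv.
- move=> x; rewrite /P/= in_itv/= (le_trans _ (expR_ge0 _))//= ?oppr_le0 ?ler01//.
- move=> d T M M0; apply: disintegrable_base; rewrite -[RHS]M0; congr (M _).
Qed.

(** The one-point space is a retract of the line, and splitting off the first coordinate makes
    R^(n+1) a retract of a product. *)
Lemma disintegrable_rV n : disintegrable (borel 'rV[R]_n).
Proof.
elim: n => [|n IH].
  apply: (@disintegrable_retract _ _ _ _ setT (fun=> 0%R : measurableTypeR R) (fun=> (0%R : 'rV[R]_0) : borel 'rV[R]_0)) => //.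
  - by move=> x; apply/rowP => -[].
  - exact: disintegrable_R.
apply: (@disintegrable_retract _ _ _ _ setT (fun w => (@headrV R n w, @tailrV R n w)) (@consrV R n)) => //.
- apply/measurable_fun_pair; first exact: (@borel_coord R n.+1 ord0).
  exact: borel_tail.
- exact: measurable_consrV.
- move=> w; apply/rowP => i; case: (unliftP ord0 i) => [j ->|->].
    by rewrite consrV_lift /= mxE.
  by rewrite consrV0.
- by apply: disintegrable_prod => //; exact: disintegrable_R.
Qed.

End disintegration.

(** * Topology of the torus and of Euclidean spaces *)

Section topology.
Context {R : realType}.

Definition countable_base (T : topologicalType) (B : nat -> set T) : Prop :=
  (forall n, open (B n)) /\
  forall x U, nbhs x U -> exists n, B n x /\ B n `<=` U.

Lemma countable_base_bigcup (T : topologicalType) (B : nat -> set T) (U : set T) :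
  countable_base B -> open U ->
  U = \bigcup_n (if `[< B n `<=` U >] then B n else set0).
Proof.
move=> [oB BU] oU; apply/seteqP; split => [x Ux|x [n _]].
  have [n [Bx BsU]] := BU x U (open_nbhs_nbhs (conj oU Ux)).
  by exists n => //; rewrite asboolT.
by case: asboolP => // h /h.
Qed.

Lemma countable_base_prod (T U : topologicalType) (B : nat -> set T) (C : nat -> set U) :
  countable_base B -> countable_base C ->
  countable_base (fun n => if unpickle n is Some (i, j) then B i `*` C j else set0 : set (T * U)).
Proof.
move=> [oB hB] [oC hC]; split.
  move=> n; case: unpickle => [[i j]|]; last exact: open0.
  by rewrite openE => -[x y] [/= Bx Cy]; exists (B i, C j) => //=; split; exact: open_nbhs_nbhs.
move=> [x y] O [[P Q] [/= nP nQ] PQ].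
have [i [Bx BP]] := hB _ _ nP; have [j [Cy CQ]] := hC _ _ nQ.
exists (pickle (i, j)); rewrite pickleK; split => // -[a b] [/= Ba Cb].
by apply: PQ; split => /=; [exact: BP|exact: CQ].
Qed.

(** This is why the product of the Borel sigma-algebras contains every open set of the product. *)
Lemma countable_base_rect (T U : topologicalType) (B : nat -> set T) (C : nat -> set U)
    (O : set (T * U)) :
  countable_base B -> countable_base C -> open O ->
  exists (F : nat -> set T) (H : nat -> set U),
    (forall n, open (F n) /\ open (H n)) /\ O = \bigcup_n (F n `*` H n).
Proof.
move=> cB cC oO; have OE := countable_base_bigcup (countable_base_prod cB cC) oO.
have rect n : exists FH : set T * set U, [/\ open FH.1, open FH.2 &
    (if `[< (if unpickle n is Some (i, j) then B i `*` C j else set0 : set (T * U)) `<=` O >]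
     then (if unpickle n is Some (i, j) then B i `*` C j else set0 : set (T * U)) else set0) =
    FH.1 `*` FH.2].
  case: asboolP => _; last by exists (set0, set0); split; [exact: open0..|rewrite setX0].
  case: unpickle => [[i j]|]; last by exists (set0, set0); split; [exact: open0..|rewrite setX0].
  by exists (B i, C j); split; [exact: cB.1|exact: cC.1|].
have /choice[FH FHE] := rect.
exists (fun n => (FH n).1), (fun n => (FH n).2); split.
  by move=> n; have [? ? _] := FHE n.
by rewrite {1}OE; apply: eq_bigcupr => n _; have [_ _] := FHE n.
Qed.

(** * The Borel sigma-algebra of a product and the product of Borel sigma-algebras *)

Section generated.
Context (A B : pointedType) (GA : set (set A)) (GB : set (set B)) (GAB : set (set (A * B))).

Lemma measurable_to_generated :
  (forall O, GAB O -> exists (F : nat -> set A) (H : nat -> set B),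
    (forall n, GA (F n) /\ GB (H n)) /\ O = \bigcup_n (F n `*` H n)) ->
  @measurable_fun _ _ (g_sigma_algebraType GA * g_sigma_algebraType GB)%type
    (g_sigma_algebraType GAB) setT id.
Proof.
move=> h; apply: (@measurability _ _ (g_sigma_algebraType GA * g_sigma_algebraType GB)%type
  (g_sigma_algebraType GAB) setT id GAB) => //.
move=> _ [W GW <-]; rewrite setTI; have [F [H [FH ->]]] := h _ GW.
rewrite preimage_bigcup; apply: bigcupT_measurable => n; have [Fn Hn] := FH n.
by apply: measurableX; exact: sub_sigma_algebra.
Qed.

Lemma measurable_from_generated :
  (forall U, GA U -> GAB (fst @^-1` U)) -> (forall V, GB V -> GAB (snd @^-1` V)) ->
  @measurable_fun _ _ (g_sigma_algebraType GAB)
    (g_sigma_algebraType GA * g_sigma_algebraType GB)%type setT id.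
Proof.
move=> hA hB; rewrite (_ : id = fun p : A * B => (p.1, p.2)); last by apply/funext => -[].
apply: (@measurable_fun_pair _ _ _ (g_sigma_algebraType GAB)
  (g_sigma_algebraType GA) (g_sigma_algebraType GB)).
  apply: (@measurability _ _ (g_sigma_algebraType GAB) (g_sigma_algebraType GA) setT fst GA) => //.
  by move=> _ [V oV <-]; rewrite setTI; apply: sub_sigma_algebra; exact: hA.
apply: (@measurability _ _ (g_sigma_algebraType GAB) (g_sigma_algebraType GB) setT snd GB) => //.
by move=> _ [V oV <-]; rewrite setTI; apply: sub_sigma_algebra; exact: hB.
Qed.

End generated.

Lemma generated_closed (A : pointedType) (G : set (set A)) (C : set A) :
  G (~` C) -> measurable (C : set (g_sigma_algebraType G)).
Proof. by move=> h; rewrite -(setCK C); apply: measurableC; exact: sub_sigma_algebra. Qed.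

Lemma sigma_base (A : pointedType) (GO G : set (set A)) :
  G `<=` GO -> (forall U, GO U -> exists2 F : nat -> set A,
    (forall n, G (F n) \/ F n = set0) & U = \bigcup_n F n) ->
  @measurable _ (g_sigma_algebraType GO) = <<s G >>.
Proof.
move=> GGO h; apply/seteqP; split; last first.
  apply: smallest_sub; first exact: smallest_sigma_algebra.
  by move=> C /GGO oC; exact: sub_sigma_algebra.
apply: smallest_sub; first exact: smallest_sigma_algebra.
move=> U /h[F GF ->].
have [s0 sC sU] := smallest_sigma_algebra setT G.
by apply: sU => n; have [|->] := GF n; [exact: sub_sigma_algebra|exact: s0].
Qed.

(** The distance to the complement of U, truncated at 1 so that it is finite for the whole space
    too. The guard [0 < r] puts 0 in the set at every point, so the supremum is never over the empty
    set. *)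
Definition rad (T : pseudoMetricType R) (U : set T) (x : T) : R :=
  sup [set r | 0 <= r <= 1 /\ (0 < r -> ball x r `<=` U)].

Section rad.
Context (T : pseudoMetricType R) (U : set T).
Let S (x : T) := [set r | 0 <= r <= 1 /\ (0 < r -> ball x r `<=` U)].

Let S0 x : S x 0.
Proof. by split; [rewrite lexx ler01|rewrite ltxx]. Qed.

Let Ssup x : has_sup (S x).
Proof.
by split; [exists 0; exact: S0|exists 1 => r [/andP[]]].
Qed.

Lemma rad_ge0 x : 0 <= rad U x.
Proof. by apply: ub_le_sup; [have [] := Ssup x|exact: S0]. Qed.

Lemma rad_out x : ~ U x -> rad U x = 0.
Proof.
move=> Ux; apply/eqP; rewrite eq_le rad_ge0 andbT.
apply: ge_sup; first by exists 0; exact: S0.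
move=> r [/andP[r0 _] rU]; rewrite leNgt; apply/negP => r1; apply: Ux.
by apply: (rU r1); exact: ballxx.
Qed.

Lemma rad_gt0 x : nbhs x U -> 0 < rad U x.
Proof.
move=> /nbhs_ballP[e /= e0 eU].
have h : S x (Num.min 1 e).
  split => [|_]; first by rewrite le_min ler01 (ltW e0) ge_min lexx.
  by apply: subset_trans eU; apply: le_ball; rewrite ge_min lexx orbT.
apply: lt_le_trans (ub_le_sup _ h); first by rewrite lt_min ltr01.
by have [] := Ssup x.
Qed.

Lemma rad_lip x y e : 0 < e -> ball x e y -> rad U x - e <= rad U y.
Proof.
move=> e0 xy; rewrite lerBlDr; apply: ge_sup; first by exists 0; exact: S0.
move=> r [/andP[r0 r1] rU]; rewrite -lerBlDr.
have [re|re] := leP (r - e) 0; first exact: le_trans re (rad_ge0 y).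
apply: ub_le_sup; first by have [] := Ssup y.
split; first by rewrite (ltW re)/= (le_trans _ r1)// gerBl ltW.
move=> _ z yz; apply: rU; first by rewrite (lt_le_trans re)// gerBl ltW.
rewrite -(subrK e r) addrC.
exact: ball_triangle xy yz.
Qed.

Lemma rad_continuous : continuous (rad U).
Proof.
move=> x; apply/cvgrPdist_le => e e0.
near=> y; have xy : ball x e y by near: y; exact: nbhsx_ballx.
rewrite ler_distl; apply/andP; split.
  by apply: rad_lip => //; exact: ball_sym.
by rewrite -lerBlDr; apply: rad_lip.
Unshelve. all: by end_near. Qed.

End rad.

(** Pointwise eventual equality with the indicator, together with the bound by 1, is what dominated
    convergence asks for; monotonicity in n is left out. *)
Definition indic_approx (T : topologicalType) (U : set T) (f : nat -> T -> R) : Prop :=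
  [/\ forall n, continuous (f n), forall n x, 0 <= f n x <= 1,
      forall n x, ~ U x -> f n x = 0 &
      forall x, U x -> \forall n \near \oo, f n x = 1].

Definition open_approx (T : topologicalType) : Prop :=
  forall U : set T, open U -> exists f : nat -> T -> R, indic_approx U f.

Section radn.
Context (T : pseudoMetricType R) (U : set T).
Definition radn n (x : T) := Num.min 1 (n%:R * rad U x).

Lemma radn_continuous n : continuous (radn n).
Proof.
move=> x; apply: (@continuous_min _ _ (cst 1) (fun x => n%:R * rad U x)); first exact: cvg_cst.
apply: cvgM; [exact: cvg_cst|exact: rad_continuous].
Qed.

Lemma radn01 n x : 0 <= radn n x <= 1.
Proof. by rewrite /radn le_min ler01 mulr_ge0 ?rad_ge0//= ge_min lexx. Qed.

Lemma radn_out n x : ~ U x -> radn n x = 0.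
Proof. by move=> Ux; rewrite /radn rad_out// mulr0 min_r. Qed.

Lemma radn_in x : nbhs x U -> \forall n \near \oo, radn n x = 1.
Proof.
move=> /rad_gt0 r0; near=> n; rewrite /radn min_l//.
rewrite -ler_pdivrMr// div1r; near: n; exact: nbhs_infty_ger.
Unshelve. all: by end_near. Qed.
End radn.

Lemma open_approx_pseudoMetric (T : pseudoMetricType R) : open_approx T.
Proof.
move=> U oU; exists (radn U); split.
- exact: radn_continuous.
- exact: radn01.
- exact: radn_out.
- by move=> x Ux; apply: radn_in; exact: open_nbhs_nbhs.
Qed.

Lemma dense_countable_base (T : normedModType R) (D : nat -> T) :
  (forall x e, 0 < e -> exists n, ball (D n) e x) ->
  countable_base (fun n => if unpickle n is Some (i, k)
    then ball (D i) (k.+1%:R^-1) else set0 : set T).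
Proof.
move=> dD; split.
  by move=> n; case: unpickle => [[i k]|]; [exact: ball_open|exact: open0].
move=> x U /nbhs_ballP[e /= e0 eU].
have [k ke] : exists k : nat, k.+1%:R^-1 + k.+1%:R^-1 < e.
  have e2 : 0 < e / 2 by rewrite divr_gt0.
  have [k _ /(_ k (leqnn _))/= hk] := near_infty_natSinv_lt (PosNum e2).
  by exists k; rewrite (splitr e) ltrD.
have [|i Di] := dD x k.+1%:R^-1; first by rewrite invr_gt0.
exists (pickle (i, k)); rewrite pickleK; split => // y Dy; apply: eU.
apply: le_ball (ltW ke) _ _; apply: ball_triangle Dy; exact: ball_sym.
Qed.


(** * Openness, compactness and a Borel section of the torus projection *)

Section torus_topology.
Context (d : nat).
Notation Z := (torus R d).
Notation pr := (@to_torus R d).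

Lemma to_torus_eq (x y : 'rV[R]_d) : lattice_eq x y -> pr x = pr y.
Proof. by move=> xy; exact: (elimT (@eqquotP _ _ {eq_quot (@lattice_equiv R d)}%qT x y) xy). Qed.

Lemma to_torus_lattice (x y : 'rV[R]_d) : pr x = pr y -> lattice_eq x y.
Proof. by move=> xy; exact: (introT (@eqquotP _ _ {eq_quot (@lattice_equiv R d)}%qT x y) xy). Qed.

Lemma to_torusK (xi : Z) : pr (repr xi) = xi.
Proof. exact: reprK. Qed.

Lemma to_torus_continuous : continuous pr.
Proof. exact: pi_continuous. Qed.

Lemma ball_rV_shift (x y c : 'rV[R]_d) (r : R) : ball x r y -> ball (x + c) r (y + c).
Proof.
move=> [r0 h]; split=> // i j; have := h i j.
by rewrite !mxE /ball/= opprD addrACA subrr addr0.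
Qed.

(** The preimage of the image is the union of the lattice translates of U, and balls are translation
    invariant. *)
Lemma to_torus_open (U : set 'rV[R]_d) : open U -> open (pr @` U).
Proof.
move=> oU; suff : open (pr @^-1` (pr @` U)) by [].
rewrite openE => x [u Uu /to_torus_lattice ux].
have /nbhs_ballP[e /= e0 eU] : nbhs u U by exact: open_nbhs_nbhs.
apply/nbhs_ballP; exists e => //= y xy; exists (y + (u - x)).
  apply: eU; rewrite [X in ball X](_ : u = x + (u - x)); first exact: ball_rV_shift.
  by rewrite addrCA subrr addr0.
apply: to_torus_eq; apply/forallP => i; rewrite (_ : _ - _ = u ord0 i - x ord0 i); last by rewrite !mxE; ring.
by move/forallP : ux => /(_ i).
Qed.

Lemma torus_countable_base (B : nat -> set 'rV[R]_d) :
  countable_base B -> countable_base (fun n => pr @` B n).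
Proof.
move=> [oB hB]; split; first by move=> n; exact: to_torus_open.
move=> xi U nU; have := to_torus_continuous (x := repr xi); rewrite /continuous_at to_torusK => /(_ _ nU).
move=> /hB[n [Bn BU]]; exists n; split; first by exists (repr xi) => //; exact: to_torusK.
by move=> _ [y By <-]; exact: BU.
Qed.

(** The approximation is made on R^d for the preimage of V. That set is lattice invariant, hence so
    is its [rad], and the functions descend to the quotient. *)
Lemma open_approx_torus : open_approx Z.
Proof.
move=> V oV; pose U := pr @^-1` V.
have oU : open U by move/continuousP : to_torus_continuous; exact.
have inv x y : pr x = pr y -> forall n, radn U n x = radn U n y.
  suff h x' y' : pr x' = pr y' -> rad U x' <= rad U y'.
    move=> xy n; have xyr : rad U x = rad U y.
      by apply/le_anti/andP; split; apply: h; [exact: xy|exact: esym xy].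
    by rewrite /radn xyr.
  move=> xy; apply: ge_sup; first by exists 0; split; [rewrite lexx ler01|rewrite ltxx].
  move=> r [r01 rU]; apply: ub_le_sup; first by exists 1 => s [/andP[]].
  (* Translation by the lattice vector x' - y' carries the ball at y' to the ball at x' and
     preserves U. *)
  split => // r0 z yz; have := rU r0 (z + (x' - y')).
  have -> : U (z + (x' - y')) = U z.
    rewrite /U/=; congr V; apply: to_torus_eq; apply/forallP => i.
    rewrite (_ : _ - _ = x' ord0 i - y' ord0 i); last by rewrite !mxE; ring.
    by move/to_torus_lattice/forallP : xy => /(_ i).
  apply; rewrite [X in ball X](_ : x' = y' + (x' - y')); first exact: ball_rV_shift.
  by rewrite addrCA subrr addr0.
exists (fun n => radn U n \o repr); split.
- move=> n; apply: repr_comp_continuous; first exact: radn_continuous.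
  by move=> a b /eqP ab; apply/eqP; exact: inv.
- by move=> n x; exact: radn01.
- by move=> n x Vx; apply: radn_out; rewrite /U/= to_torusK.
- by move=> x Vx; apply: radn_in; apply: open_nbhs_nbhs; split => //; rewrite /U/= to_torusK.
Qed.

(** The representative in the cube [0, 1)^d: a Borel section, although a discontinuous one when d >
    0. *)
Definition torus_sec (xi : Z) : 'rV[R]_d :=
  \row_i (repr xi ord0 i - (Num.floor (repr xi ord0 i))%:~R).

Lemma torus_secK (xi : Z) : pr (torus_sec xi) = xi.
Proof.
rewrite -[RHS]to_torusK; apply: to_torus_eq; apply/forallP => i.
by rewrite mxE addrAC subrr add0r rpredN; exact: intr_int.
Qed.

Lemma torus_sec01 (xi : Z) i : 0 <= torus_sec xi ord0 i < 1.
Proof.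
rewrite mxE subr_ge0 floor_le_tmp/= ltrBlDl. 
have := floorD1_gt (repr xi ord0 i); by rewrite intrD.
Qed.

(** Two representatives in [0, 1) differ by an integer of modulus less than 1. *)
Lemma torus_sec_eq (x : 'rV[R]_d) i : 0 <= x ord0 i < 1 ->
  torus_sec (pr x) ord0 i = x ord0 i.
Proof.
move=> /andP[x0 x1]; have /andP[s0 s1] := torus_sec01 (pr x) i.
have /to_torus_lattice/forallP/(_ i)/intrP[z zE] : pr (torus_sec (pr x)) = pr x by exact: torus_secK.
have : -1 < (z%:~R : R) < 1.
  rewrite -zE; apply/andP; split; first by rewrite ltrBrDl; lra.
  by rewrite ltrBlDl; lra.
move=> h; have z0 : z = 0.
  have /andP[h1 h2] := h.
  have h3 : (z < 1)%R by rewrite -(ltr_int R).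
  have h4 : (-1 < z)%R by rewrite -(ltr_int R) mulrN1z.
  lia.
by move: zE; rewrite z0 => /eqP; rewrite subr_eq0 => /eqP.
Qed.

Lemma torus_compact : compact [set: Z].
Proof.
have -> : [set: Z] = pr @` [set v : 'rV[R]_d | forall i, `[0, 1]%classic (v ord0 i)].
  apply/seteqP; split => // xi _; exists (torus_sec xi); last exact: torus_secK.
  by move=> i /=; rewrite in_itv/=; have /andP[-> /ltW ->] := torus_sec01 xi i.
apply: continuous_compact; first by apply: continuous_subspaceT; exact: to_torus_continuous.
by apply: (@rV_compact _ d (fun=> `[0 : R, 1]%classic)) => i; exact: segment_compact.
Qed.

(** The sigma-algebra is generated by open sets, not by coordinates; [measurable_consrV] bridges the
    difference one coordinate at a time. *)
Lemma measurable_fun_rV {d'} {T : measurableType d'} n (f : T -> borel 'rV[R]_n) :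
  (forall i, @measurable_fun _ _ T (measurableTypeR R) setT (fun t => (f t : 'rV[R]_n) ord0 i)) ->
  measurable_fun setT f.
Proof.
elim: n f => [|n IH] f mf.
  rewrite (_ : f = cst (0 : 'rV[R]_0)); first exact: measurable_cst.
  by apply/funext => t; apply/rowP => -[].
rewrite (_ : f = fun t => @consrV R n (headrV (f t), tailrV (f t))).
  apply: (measurableT_comp (@measurable_consrV R n)).
  apply/measurable_fun_pair; first exact: mf.
  by apply: IH => i; under eq_fun do rewrite mxE; exact: mf.
apply/funext => t; apply/rowP => i; case: (unliftP ord0 i) => [j ->|->].
  by rewrite consrV_lift /= mxE.
by rewrite consrV0.
Qed.

(** For a >= 0, the points whose i-th representative coordinate exceeds a form the projection of the
    open slab a < x_i < 1, hence an open set. *)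
Lemma measurable_torus_sec :
  @measurable_fun _ _ (borel Z) (borel 'rV[R]_d) setT torus_sec.
Proof.
apply: measurable_fun_rV => i.
apply: (measurability _ (RGenOInfty.measurableE R)).
move=> _ [_ [a ->] <-]; rewrite setTI.
have [a0|a0] := ltP a 0.
  rewrite (_ : _ @^-1` _ = setT)//; apply/seteqP; split => // xi _ /=.
  by rewrite in_itv/= andbT; have /andP[h _] := torus_sec01 xi i; exact: lt_le_trans h.
rewrite (_ : _ @^-1` _ = pr @` [set x : 'rV[R]_d | `]a, 1[%classic (x ord0 i)]).
  apply: borel_open; apply: to_torus_open.
  by move/continuousP: (@coord_continuous R 1 d ord0 i); apply; exact: interval_open.
apply/seteqP; split => [xi|_ [x + <-]] /=; rewrite !in_itv/= ?andbT.
  move=> ax; exists (torus_sec xi); last exact: torus_secK.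
  by rewrite /= in_itv/= ax; have /andP[] := torus_sec01 xi i.
by move=> /andP[ax x1]; rewrite torus_sec_eq// (le_trans a0 (ltW ax)).
Qed.

End torus_topology.

Lemma rV_countable_base n : exists B : nat -> set 'rV[R]_n, countable_base B.
Proof.
pose D (i : nat) : 'rV[R]_n := if unpickle i is Some q then map_mx ratr (q : 'rV[rat]_n) else 0.
eexists; apply: (@dense_countable_base _ D) => x e e0.
have [q qx] := ball_rat x e0; by exists (pickle q); rewrite /D pickleK.
Qed.


(** * Finite-dimensional Euclidean spaces as retracts of R^n *)

Section euclidean_coordinates.
Context (E : normedModType R) (ip : E -> E -> R).
Hypothesis ipC : forall x y, ip x y = ip y x.
Hypothesis ipD : forall a x y z, ip (a *: x + y) z = a * ip x z + ip y z.
Hypothesis ipN : forall x, ip x x = `|x| ^+ 2.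

Lemma ip0 z : ip 0 z = 0.
Proof. by have := ipD 1 0 0 z; rewrite scaler0 add0r mul1r => h; lra. Qed.

Lemma ipDl x y z : ip (x + y) z = ip x z + ip y z.
Proof. by have := ipD 1 x y z; rewrite scale1r mul1r. Qed.

Lemma ipZl a x z : ip (a *: x) z = a * ip x z.
Proof. by have := ipD a x 0 z; rewrite addr0 ip0 addr0. Qed.

Lemma ipBl x y z : ip (x - y) z = ip x z - ip y z.
Proof. by rewrite ipDl -scaleN1r ipZl mulN1r. Qed.

Definition proj (u : seq E) (z : E) : E := \sum_(x <- u) ip z x *: x.

Lemma projD u z w : proj u (z + w) = proj u z + proj u w.
Proof. by rewrite /proj -big_split; apply: eq_bigr => x _; rewrite ipDl scalerDl. Qed.

Lemma projZ u a z : proj u (a *: z) = a *: proj u z.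
Proof. by rewrite /proj scaler_sumr; apply: eq_bigr => x _; rewrite ipZl scalerA. Qed.

Lemma ip_sum (I : Type) (s : seq I) (F : I -> E) z :
  ip (\sum_(i <- s) F i) z = \sum_(i <- s) ip (F i) z.
Proof.
by elim: s => [|a s IH]; rewrite ?big_nil ?ip0// !big_cons ipDl IH.
Qed.

Lemma proj_sum (I : Type) (s : seq I) (F : I -> E) u :
  proj u (\sum_(i <- s) F i) = \sum_(i <- s) proj u (F i).
Proof.
elim: s => [|a s IH]; rewrite ?big_nil ?big_cons ?projD ?IH//.
by rewrite /proj big1// => x _; rewrite ip0 scale0r.
Qed.

Lemma proj_sym u z w : ip (proj u z) w = ip z (proj u w).
Proof.
rewrite (ipC z) !ip_sum; apply: eq_bigr => x _; rewrite !ipZl (ipC x z) (ipC x w).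
by rewrite mulrC.
Qed.

(* Gram-Schmidt, keeping only the idempotence of the projection on the span. *)
Lemma gram_schmidt (s : seq E) : exists u : seq E,
  {in u, forall x, proj u x = x} /\ {in s, forall x, proj u x = x}.
Proof.
elim: s => [|v s [u [uu us]]]; first by exists [::].
pose w := v - proj u v.
have wu x : x \in u -> ip w x = 0.
  by move=> xu; rewrite ipBl proj_sym uu// subrr.
have [w0|w0] := eqVneq w 0.
  exists u; split => // x; rewrite inE => /predU1P[->|]; last exact: us.
  by apply/esym/eqP; rewrite -subr_eq0 -/w w0.
pose h := `|w|^-1 *: w.
have nw : `|w| != 0 by rewrite normr_eq0.
have hh : ip h h = 1 by rewrite ipN normrZ normfV normr_id mulVf// expr1n.
have hu x : x \in u -> ip h x = 0 by move=> xu; rewrite ipZl wu// mulr0.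
have pu x : proj (h :: u) x = ip x h *: h + proj u x by rewrite /proj big_cons.
have puh : proj u h = 0 by rewrite /proj big_seq big1// => x xu; rewrite hu// scale0r.
have fix_u x : proj u x = x -> proj (h :: u) x = x.
  move=> px; rewrite pu px -{1}px proj_sym puh ipC ip0 scale0r add0r//.
exists (h :: u); split => x; rewrite inE => /predU1P[->|xu].
- by rewrite pu hh scale1r puh addr0.
- by apply: fix_u; exact: uu.
- have -> : v = w + proj u v by rewrite subrK.
  rewrite projD (_ : proj (h :: u) (proj u v) = proj u v); last first.
    apply: fix_u; rewrite {2}/proj proj_sum /proj big_seq [RHS]big_seq; apply: eq_bigr => y yu.
    by rewrite -/(proj u _) projZ uu.
  congr (_ + _); rewrite (_ : w = `|w| *: h); last by rewrite scalerA divff// scale1r.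
  by rewrite projZ pu hh scale1r puh addr0.
- by apply: fix_u; exact: us.
Qed.

(** Polarisation transfers continuity and boundedness from the norm to the inner product, about
    which only its algebra is assumed. *)
Lemma ip_polar z u : ip z u = 4^-1 * (`|z + u| ^+ 2 - `|z - u| ^+ 2).
Proof.
have ipDr x y z' : ip x (y + z') = ip x y + ip x z' by rewrite ipC ipDl !(ipC x).
have ipNr x y : ip x (- y) = - ip x y by rewrite ipC -scaleN1r ipZl mulN1r ipC.
have ipNl x y : ip (- x) y = - ip x y by rewrite -scaleN1r ipZl mulN1r.
by rewrite -!ipN !ipDl !ipDr !(ipNl, ipNr) (ipC u z); field.
Qed.

(** Coarser than Cauchy-Schwarz, but it follows from polarisation at once, and bounded coordinates
    on balls suffice for compactness. *)
Lemma ip_bound r z u : `|z| <= r -> `|ip z u| <= (r + `|u|) ^+ 2.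
Proof.
move=> zr; have h w : `|w| = `|u| -> `|z + w| ^+ 2 <= (r + `|u|) ^+ 2.
  move=> wu; have r0 : 0 <= r by exact: le_trans zr.
  rewrite ler_pXn2r ?nnegrE ?addr_ge0//.
  by apply: le_trans (ler_normD _ _) _; rewrite wu lerD2r.
have h1 := h u erefl; have h2 := h (- u) (normrN _).
have h3 : 0 <= `|z + u| ^+ 2 by rewrite exprn_ge0.
have h4 : 0 <= `|z - u| ^+ 2 by rewrite exprn_ge0.
by rewrite ip_polar ler_norml; apply/andP; split; lra.
Qed.

Lemma ip_continuous u : continuous (ip ^~ u).
Proof.
rewrite (_ : ip^~ u = fun z => 4^-1 * (`|z + u| ^+ 2 - `|z - u| ^+ 2)); last by apply/funext => z; exact: ip_polar.
move=> z; apply: cvgM; first exact: cvg_cst.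
have sq (g : E -> R) : g @ z --> g z -> (fun x => g x ^+ 2) @ z --> g z ^+ 2.
  by move=> h; rewrite expr2; under eq_fun do rewrite expr2; exact: cvgM.
apply: cvgB; apply: sq; apply: cvg_norm.
  by apply: cvgD; [exact: cvg_id|exact: cvg_cst].
by apply: cvgB; [exact: cvg_id|exact: cvg_cst].
Qed.

End euclidean_coordinates.

Lemma continuous_sum (T : topologicalType) (V : normedModType R) (I : Type) (s : seq I)
    (F : I -> T -> V) :
  (forall i, continuous (F i)) -> continuous (fun t => \sum_(i <- s) F i t).
Proof.
move=> cF; elim: s => [|i s IH] t.
  by under eq_fun do rewrite big_nil; exact: cvg_cst.
rewrite (_ : (fun t => _) = fun t => F i t + \sum_(i <- s) F i t); last first.
  by apply/funext => u; rewrite big_cons.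
by apply: cvgD; [exact: cF|exact: IH].
Qed.

(** It is enough that the projection on the span of [u] is the identity: then [s] is a continuous
    left inverse of [c], so E is a retract of R^n. Compact balls, a countable base and
    disintegration are all inherited through this retraction. *)
Lemma euclidean_coordinates (E : normedModType R) : euclidean E ->
  exists n (c : E -> 'rV[R]_n) (s : 'rV[R]_n -> E),
  [/\ continuous c, continuous s, cancel c s & forall r, exists B : 'I_n -> R, forall z i, `|z| <= r -> `|c z ord0 i| <= B i].
Proof.
move=> [[m [e espan]] [ip [ipC ipD ipN]]].
have [u [_ ue]] := gram_schmidt ipC ipD ipN (codom e).
have pu z : proj ip u z = z.
  have [c ->] := espan z; rewrite proj_sum//; apply: eq_bigr => i _.
  by rewrite projZ// ue// codom_f.
exists (size u), (fun z => \row_i ip z u`_i), (fun r => \sum_(i < size u) r ord0 i *: u`_i); split.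
- move=> z A /nbhs_ballP[r /= r0 rA].
  have h (i : 'I_(size u)) : \forall w \near z, ball (ip z u`_i) r (ip w u`_i).
    by apply: (ip_continuous ipC ipD ipN (u := u`_i)); exact: nbhsx_ballx.
  suff : \forall w \near z, A (\row_i ip w u`_i) by [].
  apply: filterS (filter_forall _ h) => w hw; apply: rA; split => // i j.
  by rewrite !mxE; exact: hw.
- apply: (@continuous_sum _ _ _ _ (fun i (r : 'rV[R]_(size u)) => r ord0 i *: u`_i)) => i r.
  have h := @coord_continuous R 1 (size u) ord0 i r.
  exact: (cvgZ h (cvg_cst u`_i)).
- move=> z; rewrite -[RHS]pu /proj (big_nth 0) big_mkord; apply: eq_bigr => i _.
  by rewrite mxE.
- move=> r; exists (fun i => (r + `|u`_i|) ^+ 2) => z i zr.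
  by rewrite mxE; exact: (ip_bound ipC ipD ipN).
Qed.

Lemma euclidean_ball_compact (E : normedModType R) : euclidean E ->
  forall r, compact [set z : E | `|z| <= r].
Proof.
move=> /euclidean_coordinates[n [c [s [cc cs csK cB]]]] r.
have [B hB] := cB r.
apply: (@subclosed_compact _ _ (s @` [set v : 'rV[R]_n | forall i, `[- B i, B i]%classic (v ord0 i)])).
- rewrite (_ : [set z | _] = (fun z : E => `|z|) @^-1` [set x : R | x <= r])//.
  apply: preimage_closed; [by move=> x _; exact: norm_continuous|exact: closed_le].
- apply: continuous_compact; first by apply: continuous_subspaceT.
  by apply: (@rV_compact _ n (fun i => `[- B i, B i]%classic)) => i; exact: segment_compact.
- move=> z zr; exists (c z); last exact: csK.
  by move=> i /=; rewrite in_itv/= -ler_norml; exact: hB.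
Qed.

(** The base sets are bounded so that a continuous function vanishing off one of them is in C_0(E),
    the class on which weak-* measurability is tested. *)
Lemma euclidean_countable_base (E : normedModType R) : euclidean E ->
  exists B : nat -> set E, countable_base B /\
    forall n, exists r, B n `<=` [set z | `|z| <= r].
Proof.
move=> /euclidean_coordinates[n [c [s [cc cs csK _]]]].
pose D (i : nat) : E := if unpickle i is Some q then s (map_mx ratr (q : 'rV[rat]_n)) else 0.
eexists; split.
  apply: (@dense_countable_base _ D) => x e e0.
  have : \forall v \near c x, ball x e (s v).
    by have := cs (c x); rewrite /continuous_at csK; apply; exact: nbhsx_ballx.
  move=> /nbhs_ballP[r /= r0 hr]; have [q qx] := ball_rat (c x) r0.
  exists (pickle q); rewrite /D pickleK; apply: ball_sym; apply: hr; exact: ball_sym.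
move=> m /=; case: unpickle => [[i k]|]; last by exists 0 => x.
exists (`|D i| + k.+1%:R^-1) => z; rewrite -ball_normE/= => h.
rewrite -(subrK (D i) z) addrC (le_trans (ler_normD _ _))// lerD2l distrC ltW//.
Qed.

Lemma continuous_within_generated (A : pointedType) (G : set (set A)) (K : set A)
    (g : A -> R) :
  measurable (K : set (g_sigma_algebraType G)) ->
  (forall a b, exists2 W, G W & W `&` K = g @^-1` `]a, b[%classic `&` K) ->
  @measurable_fun _ _ (g_sigma_algebraType G) (measurableTypeR R) K g.
Proof.
move=> mK h; apply: (measurability _ (RGenOpens.measurableE R)).
move=> _ [V [a [b ->]] <-]; have [W GW WE] := h a b.
by rewrite setIC -WE; apply: measurableI => //; exact: sub_sigma_algebra.
Qed.

Lemma continuous_within_preimage (T : topologicalType) (K : set T) (g : T -> R) (a b : R) :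
  {within K, continuous g} -> exists2 W, open W & W `&` K = g @^-1` `]a, b[%classic `&` K.
Proof.
move=> /continuousP cg; apply/open_subspaceP.
by apply: cg; exact: interval_open.
Qed.

Lemma continuous_within_measurable (T : ptopologicalType) (K : set T) (g : T -> R) :
  closed K -> {within K, continuous g} ->
  @measurable_fun _ _ (borel T) (measurableTypeR R) K g.
Proof.
move=> cK cg; apply: continuous_within_generated.
  by apply: generated_closed; exact: closed_openC.
by move=> a b; exact: continuous_within_preimage.
Qed.

Lemma continuous_within_bounded (T : topologicalType) (K : set T) (g : T -> R) :
  compact K -> {within K, continuous g} -> exists C, 0 <= C /\ forall x, K x -> `|g x| <= C.
Proof.
move=> cK cg; have /compact_bounded[C [_ hC]] := continuous_compact cg cK.
exists (`|C| + 1); split => [|x Kx]; first by rewrite addr_ge0.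
by apply: hC; [rewrite (le_lt_trans (ler_norm _))// ltrDl|exists x].
Qed.

End topology.

(** * Borel versions of weak-* measurable families *)

Section borel_version.
Context {R : realType}.
Local Open Scope ereal_scope.

Lemma indic_approx_cvg {d} {T : measurableType d} (m : {measure set T -> \bar R})
    (D U : set T) (f : nat -> T -> R) :
  m D < +oo -> measurable D -> measurable U ->
  (forall n, measurable_fun setT (f n)) -> (forall n x, 0 <= f n x <= 1)%R ->
  (forall n x, ~ U x -> f n x = 0%R) ->
  (forall x, U x -> \forall n \near \oo, f n x = 1%R) ->
  \int[m]_(x in D) (f n x)%:E @[n --> \oo] --> m (U `&` D).
Proof.
move=> mD mmD mU mf f01 f0 f1.
rewrite -integral_indic//.
have [] // := @dominated_convergence _ _ _ m D mmD (fun n x => (f n x)%:E)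
  (fun x => (\1_U x)%:E) (cst 1).
- move=> n; apply/measurable_EFinP; exact: (measurable_funS measurableT).
- by apply/measurable_EFinP; exact: measurable_indic.
- apply: aeW => x Dx; have [Ux|Ux] := pselect (U x).
    rewrite indicE mem_set//; apply: cvg_near_cst.
    by apply: filterS (f1 x Ux) => n ->.
  rewrite indicE memNset//; apply: cvg_near_cst.
  by near=> n; rewrite f0.
- apply/integrableP; split => //; rewrite (eq_integral (cst 1)).
    by rewrite integral_cst// mul1e.
  by move=> t _; rewrite gee0_abs.
- apply: aeW => x n Dx; have /andP[h0 h1] := f01 n x.
  by rewrite abse_EFin ger0_norm// lee_fin.
Unshelve. all: by end_near. Qed.

(** Superlevel sets at rational levels generate the rest, so countably many null sets, one per
    level, are all that has to be removed. *)
Lemma completed_ae_measurable {d} {T : measurableType d} (m : {measure set T -> \bar R})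
    (D : set T) (f : T -> \bar R) :
  measurable D -> completed_measurable_fun m D f ->
  exists N, [/\ measurable N, m N = 0 & measurable_fun (D `\` N) f].
Proof.
move=> mD cf.
have H (q : rat) : exists BN : set T * set T, [/\ measurable BN.1, measurable BN.2, m BN.2 = 0 &
    forall t, ~ BN.2 t -> (D t /\ (ratr q)%:E < f t <-> BN.1 t)].
  have [|B mB [N [mN N0 sN]]] := cf [set` `](ratr q)%:E, +oo[].
    by exact: emeasurable_itv.
  exists (B, N); split => // t /= Nt; split => [[Dt ft]|Bt].
    apply: contrapT => Bt; apply: Nt; apply: sN; left; split => //; split => //=.
    by rewrite in_itv/= andbT.
  have : (D `&` f @^-1` [set` `](ratr q)%:E, +oo[]) t.
    by apply: contrapT => ht; apply: Nt; apply: sN; right; split.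
  by move=> [Dt /=]; rewrite in_itv/= andbT.
have /choice[BN BNE] := H.
have [mN N0] := @null_bigcup _ _ _ m rat (fun q => (BN q).2)
  (fun q => ltac:(by case: (BNE q))) (fun q => ltac:(by case: (BNE q))).
exists (\bigcup_q (BN q).2); split => //.
have mDN : measurable (D `\` \bigcup_q (BN q).2) by exact: measurableD.
apply: (measurability _ (ErealGenOInfty.measurableE R)) => //.
move=> _ [_ [x ->] <-].
rewrite (_ : _ `&` _ = (D `\` \bigcup_q (BN q).2) `&`
   \bigcup_(q in [set q : rat | (x < ratr q)%R]) (BN q).1).
  apply: measurableI => //; rewrite bigcup_mkcond; apply: bigcupT_measurable_rat => q.
  by case: ifPn => // _; case: (BNE q).
apply/seteqP; split => t [[Dt Nt]] /=.
  rewrite in_itv/= andbT => xf; split; first by [].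
  have [q xq qf] : exists2 q : rat, (x < ratr q)%R & (ratr q)%:E < f t.
    case: (f t) xf => [y| |] // xy.
    - rewrite lte_fin in xy; have [q] := rat_in_itvoo xy.
      by rewrite in_itv/= => /andP[? ?]; exists q.
    - have [q] : exists q : rat, ratr q \in `]x, (x + 1)%R[ by apply: rat_in_itvoo; rewrite ltrDl.
      by rewrite in_itv/= => /andP[? ?]; exists q => //; rewrite ltry.
  exists q => //; have [_ _ _ /(_ t) h] := BNE q.
  by apply: (h (fun hh => Nt (ex_intro2 _ _ q I hh))).1.
move=> [q xq Bq]; split => //; rewrite in_itv/= andbT.
have [_ _ _ /(_ t) h] := BNE q.
have [_ qf] := (h (fun hh => Nt (ex_intro2 _ _ q I hh))).2 Bq.
by apply: lt_trans qf; rewrite lte_fin.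
Qed.

(** The countable pi-system generated by the base; the empty list gives the whole space. *)
Definition finI (Y : Type) (B : nat -> set Y) (s : seq nat) : set Y :=
  foldr (fun n A => B n `&` A) setT s.

Lemma finI_cat (Y : Type) (B : nat -> set Y) s s' :
  finI B (s ++ s') = finI B s `&` finI B s'.
Proof. by elim: s => [|n s IH] /=; rewrite ?setTI// IH setIA. Qed.

(** Finite intersections of base sets form a countable pi-system generating the Borel sets. The mass
    of each is a limit of integrals of C_0 functions, so off a single null set all these masses are
    measurable in t; the Dynkin argument extends this to Borel sets. [N0] holds the points at which
    [nu t] may charge the complement of S. *)
Lemma borel_version {d} {T : measurableType d} (m : {measure set T -> \bar R})
    (D : set T) (Y : ptopologicalType) (S : set Y) (B : nat -> set Y)
    (nu : T -> probability (borel Y) R) (N0 : set T) :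
  measurable D -> countable_base B -> @open_approx R Y ->
  (forall n phi, continuous phi -> (forall x, ~ B n x -> phi x = 0%R) -> @C0 R Y S phi) ->
  measurable (S : set (borel Y)) ->
  measurable N0 -> m N0 = 0 -> (forall t, D t -> ~ N0 t -> nu t S = 1) ->
  weakstar_measurable m D S nu ->
  exists k : T -> probability (borel Y) R, mker k /\
    exists N, [/\ measurable N, m N = 0 & forall t, D t -> ~ N t -> k t = nu t].
Proof.
move=> mD cB OA C0B mS mN0 N00 nuS wnu.
have oI s : open (finI B s).
  by elim: s => [|n s IH] /=; [exact: openT|apply: openI => //; exact: cB.1].
have /choice[phi phiE] : forall s, exists f : nat -> Y -> R,
  [/\ forall n, continuous (f n), forall n x, (0 <= f n x <= 1)%R,
      forall n x, ~ finI B s x -> f n x = 0%R &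
      forall x, finI B s x -> \forall n \near \oo, f n x = 1%R] by move=> s; exact: OA.
have H (p : seq nat * nat) : exists N, [/\ measurable N, m N = 0 & p.1 != [::] ->
    measurable_fun (D `\` N) (fun t => \int[nu t]_(x in S) (phi p.1 p.2 x)%:E)].
  case: p => s j /=; have [->|s0] := eqVneq s [::]; first by exists set0; split.
  have [c01 c02 c03 c04] := phiE s.
  have [|N [? ? ?]] := @completed_ae_measurable _ _ m D _ mD (wnu (phi s j) _).
    (* The approximants vanish off the first base set of the list, hence are in C_0. The empty list
       stands apart: the constant 1 need not be in C_0, but the total mass is 1 anyway. *)
    case: s s0 c01 c02 c03 c04 => // n s _ c01 c02 c03 c04.
    by apply: (C0B n) => // x Bx; apply: c03 => -[].
  by exists N.
have /choice[N1 N1E] := H.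
have [mU U0] := @null_bigcup _ _ _ m _ N1
  (fun q => ltac:(by case: (N1E q))) (fun q => ltac:(by case: (N1E q))).
pose N := N0 `|` \bigcup_p N1 p.
have mN : measurable N by exact: measurableU.
have mDN : measurable (D `\` N) by exact: measurableD.
have nuI s t : D t -> ~ N t -> s != [::] ->
    \int[nu t]_(x in S) (phi s j x)%:E @[j --> \oo] --> nu t (finI B s).
  move=> Dt Nt s0; have [c01 c02 c03 c04] := phiE s.
  have mI : measurable (finI B s : set (borel Y)) by exact: borel_open.
  (* Weak-* measurability integrates over S only, so the mass outside S has to be discarded
     first. *)
  have -> : nu t (finI B s) = nu t (finI B s `&` S).
    have nS : nu t (~` S) = 0.
      by rewrite probability_setC// nuS ?subee// => h; apply: Nt; left.
    rewrite -[in LHS](setIT (finI B s)) -(setUv S) setIUr measureU//.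
    - rewrite [X in (_ + X)%R](_ : _ = 0); first by rewrite addr0.
      apply: (subset_measure0 _ (measurableC mS)) => //.
      by apply: measurableI => //; exact: measurableC.
    - exact: measurableI.
    - by apply: measurableI => //; exact: measurableC.
    - by rewrite setIACA setICr setI0.
  apply: indic_approx_cvg => //.
  - by apply: le_lt_trans (probability_le1 _ mS) _; rewrite ltry.
  - move=> n.
    have := @continuous_within_measurable R Y setT (phi s n) closedT.
    by apply; apply: continuous_subspaceT; exact: c01.
(* A fixed probability on the exceptional set and off D makes [k] measurable on all of [T]. *)
pose P0 : probability (borel Y) R := @dirac _ (borel Y) (point : Y) R.
pose k t := if `[< (D `\` N) t >] then nu t else P0.
have kin t : (D `\` N) t -> k t = nu t by move=> h; rewrite /k asboolT.
have kout t : (~` (D `\` N)) t -> k t = P0 by move=> h; rewrite /k asboolF.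
exists k; split; last first.
  exists N; split => //; first exact: null_set_setU.
  by move=> t Dt Nt; exact: kin.
have mkI s : measurable_fun setT (fun t => k t (finI B s)).
  have [->|s0] := eqVneq s [::].
    by under eq_fun do rewrite /= probability_setT; exact: measurable_cst.
  rewrite -(setUv (D `\` N)); apply/measurable_funU => //; first exact: measurableC.
  split.
  - apply: (@emeasurable_fun_cvg _ _ _ _ (fun j t => \int[nu t]_(x in S) (phi s j x)%:E)).
      move=> j; have [mN1 _ mf] := N1E (s, j).
      apply: (measurable_funS _ _ (mf s0)); first exact: measurableD.
      by apply: setDS => t h; right; exists (s, j).
    by move=> t tDN; rewrite kin//; case: tDN => Dt Nt; exact: nuI.
  - apply: (@eq_measurable_fun _ _ _ _ _ (cst (P0 (finI B s)))).
      by move=> t; rewrite inE => h; rewrite kout.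
    exact: measurable_cst.
have mG : @measurable _ (borel Y) = <<s range (finI B) >>.
  apply: (@sigma_base Y (@open Y) (range (finI B))); first by move=> _ [s _ <-]; exact: oI.
  move=> U oU; eexists; last exact: (countable_base_bigcup cB oU).
  move=> n /=; case: asboolP => _; last by right.
  by left; exists [:: n] => //=; rewrite setIT.
move=> A; rewrite mG.
apply: (@dynkin_induction _ (borel Y) (range (finI B)) (fun A => measurable_fun setT (fun t => k t A))) => //.
- by move=> _ _ [s _ <-] [s' _ <-]; exists (s ++ s') => //; exact: finI_cat.
- by under eq_fun do rewrite probability_setT; exact: measurable_cst.
- by move=> _ [s _ <-]; exact: mkI.
- move=> C mC h; under eq_fun do rewrite probability_setC//.
  by apply: emeasurable_funB => //; exact: measurable_cst.
- move=> F mF tF h.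
  rewrite (_ : (fun t => _) = fun t => \sum_(n <oo) k t (F n)).
    by apply: ge0_emeasurable_sum.
  by apply/funext => t; rewrite measure_bigcup//; apply: eq_eseriesl => i; rewrite in_setT.
Qed.

End borel_version.

(** * Iterated integrals, null sections and integration against charges *)

Section integration.
Context {R : realType}.
Local Open Scope ereal_scope.

(** Finiteness of the iterated integral makes the inner integrals finite only almost everywhere;
    elsewhere the inner subtraction may fail, so the identity is taken modulo a null set. *)
Lemma nested_integral_sub {d1 d2} {T1 : measurableType d1} {T2 : measurableType d2}
    (m : {measure set T1 -> \bar R}) (D : set T1) (k : T1 -> probability T2 R)
    (a b : T1 * T2 -> \bar R) :
  measurable D -> mker k -> nnm a -> nnm b ->
  \int[m]_(x in D) \int[k x]_y a (x, y) < +oo ->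
  \int[m]_(x in D) \int[k x]_y b (x, y) < +oo ->
  \int[m]_(x in D) \int[k x]_y (a (x, y) - b (x, y)) =
  \int[m]_(x in D) \int[k x]_y a (x, y) - \int[m]_(x in D) \int[k x]_y b (x, y).
Proof.
move=> mD mk na nb ia ib.
have int (c : T1 * T2 -> \bar R) : nnm c -> \int[m]_(x in D) \int[k x]_y c (x, y) < +oo ->
    m.-integrable D (fun x => \int[k x]_y c (x, y)).
  move=> nc ic; have [nA mA] := nnm_mker_integral mk nc; apply/integrableP; split.
    exact: (measurable_funS measurableT).
  by under eq_integral do rewrite gee0_abs//.
have [Na [mNa Na0 hNa]] := integrable_ae mD (int _ na ia).
have [Nb [mNb Nb0 hNb]] := integrable_ae mD (int _ nb ib).
rewrite -integralB//; [|exact: int|exact: int].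
apply: (@integral_eq_off_null _ _ _ m D (Na `|` Nb)).
- exact: measurableU.
- exact: null_set_setU.
move=> x Dx /not_orP[nNa nNb].
have fin (N : set T1) (c : T1 * T2 -> \bar R) : nnm c -> ~ N x ->
  ~` (fun x => D x -> (\int[k x]_y c (x, y)) \is a fin_num) `<=` N ->
  (k x).-integrable setT (fun y => c (x, y)).
  move=> nc Nx hN; have [nA mA] := nnm_pair1 x nc; apply/integrableP; split => //.
  under eq_integral do rewrite gee0_abs//.
  suff : (\int[k x]_y c (x, y)) \is a fin_num by rewrite ge0_fin_numE// integral_ge0.
  by apply: contrapT => h; apply: Nx; apply: hN => /= /(_ Dx).
by rewrite integralB//; [exact: (fin Na)|exact: (fin Nb)].
Qed.

Lemma null_sections {d1 d2} {T1 : measurableType d1} {T2 : measurableType d2}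
    (m : {measure set T1 -> \bar R}) (k : T1 -> probability T2 R) (N : set (T1 * T2)) :
  mker k -> measurable N -> \int[m]_x k x (xsection N x) = 0 ->
  exists N', [/\ measurable N', m N' = 0 & forall x, ~ N' x -> k x (xsection N x) = 0].
Proof.
move=> mk mN N0.
have mkN : measurable_fun setT (fun x => k x (xsection N x)).
  rewrite (_ : (fun x => _) = fun x => \int[k x]_y (\1_N (x, y))%:E).
    exact: (mker_integral mk (nnm_indic mN)).
  apply/funext => x; rewrite -[in LHS](setIT (xsection N x)) -integral_indic//; last exact: measurable_xsection.
  by apply: eq_integral => y _; rewrite !indicE mem_xsection.
have [N' [mN' N'0 h]] := (ae_eq_integral_abs m measurableT mkN).1
  (etrans (eq_integral _ _ (fun x _ => gee0_abs (measure_ge0 (k x) _))) N0).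
exists N'; split => // x Nx; apply: contrapT => hx; apply: Nx; apply: h => /= /(_ I).
exact: hx.
Qed.

Lemma weakstar_measurable_eq {d} {T : measurableType d} (mu1 mu2 : set T -> \bar R)
    (D : set T) (Y : ptopologicalType) (S : set Y) (nu : T -> probability (borel Y) R) :
  (forall A, measurable A -> mu1 A = mu2 A) ->
  weakstar_measurable mu1 D S nu -> weakstar_measurable mu2 D S nu.
Proof.
move=> mu12 w phi C0phi B mB; have [C mC [N [mN N0 hN]]] := w phi C0phi B mB.
by exists C => //; exists N; split => //; rewrite -mu12.
Qed.

Lemma mker_weakstar {d} {T : measurableType d} (mu : set T -> \bar R) (D : set T)
    (Y : ptopologicalType) (S : set Y) (k : T -> probability (borel Y) R) :
  mu set0 = 0 -> measurable D -> closed S -> mker k -> weakstar_measurable mu D S k.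
Proof.
move=> mu0 mD cS mk phi [cphi _] B mB.
have mS : measurable (S : set (borel Y)).
  by rewrite -(setCK S); apply: measurableC; apply: borel_open; exact: closed_openC.
have mphi := continuous_within_measurable cS cphi.
have mp : @measurable_fun _ _ (borel Y) _ setT ((EFin \o phi) \_ S).
  by apply/(measurable_restrictT _ mS); exact/measurable_EFinP.
exists (D `&` (fun t => \int[k t]_(x in S) (phi x)%:E) @^-1` B); last first.
  by exists set0; split => // t [[? []]|[? []]].
suff mf : measurable_fun setT (fun t => \int[k t]_(x in S) (phi x)%:E).
  by apply: measurableI => //; rewrite -[X in measurable X]setTI; exact: mf.
have nn (f : borel Y -> \bar R) : nnm f -> measurable_fun setT (fun t => \int[k t]_x f x).
  move=> nf; exact: (@mker_integral _ _ _ T (borel Y) k mk (fun p => f p.2)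
     (nnm_comp (h := snd) measurable_snd nf)).
rewrite (_ : (fun t => _) = fun t => \int[k t]_x ((EFin \o phi) \_ S)^\+ x - \int[k t]_x ((EFin \o phi) \_ S)^\- x).
  apply: emeasurable_funB; apply: nn; split.
  - by move=> x; exact: funepos_ge0.
  - exact: measurable_funepos.
  - by move=> x; exact: funeneg_ge0.
  - exact: measurable_funeneg.
by apply/funext => t; rewrite integral_mkcond integralE.
Qed.

Lemma mker_completed {d} {T : measurableType d} (mu : set T -> \bar R) (D : set T)
    (f : T -> \bar R) :
  mu set0 = 0 -> measurable D -> measurable_fun setT f -> completed_measurable_fun mu D f.
Proof.
move=> mu0 mD mf B mB; exists (D `&` f @^-1` B); last by exists set0; split => // t [[? []]|[? []]].
by apply: measurableI => //; rewrite -[X in measurable X]setTI; exact: mf.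
Qed.

Section charges.
Context {d} {T : measurableType d}.

(** The two measures are the Jordan parts. For a positive charge the negative part vanishes, being
    minus the charge of a subset of the negative Hahn set. *)
Lemma cintegralE (mu : {charge set T -> \bar R}) : exists m1 m2 : {finite_measure set T -> \bar R},
  (forall A, measurable A -> mu A = m1 A - m2 A) /\
  (forall D f, cintegral mu D f = \int[m1]_(x in D) (f x)%:E - \int[m2]_(x in D) (f x)%:E) /\
  (positive_charge mu -> forall A, measurable A -> m2 A = 0).
Proof.
rewrite /cintegral; case: cid => P hP; case: cid => N hPN.
exists (jordan_pos hPN), (jordan_neg hPN); split; last split => //.
  by move=> A mA; rewrite {1}(jordan_decomp hPN mA) /cadd/= cscaleN1.
move=> pmu A mA; have [_ negN _ _] := hPN.
apply/eqP; rewrite eq_le measure_ge0 andbT.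
have E : (jordan_neg hPN : {finite_measure set T -> \bar R}) A = - mu (A `&` N).
  by have := jordan_negE hPN A; rewrite cjordan_negE /crestr0 mem_set.
rewrite [leLHS]E leeNl oppe0.
by apply: pmu; apply: measurableI => //; case: negN.
Qed.

Lemma positive_charge_measure (mu : {charge set T -> \bar R}) : positive_charge mu ->
  exists m : {finite_measure set T -> \bar R}, forall A, measurable A -> mu A = m A.
Proof.
move=> pmu; have [m1 [m2 [muE [_ /(_ pmu) m20]]]] := cintegralE mu.
by exists m1 => A mA; rewrite muE// (m20 A mA) sube0.
Qed.

Lemma cintegral_positive (mu : {charge set T -> \bar R}) (m : {measure set T -> \bar R}) D f :
  measurable D ->
  (forall A, measurable A -> mu A = m A) -> cintegral mu D f = \int[m]_(x in D) (f x)%:E.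
Proof.
move=> mD mum; have [m1 [m2 [muE [-> m20]]]] := cintegralE mu.
have {}m20 A : measurable A -> m2 A = 0.
  by move=> mA; apply: m20 => // B mB; rewrite mum.
rewrite [X in _ - X](_ : _ = 0); last first.
  rewrite (eq_measure_integral mzero); last by move=> A mA _; exact: m20.
  exact: integral_measure_zero.
rewrite sube0; apply: eq_measure_integral => A mA _.
by rewrite -[RHS]mum// muE// (m20 _ mA) sube0.
Qed.

End charges.

End integration.

(** * The ambient product space, its compactification and recession functions *)

Section spaces.
Context {R : realType} {d : nat} (Omega : set 'rV[R]_d) (E : normedModType R).
Hypothesis hE : euclidean E.
Notation X := 'rV[R]_d.
Notation Z := (torus R d).
Notation bX := (borel 'rV[R]_d).
Notation bZ := (borel (torus R d)).
Notation bE := (borel E).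
Notation P := (borel ('rV[R]_d * torus R d * E)%type).

Lemma measurable_toP :
  @measurable_fun _ _ (bX * bZ * bE)%type P setT id.
Proof.
have [BX cX] := @rV_countable_base R d.
have cZ := torus_countable_base cX.
have [BE [cE _]] := euclidean_countable_base hE.
have m1 : @measurable_fun _ _ (bX * bZ)%type (borel (X * Z)%type) setT id.
  by apply: measurable_to_generated => W; exact: (countable_base_rect cX cZ).
have m2 : @measurable_fun _ _ (borel (X * Z)%type * bE)%type P setT id.
  apply: measurable_to_generated => W.
  exact: (countable_base_rect (countable_base_prod cX cZ) cE).
have m3 : @measurable_fun _ _ (bX * bZ * bE)%type (borel (X * Z)%type * bE)%type setT
    (fun p => (p.1, p.2)).
  apply/measurable_fun_pair; last exact: measurable_snd.
  exact: (measurableT_comp m1 measurable_fst).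
rewrite (_ : id = id \o (fun p : X * Z * E => (p.1, p.2))); last by apply/funext => -[].
exact: (measurableT_comp m2 m3).
Qed.

Lemma measurable_fromP :
  @measurable_fun _ _ P (bX * bZ * bE)%type setT id.
Proof.
have m1 : @measurable_fun _ _ (borel (X * Z)%type) (bX * bZ)%type setT id.
  by apply: measurable_from_generated => W oW; apply: open_comp oW => p _; [exact: cvg_fst|exact: cvg_snd].
have m2 : @measurable_fun _ _ P (borel (X * Z)%type * bE)%type setT id.
  by apply: measurable_from_generated => W oW; apply: open_comp oW => p _; [exact: cvg_fst|exact: cvg_snd].
have m3 : @measurable_fun _ _ (borel (X * Z)%type * bE)%type (bX * bZ * bE)%type setT
    (fun p => (p.1, p.2)).
  apply/measurable_fun_pair; last exact: measurable_snd.
  exact: (measurableT_comp m1 measurable_fst).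
rewrite (_ : id = (fun p : X * Z * E => (p.1, p.2)) \o id); last by apply/funext => -[].
exact: (measurableT_comp m3 m2).
Qed.

Lemma nnm_toP (f : X * Z * E -> \bar R) :
  @nnm R _ (bX * bZ * bE)%type f -> @nnm R _ P f.
Proof. exact: (nnm_comp measurable_fromP). Qed.

Lemma nnm_fromP (f : X * Z * E -> \bar R) :
  @nnm R _ P f -> @nnm R _ (bX * bZ * bE)%type f.
Proof. exact: (nnm_comp measurable_toP). Qed.

Lemma measurable_normE : @measurable_fun _ _ bE (measurableTypeR R) setT (fun z : E => `|z|).
Proof.
apply: (@continuous_within_measurable R E setT _ closedT).
by apply: continuous_subspaceT => z; exact: norm_continuous.
Qed.

Lemma usphere_closed : closed (@usphere R E).
Proof.
rewrite (_ : @usphere R E = (fun z : E => `|z|) @^-1` [set 1])//.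
by apply: preimage_closed; [move=> x _; exact: norm_continuous|exact: closed_eq].
Qed.

Lemma usphere_compact : compact (@usphere R E).
Proof.
apply: (subclosed_compact usphere_closed (euclidean_ball_compact hE (r := 1))).
by move=> z /= ->.
Qed.

Lemma disintegrable_E : @disintegrable R _ bE.
Proof.
have [n [c [s [cc cs csK _]]]] := euclidean_coordinates hE.
apply: (@disintegrable_retract R _ _ (borel 'rV[R]_n) bE setT c s) => //.
- exact: borel_continuous.
- exact: borel_continuous.
- exact: disintegrable_rV.
Qed.

Lemma disintegrable_Z : @disintegrable R _ bZ.
Proof.
apply: (@disintegrable_retract R _ _ (borel 'rV[R]_d) bZ setT (@torus_sec R d) (@to_torus R d)) => //.
- exact: measurable_torus_sec.
- exact: measurable_to_torus.
- exact: torus_secK.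
- exact: disintegrable_rV.
Qed.

(** A point with |z| <= 1 is reached by shrinking z slightly towards 0 and moving x into [Omega]. *)
Lemma KbarE : Kbar Omega E = [set p | closure Omega p.1.1 /\ `|p.2| <= 1].
Proof.
apply/seteqP; split.
  have cl : closed [set p : X * Z * E | closure Omega p.1.1 /\ `|p.2| <= 1].
    apply: closedI.
      apply: (@preimage_closed _ _ (fun p : X * Z * E => p.1.1) (closure Omega)); last exact: closed_closure.
      by move=> p _; apply: (@cvg_comp _ _ _ fst fst); [exact: cvg_fst|exact: cvg_fst].
    apply: (@preimage_closed _ _ (fun p : X * Z * E => `|p.2|) [set x : R | x <= 1]); last exact: closed_le.
    by move=> p _; apply: (@cvg_comp _ _ _ snd (fun z : E => `|z|)); [exact: cvg_snd|exact: norm_continuous].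
  move/closure_id : cl => ->; apply: closureS => -[[x xi] z] [[/= Ox _] /ltW z1].
  by split => //; exact: subset_closure.
move=> [[x xi] z] [/= Ox z1] B [[A C] [/= [[A1 A2] [/= nA1 nA2] A12] nC] AC].
have [x' [Ox' A1x']] := Ox _ nA1.
have [e /= e0 eC] := (nbhs_ballP _ _).1 nC.
(* The shrunken point (1 - t) z is at distance t |z| from z: e / 2 keeps this below e, and 1/2 keeps
   the factor 1 - t positive. *)
pose t := Num.min (2^-1 : R) (e / 2).
have t0 : 0 < t by rewrite lt_min invr_gt0 ltr0n/= divr_gt0.
have t1 : t < 1 by rewrite /t gt_min; apply/orP; left; rewrite invf_lt1// ltr1n.
have te : t < e by rewrite /t gt_min; apply/orP; right; rewrite gtr_pMr// invf_lt1// ltr1n.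
exists ((x', xi), (1 - t) *: z); split.
  split => //; rewrite /uball/= normrZ ger0_norm ?subr_ge0 ?(ltW t1)//.
  apply: (@le_lt_trans _ _ (1 - t)); last by rewrite gtrBl.
  by rewrite ler_piMr// subr_ge0 ltW.
apply: AC; split => /=.
  by apply: A12; split => //=; exact: nbhs_singleton.
apply: eC; rewrite -ball_normE/= scalerBl scale1r opprB addrC subrK normrZ gtr0_norm//.
by apply: le_lt_trans te; rewrite ler_piMr// ltW.
Qed.

Lemma Kbar_closed : closed (Kbar Omega E).
Proof. exact: closed_closure. Qed.

Lemma measurable_Kbar : measurable (Kbar Omega E : set P).
Proof. by apply: generated_closed; exact: closed_openC Kbar_closed. Qed.

Lemma measurable_closure : measurable (closure Omega : set bX).
Proof. by apply: generated_closed; apply: closed_openC; exact: closed_closure. Qed.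

Hypothesis hbounded : bounded_set Omega.

Lemma closure_compact : compact (closure Omega).
Proof.
apply: bounded_closed_compact; last exact: closed_closure.
have [M [Mr hM]] := hbounded; exists M; split => // x Mx y cy.
have cl : closed [set z : X | `|z| <= x].
  rewrite (_ : [set z : X | `|z| <= x] = (fun z : X => `|z|) @^-1` [set r : R | r <= x])//.
  by apply: preimage_closed; [move=> z _; exact: norm_continuous|exact: closed_le].
have := closureS (hM x Mx) cy; rewrite -((closure_id _).1 cl); exact.
Qed.

Lemma Kbar_compact : compact (Kbar Omega E).
Proof.
rewrite KbarE (_ : mkset _ = (closure Omega `*` [set: Z]) `*` [set z : E | `|z| <= 1]); last first.
  by apply/seteqP; split => p [] => [? ?|[? _] ?].
apply: compact_setX; last exact: euclidean_ball_compact.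
by apply: compact_setX; [exact: closure_compact|exact: torus_compact].
Qed.

Hypothesis hopen : open Omega.

Lemma leb_Omega_fin : (leb d Omega < +oo)%E.
Proof.
have [M [Mr hM]] := hbounded.
pose B : 'I_d -> set R := fun=> `[- (`|M| + 1), `|M| + 1]%classic.
have mB i : measurable (B i) by exact: measurable_itv.
apply: (@le_lt_trans _ _ (leb d [set v : 'rV[R]_d | forall i, B i (v ord0 i)])).
  apply: le_measure; rewrite ?inE.
  - exact: borel_open.
  - exact: measurable_boxrV.
  - move=> v Ov i; rewrite /B/= in_itv/= -ler_norml.
    apply: (@le_trans _ _ `|v|); last by apply: hM => //; rewrite (le_lt_trans (ler_norm M))// ltrDl.
    rewrite [leRHS]/Num.norm /= mx_normrE.
    exact: (le_bigmax _ (fun ij => `|v ij.1 ij.2|) (ord0, i)).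
rewrite leb_box// ltey_eq; apply/orP; left.
apply: (big_ind (fun x => x \is a fin_num)) => //.
  by move=> x y; exact: fin_numM.
move=> i _; rewrite /B lebesgue_measure_itv/=; case: ifP => // _.
Qed.

(** For |z| = 1 the quotient at t z equals (1 + 1/t) g(x', xi', (1 + 1/t)^-1 z), which tends to g(x,
    xi, z) by continuity of g up to the sphere. *)
Lemma recession_Smap (g : X * Z * E -> R) (x : X) (xi : Z) (z : E) :
  {within Kbar Omega E, continuous g} -> closure Omega x -> `|z| = 1 ->
  recession Omega (Smap g) (x, xi, z) = g (x, xi, z).
Proof.
move=> cg cx z1; rewrite /recession/=.
set FF := filter_prod _ _.
(* The limit is identified by uniqueness, which needs a proper filter; this is where x must adhere
   to [Omega]. *)
have pF : ProperFilter FF.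
  have pw : ProperFilter (within Omega (nbhs x)).
    apply: Build_ProperFilter_ex => A; rewrite /within/= => nA.
    by have [y [Oy Ay]] := cx _ nA; exists y; exact: Ay.
  exact: filter_prod_proper.
apply/cvg_lim => //.
have tF : FF [set q | 0 < q.2].
  exists (setT, [set t | 0 < t]) => //=; last by move=> [a t] [].
  by split; [exact: filterT|exact: nbhs_pinfty_gt].
have t1 : q.2^-1 @[q --> FF] --> (0 : R).
  have h : (fun t : R => t^-1) @ +oo --> (0 : R).
    apply/cvgrPdist_lt => e e0; near=> t.
    have te : e^-1 < t by near: t; apply: nbhs_pinfty_gt; exact: num_real.
    have t0 : 0 < t by rewrite (lt_trans _ te)// invr_gt0.
    by rewrite sub0r normrN gtr0_norm ?invr_gt0// -(invrK e) ltf_pV2// posrE invr_gt0.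
  apply: (@cvg_comp _ _ _ snd (fun t : R => t^-1) _ _ _ _ h).
  exact: cvg_snd.
have c1 : (1 + q.2^-1) @[q --> FF] --> (1 : R).
  by rewrite -[X in _ --> X]addr0; apply: cvgD => //; exact: cvg_cst.
have c2 : (1 + q.2^-1)^-1 @[q --> FF] --> (1 : R).
  by rewrite -[X in _ --> X]invr1; apply: cvgV => //; exact: oner_neq0.
have c3 : (1 + q.2^-1)^-1 *: z @[q --> FF] --> z.
  by rewrite -[X in _ --> X]scale1r; apply: cvgZ => //; exact: cvg_cst.
have c4 : g (q.1, (1 + q.2^-1)^-1 *: z) @[q --> FF] --> g (x, xi, z).
  have Kp : Kbar Omega E (x, xi, z) by rewrite KbarE; split => //=; rewrite z1.
  have OF : FF [set q | Omega q.1.1].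
    exists ([set y | Omega y.1], setT) => /=; last by move=> [a t] [].
    split; last exact: filterT.
    by exists (Omega, setT) => /=; [split; [exact: withinT|exact: filterT]|move=> [a b] []].
  have Kq : \forall q \near FF, Kbar Omega E (q.1, (1 + q.2^-1)^-1 *: z).
    near=> q; have q0 : 0 < q.2 by near: q.
    have Oq : Omega q.1.1 by near: q.
    have q1 : 0 < q.2^-1 by rewrite invr_gt0.
    rewrite KbarE/=; split; first exact: subset_closure.
    by rewrite normrZ z1 mulr1 gtr0_norm ?invr_gt0 ?invf_le1; lra.
  have c5 : (q.1, (1 + q.2^-1)^-1 *: z) @[q --> FF] --> (x, xi, z).
    move=> A [[B1 B2] [/= [[A1 A2] [/= nA1 nA2] hA] nB2] hB].
    have h1 : FF [set q | B1 q.1].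
      exists (B1, setT) => /=; last by move=> [a t] [].
      split; last exact: filterT.
      exists (A1, A2) => //=; split => //.
      by apply: filterS nA1 => y hy _.
    by apply: filterS2 h1 (c3 _ nB2) => q b1 b2; apply: hB; split.
  have := (subspace_continuousP _ _).1 cg _ Kp; apply: cvg_comp => A nA.
  by apply: filterS2 Kq (c5 _ nA) => q hq; exact.
have : (1 + q.2^-1) * g (q.1, (1 + q.2^-1)^-1 *: z) @[q --> FF] --> g (x, xi, z).
  by rewrite -[X in _ --> X]mul1r; apply: cvgM.
apply: cvg_trans; apply: near_eq_cvg.
near=> q.
have q0 : 0 < q.2 by near: q.
rewrite /Smap/= normrZ z1 mulr1 gtr0_norm// scalerA.
have -> : (1 + q.2^-1)^-1 = (1 + q.2)^-1 * q.2 by field; lra.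
by field; lra.
Unshelve. all: by end_near. Qed.

End spaces.

(** * The measure of a Young measure *)

Section nested.
Context {R : realType}.
Local Open Scope ereal_scope.

Lemma iterated_integral_off_null {d1 d2} {T1 : measurableType d1} {T2 : measurableType d2}
    (m : {measure set T1 -> \bar R}) (D : set T1) (k : T1 -> probability T2 R)
    (N : set (T1 * T2)) (F G : T1 -> T2 -> \bar R) :
  mker k -> measurable N -> \int[m]_x k x (xsection N x) = 0 ->
  (forall x y, D x -> ~ N (x, y) -> F x y = G x y) ->
  \int[m]_(x in D) \int[k x]_y F x y = \int[m]_(x in D) \int[k x]_y G x y.
Proof.
move=> mk mN N0 FG; have [N' [mN' N'0 kN]] := null_sections mk mN N0.
apply: (integral_eq_off_null mN' N'0) => x Dx Nx.
apply: (@integral_eq_off_null _ _ _ (k x) setT (xsection N x)).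
- exact: measurable_xsection.
- exact: kN.
- by move=> y _ ny; apply: FG => // h; apply: ny; rewrite /xsection/= inE.
Qed.

Lemma integral_like_nested {d1 d2 d3} {T1 : measurableType d1} {T2 : measurableType d2}
    {U : measurableType d3} (m : {measure set T1 -> \bar R}) (D : set T1)
    (k : T1 -> probability T2 R) (G : (U -> \bar R) -> T1 * T2 -> \bar R) :
  measurable D -> mker k -> (forall f, nnm f -> nnm (G f)) ->
  (forall p, integral_like (fun f => G f p)) ->
  integral_like (fun f => \int[m]_(x in D) \int[k x]_y G f (x, y)).
Proof.
move=> mD mk nG iG.
apply: (@integral_like_comp _ _ _ _ _ (fun f => \int[m]_(x in D) f x)
  (fun f x => \int[k x]_y G f (x, y))); first exact: integral_like_int.
  by move=> f nf; apply: mker_integral => //; exact: nG.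
move=> x; apply: (@integral_like_comp _ _ _ _ _ (fun f => \int[k x]_y f y)
  (fun f y => G f (x, y))); first exact: integral_like_int.
  by move=> f nf; have [] := nnm_pair1 x (nG _ nf).
by move=> y; exact: iG.
Qed.

Lemma mker_cst {d1 d2} {T1 : measurableType d1} {T2 : measurableType d2}
  (m : probability T2 R) : mker (fun _ : T1 => m).
Proof. by move=> A mA; exact: measurable_cst. Qed.

Lemma restrict_indic {d} {T : measurableType d} (f : T -> \bar R) (D : set T) :
  f \_ D = fun x => (\1_D x)%:E * f x.
Proof.
by apply/funext => x; rewrite patchE indicE; case: ifPn => _; rewrite ?mul1e ?mul0e.
Qed.

Lemma integral_set_indic {d} {T : measurableType d} (m : {measure set T -> \bar R})
  (D : set T) (f : T -> \bar R) : \int[m]_(x in D) f x = \int[m]_x ((\1_D x)%:E * f x).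
Proof. by rewrite integral_mkcond restrict_indic. Qed.

End nested.

(** * The pairing as a countably additive functional of Borel functions *)

Section lifted.
Context {R : realType} {d : nat} (Omega : set 'rV[R]_d) (E : normedModType R).
Hypothesis hE : euclidean E.
Hypothesis hopen : open Omega.
Hypothesis hbounded : bounded_set Omega.
Local Open Scope ereal_scope.
Notation X := 'rV[R]_d.
Notation Z := (torus R d).
Notation bX := (borel 'rV[R]_d).
Notation bZ := (borel (torus R d)).
Notation bE := (borel E).
Notation P := (borel ('rV[R]_d * torus R d * E)%type).
Notation tor := (torus_measure R d).

Definition compress (z : E) : E := ((1 + `|z|)^-1 *: z)%R.

(* The pairing of [Smap h] with the Young measure, in a form that makes sense for
   every nonnegative Borel function h (see [pairing_lifted]). *)
Definition lifted (k : X * Z -> probability bE R) (lam : {finite_measure set bX -> \bar R})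
    (rho : X -> probability bZ R) (ki : X * Z -> probability bE R)
    (h : X * Z * E -> \bar R) : \bar R :=
  \int[leb d]_(x in Omega) \int[tor]_xi
     \int[k (x, xi)]_z ((1 + `|z|)%:E * h (x, xi, compress z)) +
  \int[lam]_(x in closure Omega) \int[rho x]_xi
     \int[ki (x, xi)]_(z in @usphere R E) h (x, xi, z).

Lemma norm_compress (z : E) : (`|compress z| = `|z| / (1 + `|z|))%R.
Proof. by rewrite normrZ mulrC gtr0_norm// invr_gt0 ltr_pwDl. Qed.

Lemma compress_le1 (z : E) : (`|compress z| <= 1)%R.
Proof. by rewrite norm_compress ler_pdivrMr ?ltr_pwDl// mul1r lerDr. Qed.

Lemma compress_continuous : continuous compress.
Proof.
move=> z; have h : ((1 + `|x|)^-1)%R @[x --> z] --> ((1 + `|z|)^-1)%R.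
  apply: cvgV; first by rewrite gt_eqF// ltr_pwDl.
  by apply: cvgD; [exact: cvg_cst|exact: norm_continuous].
exact: (cvgZ h cvg_id).
Qed.

(** [lifted] evaluates its argument only at points of [Kbar], so extending g by 0 outside loses
    nothing and gives a function on the whole space. *)
Lemma pairing_lifted (y : young2 Omega E) (g : X * Z * E -> R) :
  {within Kbar Omega E, continuous g} ->
  pairing (Smap g) y =
  lifted (y_nu y) (y_lambda y) (y_rho y) (y_nuinf y) ((EFin \o g) \_ (Kbar Omega E)).
Proof.
move=> cg; apply: (congr2 adde).
- apply: eq_integral => x; rewrite inE => Ox; apply: eq_integral => xi _.
  apply: eq_integral => z _; rewrite patchE ifT ?EFinM//.
  by rewrite inE KbarE; split => /=; [exact: subset_closure|exact: compress_le1].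
- apply: eq_integral => x; rewrite inE => Ox; apply: eq_integral => xi _.
  apply: eq_integral => z; rewrite inE => z1; rewrite recession_Smap// patchE ifT//.
  by rewrite inE KbarE; split => //=; rewrite z1.
Qed.

Lemma nnm_compress (h : P -> \bar R) : nnm h ->
  @nnm R _ (bX * bZ * bE)%type (fun p => (1 + `|p.2|)%:E * h (p.1, compress p.2)).
Proof.
move=> nh; apply: nnmM.
  split => [p|]; first by rewrite lee_fin addr_ge0.
  apply/measurable_EFinP; apply: measurable_funD => //.
  exact: (measurableT_comp (@measurable_normE R E) measurable_snd).
have mc : @measurable_fun _ _ bE bE setT compress by exact: borel_continuous compress_continuous.
have mc2 : @measurable_fun _ _ (bX * bZ * bE)%type (bX * bZ * bE)%type setT
    (fun p => (p.1, compress p.2)).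
  apply/measurable_fun_pair; first exact: measurable_fst.
  exact: (measurableT_comp mc measurable_snd).
exact: (nnm_comp mc2 (nnm_fromP hE nh)).
Qed.

Lemma measurable_usphere : measurable (@usphere R E : set bE).
Proof. by apply: generated_closed; apply: closed_openC; exact: usphere_closed. Qed.

Lemma nnm_usphere (h : P -> \bar R) : nnm h ->
  @nnm R _ (bX * bZ * bE)%type (fun p => (\1_(@usphere R E) p.2)%:E * h p).
Proof.
move=> nh; apply: nnmM; last exact: (nnm_fromP hE).
exact: (nnm_comp (h := snd) measurable_snd (nnm_indic measurable_usphere)).
Qed.

Section borel_kernels.
Variables (k : X * Z -> probability bE R) (lam : {finite_measure set bX -> \bar R})
    (rho : X -> probability bZ R) (ki : X * Z -> probability bE R).
Hypotheses (mk : @mker R _ _ (bX * bZ)%type bE k) (mrho : @mker R _ _ bX bZ rho)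
  (mki : @mker R _ _ (bX * bZ)%type bE ki).

Let G1 (h : P -> \bar R) (p : bX * bZ) := \int[k p]_z ((1 + `|z|)%:E * h (p, compress z)).
Let G2 (h : P -> \bar R) (p : bX * bZ) := \int[ki p]_(z in @usphere R E) h (p, z).

Lemma nnm_G1 h : nnm h -> nnm (G1 h).
Proof. by move=> nh; exact: (nnm_mker_integral mk (nnm_compress nh)). Qed.

Lemma nnm_G2 h : nnm h -> nnm (G2 h).
Proof.
move=> nh; rewrite /G2; under eq_fun do rewrite integral_set_indic.
exact: (nnm_mker_integral mki (nnm_usphere nh)).
Qed.

Lemma measurable_Omega : measurable (Omega : set bX).
Proof. exact: borel_open. Qed.

Lemma lifted_integral_like : @integral_like R _ P (lifted k lam rho ki).
Proof.
apply: integral_like_add.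
- apply: (@integral_like_nested R _ _ _ bX bZ P (leb d) Omega (fun=> tor) G1).
  + exact: measurable_Omega.
  + exact: mker_cst.
  + exact: nnm_G1.
  + move=> p; apply: (@integral_like_comp _ _ _ bE P (fun f => \int[k p]_z f z)
      (fun h z => (1 + `|z|)%:E * h (p, compress z))); first exact: integral_like_int.
      by move=> f nf; have [] := nnm_pair1 p (nnm_compress nf).
    move=> z; apply: integral_like_scale; first by rewrite addr_ge0.
    exact: (@integral_like_eval _ _ _ P bE (fun z => (p, compress z))).
- apply: (@integral_like_nested R _ _ _ bX bZ P lam (closure Omega) rho G2) => //.
  + exact: measurable_closure.
  + exact: nnm_G2.
  + move=> p; apply: (@integral_like_comp _ _ _ bE P (fun f => \int[ki p]_(z in @usphere R E) f z)
      (fun h z => h (p, z))).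
    * by apply: integral_like_int; exact: measurable_usphere.
    * by move=> f nf; have [] := nnm_pair1 p (nnm_fromP hE nf).
    * by move=> z; exact: (@integral_like_eval _ _ _ P bE (fun z => (p, z))).
Qed.

Hypothesis moment : \int[leb d]_(x in Omega) \int[tor]_xi \int[k (x, xi)]_z `|z|%:E < +oo.

(** The function 1 + |z| integrates to the volume of [Omega] plus the first moment, and the part on
    the sphere is at most the mass of lambda. *)
Lemma lifted1_fin : lifted k lam rho ki (cst 1) < +oo.
Proof.
have mO := measurable_Omega.
apply: lte_add_pinfty.
- have nnorm : @nnm R _ (bX * bZ * bE)%type (fun p => `|p.2|%:E).
    split; first by move=> p; rewrite lee_fin.
    apply/measurable_EFinP; exact: (measurableT_comp (@measurable_normE R E) measurable_snd).
  have n1 := nnm_mker_integral mk nnorm.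
  have n2 := nnm_mker_integral (@mker_cst R _ _ bX bZ tor) n1.
  rewrite (eq_integral (fun x : bX => 1 + \int[tor]_xi \int[k (x, xi)]_z `|z|%:E)).
    rewrite ge0_integralD//; last 2 first.
    - by move=> x _; exact: n2.1.
    - exact: (measurable_funS measurableT _ n2.2).
    rewrite integral_cst// mul1e; apply: lte_add_pinfty => //.
    exact: leb_Omega_fin.
  move=> x _; rewrite (eq_integral (fun xi : bZ => 1 + \int[k (x, xi)]_z `|z|%:E)).
    rewrite ge0_integralD//; last 2 first.
    - by move=> xi _; exact: n1.1.
    - exact: (nnm_pair1 x n1).2.
    by rewrite (prob_integral1 (T := bZ)).
  move=> xi _; rewrite (eq_integral (fun z : bE => 1 + `|z : E|%:E)).
    rewrite ge0_integralD//; last by apply/measurable_EFinP; exact: measurable_normE.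
    by rewrite (@prob_integral1 R _ bE (k (x, xi)) (fun=> 1)).
  by move=> z _; rewrite mule1 EFinD.
- apply: (@le_lt_trans _ _ (\int[lam]_(x in closure Omega) cst 1 x)); last first.
    rewrite integral_cst ?mul1e; last exact: measurable_closure.
    by rewrite -ge0_fin_numE// fin_num_measure//; exact: measurable_closure.
  have n1 := nnm_G2 (nnm_cst (T := P) lee01).
  have n2 := nnm_mker_integral mrho n1.
  apply: ge0_le_integral => //.
  + exact: measurable_closure.
  + by move=> x _; exact: n2.1.
  + exact: (measurable_funS measurableT _ n2.2).
  + move=> x _ /=; rewrite -[leRHS](prob_integral1 (rho x) (f := cst 1))//.
    apply: ge0_le_integral => //.
    * by move=> xi _; exact: n1.1.
    * exact: (nnm_pair1 x n1).2.
    * move=> xi _ /=; rewrite integral_cst; last exact: measurable_usphere.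
      by rewrite mul1e; apply: probability_le1; exact: measurable_usphere.
Qed.

(** The representation is known for nonnegative functions. A continuous g is bounded on the compact
    [Kbar], so its positive and negative parts have finite integrals and can be subtracted inside
    each layer of the iterated integrals. *)
Lemma lifted_signed (mu : {finite_measure set P -> \bar R}) (g : X * Z * E -> R) :
  (forall h, nnm h -> \int[mu]_p h p = lifted k lam rho ki h) ->
  {within Kbar Omega E, continuous g} ->
  \int[mu]_(p in Kbar Omega E) (g p)%:E =
  lifted k lam rho ki ((EFin \o g) \_ (Kbar Omega E)).
Proof.
move=> muE cg; have mK := @measurable_Kbar R d Omega E.
rewrite integral_mkcond; set gK := _ \_ _.
have [C [C0 gC]] := continuous_within_bounded (Kbar_compact hE hbounded) cg.
have mgK : @measurable_fun _ _ P _ setT gK.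
  apply/(measurable_restrictT _ mK)/measurable_EFinP.
  apply: continuous_within_generated => // a b.
  exact: continuous_within_preimage.
have gKC p : `|gK p| <= C%:E.
  rewrite /gK patchE; case: ifPn => [|_]; last by rewrite abse0 lee_fin.
  by rewrite inE => Kp; rewrite abse_EFin lee_fin; exact: gC.
have np : nnm gK^\+ by split; [move=> p; exact: funepos_ge0|exact: measurable_funepos].
have nn : nnm gK^\- by split; [move=> p; exact: funeneg_ge0|exact: measurable_funeneg].
have bnd h : nnm h -> (forall p, h p <= `|gK p|) -> lifted k lam rho ki h < +oo.
  move=> nh hC; rewrite -muE//; apply: (@le_lt_trans _ _ (\int[mu]_p cst C%:E p)).
    apply: ge0_le_integral => //; [by move=> p _; exact: nh.1|exact: nh.2|].
    by move=> p _; exact: le_trans (hC p) (gKC p).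
  by rewrite integral_cst// lte_mul_pinfty// -ge0_fin_numE// fin_num_measure.
have fp : lifted k lam rho ki gK^\+ < +oo.
  by apply: bnd => // p; rewrite funeposE ge_max lee_abs abse_ge0.
have fn : lifted k lam rho ki gK^\- < +oo.
  by apply: bnd => // p; rewrite funenegE ge_max -[`|gK p|]abseN lee_abs abse_ge0.
rewrite integralE !muE//.
pose A h := \int[leb d]_(x in Omega) \int[tor]_xi G1 h (x, xi).
pose B h := \int[lam]_(x in closure Omega) \int[rho x]_xi G2 h (x, xi).
have A0 h : nnm h -> 0 <= A h.
  by move=> nh; apply: integral_ge0 => x _; apply: integral_ge0 => xi _; exact: (nnm_G1 nh).1.
have B0 h : nnm h -> 0 <= B h.
  by move=> nh; apply: integral_ge0 => x _; apply: integral_ge0 => xi _; exact: (nnm_G2 nh).1.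
have LAB h : lifted k lam rho ki h = A h + B h by [].
have fin (h : P -> \bar R) : nnm h -> lifted k lam rho ki h < +oo -> A h < +oo /\ B h < +oo.
  move=> nh; rewrite LAB => hh; split; apply: le_lt_trans hh.
    by rewrite leeDl// B0.
  by rewrite leeDr// A0.
have [Ap Bp] := fin _ np fp; have [An Bn] := fin _ nn fn.
have AE : A gK = A gK^\+ - A gK^\-.
  have S := nested_integral_sub measurable_Omega (@mker_cst R _ _ bX bZ tor) (nnm_G1 np) (nnm_G1 nn) Ap An.
  apply: (etrans _ S).
  apply: eq_integral => x _; apply: eq_integral => xi _; rewrite {1}/G1 integralE.
  (* The factor 1 + |z| is nonnegative, so it commutes with taking positive and negative parts. *)
  have mx (c : R) (a : \bar R) : (0 <= c)%R -> maxe (c%:E * a) 0 = c%:E * maxe a 0.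
    move=> c0; have [a0|/ltW a0] := leP 0 a.
      by rewrite !max_l// mule_ge0.
    by rewrite !max_r ?mule0// mule_ge0_le0.
  by congr (_ - _); apply: eq_integral => z _; rewrite ?funeposE ?funenegE -?muleN mx ?addr_ge0.
have BE : B gK = B gK^\+ - B gK^\-.
  have S := nested_integral_sub (@measurable_closure R d Omega) mrho (nnm_G2 np) (nnm_G2 nn) Bp Bn.
  apply: (etrans _ S).
  apply: eq_integral => x _; apply: eq_integral => xi _; rewrite {1}/G2 integralE.
  by congr (_ - _); apply: eq_integral => z _; rewrite ?funeposE ?funenegE.
rewrite !LAB AE BE.
have f1 (h : P -> \bar R) : nnm h -> A h < +oo -> A h \is a fin_num by move=> nh hh; rewrite ge0_fin_numE ?A0.
have f2 (h : P -> \bar R) : nnm h -> B h < +oo -> B h \is a fin_num by move=> nh hh; rewrite ge0_fin_numE ?B0.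
by rewrite fin_num_oppeD ?f1 ?f2// addeACA.
Qed.

End borel_kernels.
End lifted.

(** * Borel representatives of a Young measure and existence of its image *)

Section young_borel.
Context {R : realType} {d : nat} (Omega : set 'rV[R]_d) (E : normedModType R).
Hypothesis hE : euclidean E.
Hypothesis hopen : open Omega.
Hypothesis hbounded : bounded_set Omega.
Local Open Scope ereal_scope.
Notation X := 'rV[R]_d.
Notation Z := (torus R d).
Notation bX := (borel 'rV[R]_d).
Notation bZ := (borel (torus R d)).
Notation bE := (borel E).
Notation P := (borel ('rV[R]_d * torus R d * E)%type).
Notation tor := (torus_measure R d).

Lemma measurable_cylinder : measurable (closure Omega `*` [set: Z] : set (bX * bZ)).
Proof. by apply: measurableX => //; exact: measurable_closure. Qed.

Lemma semidirectE (lam : {finite_measure set bX -> \bar R}) (rho : X -> probability bZ R) :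
  @mker R _ _ bX bZ rho -> forall A : set (bX * bZ), measurable A ->
  semidirect lam rho A = \int[lam]_x \int[rho x]_xi (\1_A (x, xi))%:E.
Proof.
move=> mrho A mA; apply: eq_integral => x _.
rewrite -[in LHS](setIT (xsection A x)) -integral_indic//; last exact: measurable_xsection.
by apply: eq_integral => y _; rewrite !indicE mem_xsection.
Qed.

(** The measurability of nu^infinity refers to [semidirect], which is recognised as a measure once
    the kernel is Borel; then [borel_version] applies to it. *)
Lemma semidirect_measure (lam : {finite_measure set bX -> \bar R}) (rho : X -> probability bZ R) :
  @mker R _ _ bX bZ rho ->
  exists m : {measure set (bX * bZ)%type -> \bar R}, forall A, measurable A -> m A = semidirect lam rho A.
Proof.
move=> mrho; have [m mE] := integral_like_measure
  (@integral_like_nested R _ _ _ bX bZ (bX * bZ)%type lam setT rho (fun f p => f p)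
    measurableT mrho (fun f nf => nf) (fun p => integral_like_eval id p)).
exists m => A mA; rewrite semidirectE//.
have := mE _ (nnm_indic mA); by rewrite integral_indic// setIT.
Qed.

Lemma C0_compact (Y : topologicalType) (S : set Y) (phi : Y -> R) :
  compact S -> continuous phi -> C0 S phi.
Proof.
move=> cS cphi; split; first exact: continuous_subspaceT.
by move=> e e0; exists S; split => // x [].
Qed.

Lemma lifted_eq_off_null (k k' : X * Z -> probability bE R)
    (lam : {finite_measure set bX -> \bar R}) (rho rho' : X -> probability bZ R)
    (ki ki' : X * Z -> probability bE R) (h : P -> \bar R)
    (N N2 : set (bX * bZ)) (N1 : set bX) :
  measurable N -> (leb d \x tor) N = 0 -> @mker R _ _ bX bZ rho ->
  measurable N1 -> lam N1 = 0 ->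
  measurable N2 -> semidirect lam rho N2 = 0 ->
  (forall t, (closure Omega `*` [set: Z]) t -> ~ N t -> k t = k' t) ->
  (forall x, closure Omega x -> ~ N1 x -> rho x = rho' x) ->
  (forall t, (closure Omega `*` [set: Z]) t -> ~ N2 t -> ki t = ki' t) ->
  lifted Omega k' lam rho' ki' h = lifted Omega k lam rho ki h.
Proof.
move=> mN N0 mrho mN1 N10 mN2 N20 kE rhoE kiE; apply: (congr2 adde).
  apply: (@iterated_integral_off_null R _ _ bX bZ (leb d) Omega (fun=> tor) N) => //.
  by move=> x xi Ox nx; rewrite kE//; split => //; exact: subset_closure.
transitivity (\int[lam]_(x in closure Omega) \int[rho x]_xi
    \int[ki' (x, xi)]_(z in @usphere R E) h (x, xi, z)).
  by apply: (integral_eq_off_null mN1 N10) => x cx nx; rewrite rhoE.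
apply: (@iterated_integral_off_null R _ _ bX bZ lam (closure Omega) rho N2) => //.
by move=> x xi Ox nx; rewrite kiE//; split.
Qed.

Lemma cylinder_integral (f : bX * bZ -> \bar R) : nnm f ->
  \int[leb d \x tor]_(p in closure Omega `*` [set: Z]) f p =
  \int[leb d]_(x in closure Omega) \int[tor]_xi f (x, xi).
Proof.
move=> nf; have mD := measurable_cylinder.
rewrite integral_set_indic [RHS]integral_set_indic.
have [ng mg] : nnm (fun p : bX * bZ => (\1_(closure Omega `*` [set: Z]) p)%:E * f p).
  by apply: nnmM => //; exact: nnm_indic.
rewrite (fubini_tonelli1 (m1 := leb d) (m2 := tor) _ mg ng).
apply: eq_integral => x _; rewrite /fubini_F -ge0_integralZl//; last 2 first.
- exact: (nnm_pair1 x nf).2.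
- by move=> xi _; exact: nf.1.
by apply: eq_integral => xi _; rewrite !indicE in_setX/= in_setT andbT.
Qed.

(* The components of y are measurable with respect to completed measures only;
   changing them on null sets affects neither [lifted] nor the moment. *)
Lemma young_borel (y : young2 Omega E) :
  exists (k : X * Z -> probability bE R) (rho : X -> probability bZ R)
    (ki : X * Z -> probability bE R),
  [/\ @mker R _ _ (bX * bZ)%type bE k, @mker R _ _ bX bZ rho,
      @mker R _ _ (bX * bZ)%type bE ki,
      forall h, lifted Omega (y_nu y) (y_lambda y) (y_rho y) (y_nuinf y) h =
        lifted Omega k (y_lambda y) rho ki h &
      \int[leb d]_(x in Omega) \int[tor]_xi \int[k (x, xi)]_z `|z|%:E < +oo].
Proof.
have [BX cX] := @rV_countable_base R d.
have cZ := torus_countable_base cX.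
have [BE [cE bE']] := euclidean_countable_base hE.
have mD := measurable_cylinder.
have mcl := @measurable_closure R d Omega.
have C0E n (phi : E -> R) : continuous phi -> (forall x, ~ BE n x -> phi x = 0%R) ->
    C0 [set: E] phi.
  move=> cphi supp; have [r hr] := bE' n.
  split; first exact: continuous_subspaceT.
  move=> e e0; exists [set z | (`|z| <= r)%R]; split => //.
    exact: euclidean_ball_compact.
  by move=> z [_ hz]; rewrite supp ?normr0// => /hr.
have [k [mk [N [mN N0 kE]]]] := @borel_version R _ (bX * bZ)%type (leb d \x tor)
  (closure Omega `*` [set: Z]) E setT BE (y_nu y) set0 mD cE (@open_approx_pseudoMetric R E)
  C0E measurableT measurable0 (measure0 _) (fun t _ _ => probability_setT (y_nu y t))
  (y_nu_measurable y).
have [rho [mrho [N1 [mN1 N10 rhoE]]]] := @borel_version R _ bX (y_lambda y)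
  (closure Omega) Z setT _ (y_rho y) set0 mcl cZ (@open_approx_torus R d)
  (fun n phi cphi _ => C0_compact (@torus_compact R d) cphi)
  measurableT measurable0 (measure0 _) (fun t _ _ => probability_setT (y_rho y t))
  (y_rho_measurable y).
(* rho and its Borel version agree lambda-almost everywhere, so they give the same set function and
   the conditions on nu^infinity carry over. *)
have sdE A : semidirect (y_lambda y) (y_rho y) A = semidirect (y_lambda y) rho A.
  apply: (@integral_eq_off_null R _ bX (y_lambda y) setT (N1 `|` ~` closure Omega)).
  - by apply: measurableU => //; exact: measurableC.
  - by apply: null_set_setU => //; [exact: measurableC|exact: y_lambda_supp].
  - by move=> x _ /not_orP[nx /contrapT cx]; rewrite rhoE.
have [msd msdE] := semidirect_measure (y_lambda y) mrho.
have [N3 [mN3 N30 hN3]] := y_nuinf_sphere y.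
have msdN3 : msd N3 = 0 by rewrite msdE// -sdE.
have nuS t : (closure Omega `*` [set: Z]) t -> ~ N3 t -> y_nuinf y t (@usphere R E) = 1.
  by move=> [ct _] nt; apply: contrapT => h; apply: nt; apply: hN3; split => //; exact/eqP.
have wsd : weakstar_measurable msd (closure Omega `*` [set: Z] : set (bX * bZ)) (@usphere R E) (y_nuinf y).
  apply: weakstar_measurable_eq (y_nuinf_measurable y) => A mA.
  by rewrite msdE// -sdE.
have CS (n : nat) (phi : E -> R) : continuous phi -> (forall x, ~ BE n x -> phi x = 0%R) ->
    C0 (@usphere R E) phi.
  by move=> cphi _; exact: C0_compact (usphere_compact hE) cphi.
have [ki [mki [N2 [mN2 N20 kiE]]]] := @borel_version R _ (bX * bZ)%type msd
  (closure Omega `*` [set: Z]) E (@usphere R E) BE (y_nuinf y) N3 mD cE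
  (@open_approx_pseudoMetric R E) CS (@measurable_usphere R E) mN3 msdN3 nuS wsd.
exists k, rho, ki; split; [exact: mk|exact: mrho|exact: mki| | ].
- by move=> h; apply: (lifted_eq_off_null h mN N0 mrho mN1 N10 mN2) => //;
    rewrite -N20 msdE.
- have mom := y_nu_moment y.
  have nnorm : @nnm R _ (bX * bZ * bE)%type (fun p => `|p.2|%:E).
    split; first by move=> p; rewrite lee_fin.
    by apply/measurable_EFinP; exact: (measurableT_comp (@measurable_normE R E) measurable_snd).
  have n1 := nnm_mker_integral mk nnorm.
  have n2 := nnm_mker_integral (@mker_cst R _ _ bX bZ tor) n1.
  rewrite (@integral_eq_off_null R _ (bX * bZ)%type (leb d \x tor) _ N _
    (fun p => \int[k p]_z `|z|%:E)) in mom => //; last first.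
    by move=> p Dp np; rewrite kE.
  have := mom; rewrite (cylinder_integral n1) => mom'; apply: le_lt_trans mom'.
  apply: ge0_subset_integral => //.
  + exact: measurable_Omega.
  + exact: (measurable_funS measurableT _ n2.2).
  + by move=> x _; exact: n2.1.
  + exact: subset_closure.
Qed.

(** Stated with separate kernels so that it serves both inclusions: Borel versions of a given Young
    measure, and the components of a constructed one. *)
Lemma is_Sstar_intro (y : young2 Omega E) (k : X * Z -> probability bE R)
    (rho : X -> probability bZ R) (ki : X * Z -> probability bE R)
    (m : {finite_measure set P -> \bar R}) (mu : {charge set P -> \bar R}) :
  @mker R _ _ (bX * bZ)%type bE k -> @mker R _ _ bX bZ rho ->
  @mker R _ _ (bX * bZ)%type bE ki ->
  (forall h, lifted Omega (y_nu y) (y_lambda y) (y_rho y) (y_nuinf y) h =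
        lifted Omega k (y_lambda y) rho ki h) ->
  (forall h, nnm h -> \int[m]_p h p = lifted Omega k (y_lambda y) rho ki h) ->
  (forall A, measurable A -> mu A = m A) ->
  is_Sstar y mu.
Proof.
move=> mk mrho mki yE mE mum; have mK := @measurable_Kbar R d Omega E.
split.
  move=> A mA AK; rewrite mum//.
  have := mE _ (nnm_indic mA); rewrite integral_indic// setIT => ->.
  rewrite /lifted [X in X + _]integral0_eq ?[X in _ + X]integral0_eq ?adde0//.
  - move=> x Ox; apply: integral0_eq => xi _; apply: integral0_eq => z z1.
    rewrite indicE memNset// => Ap.
    suff : (A `&` Kbar Omega E) (x, xi, z) by rewrite AK.
    by split => //; rewrite KbarE; split => //=; rewrite z1.
  - move=> x Ox; apply: integral0_eq => xi _; apply: integral0_eq => z _.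
    rewrite indicE memNset ?mule0// => Ap.
    suff : (A `&` Kbar Omega E) (x, xi, compress z) by rewrite AK.
    by split => //; rewrite KbarE; split => //=; [exact: subset_closure|exact: compress_le1].
move=> g cg; rewrite (cintegral_positive _ mK mum) pairing_lifted// yE.
exact: lifted_signed.
Qed.

Lemma young_measure (y : young2 Omega E) : exists m : {finite_measure set P -> \bar R},
  is_Sstar y (charge_of_finite_measure m).
Proof.
have [k [rho [ki [mk mrho mki yE mom]]]] := young_borel y.
have [m mE] := integral_like_finite_measure
  (lifted_integral_like hE hopen (y_lambda y) mk mrho mki)
  (lifted1_fin hE hopen hbounded (y_lambda y) mk mrho mki mom).
by exists m; apply: (is_Sstar_intro mk mrho mki yE mE).
Qed.

End young_borel.

(** * Uniqueness of the represented charge *)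

Section approximation.
Context {R : realType}.

Lemma indic_approx_prod (T T' : topologicalType) (U : set T) (V : set T')
    (f : nat -> T -> R) (g : nat -> T' -> R) :
  indic_approx U f -> indic_approx V g ->
  indic_approx (U `*` V) (fun n p => f n p.1 * g n p.2).
Proof.
move=> [cf f01 f0 f1] [cg g01 g0 g1]; split.
- move=> n p; apply: cvgM.
    exact: (@cvg_comp _ _ _ fst (f n) _ _ _ cvg_fst (cf n p.1)).
  exact: (@cvg_comp _ _ _ snd (g n) _ _ _ cvg_snd (cg n p.2)).
- move=> n p; have /andP[f0' f1'] := f01 n p.1; have /andP[g0' g1'] := g01 n p.2.
  by rewrite mulr_ge0//= mulr_ile1.
- move=> n p /not_andP[h|h]; first by rewrite f0// mul0r.
  by rewrite g0// mulr0.
- move=> p [Up Vp]; near=> n.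
  by rewrite (near (f1 _ Up) n)// (near (g1 _ Vp) n)// mulr1.
Unshelve. all: by end_near. Qed.

Lemma measure_unique_generated1 (A : pointedType) (GA : set (set A))
    (m1 m2 : {finite_measure set (g_sigma_algebraType GA) -> \bar R}) :
  setI_closed GA -> GA setT -> (forall U, GA U -> m1 U = m2 U) ->
  forall C, measurable C -> m1 C = m2 C.
Proof.
move=> iA TA m12.
apply: (@measure_unique _ R (g_sigma_algebraType GA) GA (fun=> setT)) => //.
- by rewrite bigcup_const.
- by move=> _; rewrite -ge0_fin_numE// fin_num_measure.
Qed.

(** The pi-system argument is applied to one factor at a time: first with V fixed in the second
    generating family, then with U an arbitrary measurable set. *)
Lemma measure_unique_generated (A B : pointedType) (GA : set (set A)) (GB : set (set B))
    (m1 m2 : {finite_measure set (g_sigma_algebraType GA * g_sigma_algebraType GB)%type -> \bar R}) :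
  setI_closed GA -> setI_closed GB -> GA setT -> GB setT ->
  (forall U V, GA U -> GB V -> m1 (U `*` V) = m2 (U `*` V)) ->
  forall C, measurable C -> m1 C = m2 C.
Proof.
move=> iA iB TA TB m12; set gA := g_sigma_algebraType GA; set gB := g_sigma_algebraType GB.
have m12A U V : measurable (U : set gA) -> GB V -> m1 (U `*` V) = m2 (U `*` V).
  move=> mU GV; have mV : measurable (V : set gB) by exact: sub_sigma_algebra.
  have mC : measurable (setT `*` V : set (gA * gB)) by exact: measurableX.
  have [n1 [_ n1E]] := restricted_pushforward m1 mC measurable_fst.
  have [n2 [_ n2E]] := restricted_pushforward m2 mC measurable_fst.
  have pre U' : (setT `*` V) `&` fst @^-1` U' = U' `*` V.
    by apply/seteqP; split => [p [[_ ?] ?]|p [? ?]].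
  have n12 : forall C, measurable C -> n1 C = n2 C.
    apply: measure_unique_generated1 => // U' GU'.
    have mU' : measurable (U' : set gA) by exact: sub_sigma_algebra.
    have := n1E _ mU'; have := n2E _ mU'; rewrite !pre => e2 e1.
    exact: (etrans e1 (etrans (m12 _ _ GU' GV) (esym e2))).
  have := n1E _ mU; have := n2E _ mU; rewrite !pre => e2 e1.
  exact: (etrans (esym e1) (etrans (n12 _ mU) e2)).
apply: measure_unique_prod; first by rewrite -ge0_fin_numE// fin_num_measure.
move=> U V mU mV.
have mC : measurable (U `*` setT : set (gA * gB)) by exact: measurableX.
have [n1 [_ n1E]] := restricted_pushforward m1 mC measurable_snd.
have [n2 [_ n2E]] := restricted_pushforward m2 mC measurable_snd.
have pre V' : (U `*` setT) `&` snd @^-1` V' = U `*` V'.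
  by apply/seteqP; split => [p [[? _] ?]|p [? ?]].
have n12 : forall C, measurable C -> n1 C = n2 C.
  apply: measure_unique_generated1 => // V' GV'.
  have mV' : measurable (V' : set gB) by exact: sub_sigma_algebra.
  have := n1E _ mV'; have := n2E _ mV'; rewrite !pre => e2 e1.
  exact: (etrans e1 (etrans (m12A _ _ mU GV') (esym e2))).
have := n1E _ mV; have := n2E _ mV; rewrite !pre => e2 e1.
exact: (etrans (esym e1) (etrans (n12 _ mV) e2)).
Qed.

Lemma open_rect (T T' : topologicalType) (U : set T) (V : set T') :
  open U -> open V -> open (U `*` V).
Proof.
move=> oU oV; apply: openI.
  by apply: open_comp oU => p _; exact: cvg_fst.
by apply: open_comp oV => p _; exact: cvg_snd.
Qed.

End approximation.

Section charge_unique.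
Context {R : realType} {d : nat} (Omega : set 'rV[R]_d) (E : normedModType R).
Hypothesis hE : euclidean E.
Local Open Scope ereal_scope.
Notation X := 'rV[R]_d.
Notation Z := (torus R d).
Notation P := (borel ('rV[R]_d * torus R d * E)%type).

(** Open boxes are stable under intersection, and by second countability they generate the Borel
    sets of the product. *)
Lemma measure_unique_box (m1 m2 : {measure set P -> \bar R}) :
  m1 setT < +oo ->
  (forall (U : set X) (V : set Z) (W : set E), open U -> open V -> open W ->
    m1 (U `*` V `*` W) = m2 (U `*` V `*` W)) ->
  forall C, measurable C -> m1 C = m2 C.
Proof.
move=> m1oo m12.
pose G : set (set (X * Z * E)) := [set A | exists (U : set X) (V : set Z) (W : set E),
  [/\ open U, open V, open W & A = U `*` V `*` W]].
apply: (@measure_unique _ R P G (fun=> setT)).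
- apply: sigma_base.
    move=> _ [U [V [W [oU oV oW ->]]]].
    by apply: open_rect => //; exact: open_rect.
  move=> O oO; have [BX cX] := @rV_countable_base R d.
  have cZ := torus_countable_base cX.
  have [BE [cE _]] := euclidean_countable_base hE.
  have cP := countable_base_prod (countable_base_prod cX cZ) cE.
  have OE := countable_base_bigcup cP oO; eexists; last exact: OE.
  move=> n /=; case: ifP => _; last by right.
  case: unpickle => [[i j]|]; last by right.
  case: unpickle => [[k l]|]; last by right; rewrite set0X.
  left; exists (BX k), (@to_torus R d @` BX l), (BE j).
  by split => //; [exact: cX.1|exact: cZ.1|exact: cE.1].
- move=> _ _ [U [V [W [oU oV oW ->]]]] [U' [V' [W' [oU' oV' oW' ->]]]].
  rewrite -!setXI; exists (U `&` U'), (V `&` V'), (W `&` W').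
  by split => //; exact: openI.
- move=> _; exists setT, setT, setT; split; try exact: openT.
  by rewrite !setXTT.
- by rewrite bigcup_const.
- by move=> _ [U [V [W [oU oV oW ->]]]]; exact: m12.
- by [].
Qed.

(** With mu1 = p1 - n1 and mu2 = p2 - n2, equality is moved to the positive measures p1 + n2 and p2
    + n1 restricted to [Kbar]. These agree on open boxes, whose indicators are limits of continuous
    functions, hence everywhere. *)
Lemma charge_unique (mu1 mu2 : {charge set P -> \bar R}) :
  on_Kbar Omega mu1 -> on_Kbar Omega mu2 ->
  (forall g : X * Z * E -> R, {within Kbar Omega E, continuous g} ->
    cintegral mu1 (Kbar Omega E) g = cintegral mu2 (Kbar Omega E) g) ->
  charge_eq mu1 mu2.
Proof.
move=> K1 K2 h12; set K := Kbar Omega E in K1 K2 h12 *.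
have mK : measurable (K : set P) := @measurable_Kbar R d Omega E.
have [p1 [n1 [mu1E [c1 _]]]] := cintegralE mu1.
have [p2 [n2 [mu2E [c2 _]]]] := cintegralE mu2.
have fin (p n : {finite_measure set P -> \bar R}) : exists m : {finite_measure set P -> \bar R},
    forall f, nnm f -> \int[m]_x f x = \int[p]_(x in K) f x + \int[n]_(x in K) f x.
  apply: integral_like_finite_measure.
    by apply: integral_like_add; exact: integral_like_int.
  rewrite !integral_cst// !mul1e; apply: lte_add_pinfty;
    by rewrite -ge0_fin_numE// fin_num_measure.
have [a aE] := fin p1 n2; have [b bE] := fin p2 n1.
have ab : forall C, measurable C -> a C = b C.
  apply: measure_unique_box; first by rewrite -ge0_fin_numE// fin_num_measure.
  move=> U V W oU oV oW.
  have [u uU] := @open_approx_pseudoMetric R X U oU.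
  have [v vV] := @open_approx_torus R d V oV.
  have [w wW] := @open_approx_pseudoMetric R E W oW.
  have [f [cf f01 f0 f1]] : exists f : nat -> X * Z * E -> R,
    indic_approx (U `*` V `*` W) f.
    by eexists; exact: indic_approx_prod (indic_approx_prod uU vV) wW.
  have mf n : @measurable_fun _ _ P _ setT (f n).
    apply: continuous_within_generated => // x y.
    by apply: continuous_within_preimage; exact: continuous_subspaceT.
  have mB : measurable (U `*` V `*` W : set P).
    by apply: sub_sigma_algebra; apply: open_rect => //; exact: open_rect.
  have cvg (m : {finite_measure set P -> \bar R}) :
      \int[m]_x (f n x)%:E @[n --> \oo] --> m (U `*` V `*` W).
    rewrite -[X in m X]setIT; apply: indic_approx_cvg => //.
    by rewrite -ge0_fin_numE// fin_num_measure.
  have fab n : \int[a]_x (f n x)%:E = \int[b]_x (f n x)%:E.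
    have nf : @nnm R _ P (fun x => (f n x)%:E).
      split; first by move=> x; rewrite lee_fin; have /andP[] := f01 n x.
      exact/measurable_EFinP.
    have ff (m : {finite_measure set P -> \bar R}) : \int[m]_(x in K) (f n x)%:E \is a fin_num.
      rewrite ge0_fin_numE; last by apply: integral_ge0 => x _; exact: nf.1.
      apply: (@le_lt_trans _ _ (\int[m]_(x in K) cst 1 x)).
        apply: ge0_le_integral => //.
        + by move=> x _; exact: nf.1.
        + exact: (measurable_funS measurableT _ nf.2).
        + by move=> x _; rewrite lee_fin; have /andP[] := f01 n x.
      by rewrite integral_cst// mul1e -ge0_fin_numE// fin_num_measure.
    have := h12 (f n) (continuous_subspaceT (cf n)).
    rewrite aE// bE// c1 c2.
    move: (ff p1) (ff n1) (ff p2) (ff n2).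
    move: (integral p1 _ _) (integral n1 _ _) (integral p2 _ _) (integral n2 _ _).
    move=> [x| |]// [y| |]// [z| |]// [t| |]// _ _ _ _ [xy].
    by congr EFin; rewrite -[x](subrK y) xy; ring.
  have cb := cvg b; rewrite -(funext fab) in cb.
  exact: (cvg_unique _ (cvg a) cb).
move=> A mA.
have split (mu : {charge set P -> \bar R}) : on_Kbar Omega mu -> mu A = mu (A `&` K).
  move=> Kmu; have D0 : mu (A `\` K) = 0.
    apply: Kmu; first exact: measurableD.
    by apply/seteqP; split => // x [[_ nK] Kx]; exact: nK.
  by rewrite (chargeDI mu mA mK) D0 add0e.
have mAK : measurable (A `&` K) by exact: measurableI.
rewrite (split _ K1) (split _ K2) mu1E// mu2E//.
have := ab _ mAK.
have E1 (m : {finite_measure set P -> \bar R}) : \int[m]_(x in K) (\1_(A `&` K) x)%:E = m (A `&` K).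
  by rewrite integral_indic// -setIA setIid.
have := aE _ (nnm_indic mAK); rewrite integral_indic// setIT !E1 => aE'.
have := bE _ (nnm_indic mAK); rewrite integral_indic// setIT !E1 => bE'.
move=> ab'; have := etrans (esym aE') (etrans ab' bE').
have ff (m : {finite_measure set P -> \bar R}) : m (A `&` K) \is a fin_num by exact: fin_num_measure.
move: (ff p1) (ff n1) (ff p2) (ff n2).
move: (p1 _) (n1 _) (p2 _) (n2 _).
move=> [x| |]// [y| |]// [z| |]// [t| |]// _ _ _ _ [xy].
by congr EFin; rewrite -[x](addrK t) xy; ring.
Qed.

End charge_unique.

(** * Images of Young measures are positive and satisfy the marginal identity *)

Section direct.
Context {R : realType} {d : nat} (Omega : set 'rV[R]_d) (E : normedModType R).
Hypothesis hE : euclidean E.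
Hypothesis hopen : open Omega.
Hypothesis hbounded : bounded_set Omega.
Local Open Scope ereal_scope.
Notation X := 'rV[R]_d.
Notation Z := (torus R d).
Notation bX := (borel 'rV[R]_d).
Notation bZ := (borel (torus R d)).
Notation bE := (borel E).
Notation P := (borel ('rV[R]_d * torus R d * E)%type).
Notation tor := (torus_measure R d).

(** By uniqueness the choice made in [Sstar] is immaterial: every charge with the defining property
    agrees with it on measurable sets. *)
Lemma is_Sstar_eq (y : young2 Omega E) (mu : {charge set P -> \bar R}) :
  is_Sstar y mu -> charge_eq mu (Sstar y).
Proof.
move=> hmu; have hS : is_Sstar y (Sstar y).
  rewrite /Sstar; case: pselect => [ex|[]]; last by exists mu.
  by case: (cid ex).
apply: (charge_unique hE hmu.1 hS.1) => g cg.
by rewrite hmu.2// hS.2.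
Qed.

Lemma test_continuous (phi : X -> R) (g : Z -> R) :
  {within closure Omega, continuous phi} -> continuous g ->
  {within Kbar Omega E, continuous (fun p : X * Z * E => phi p.1.1 * g p.1.2 * (1 - `|p.2|))%R}.
Proof.
move=> cphi cg; apply/subspace_continuousP => p Kp.
have W : Filter (within (Kbar Omega E) (nbhs p)) by exact: within_filter.
have c1 : (fun q : X * Z * E => q.1.1) @ within (Kbar Omega E) (nbhs p) --> within (closure Omega) (nbhs p.1.1).
  move=> A nA.
  have f1 : (fun q : X * Z * E => q.1.1) @ nbhs p --> nbhs p.1.1.
    by apply: (@cvg_comp _ _ _ fst fst); [exact: cvg_fst|exact: cvg_fst].
  have h : nbhs p (fun q : X * Z * E => closure Omega q.1.1 -> A q.1.1) by exact: f1 nA.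
  suff : nbhs p (fun q : X * Z * E => Kbar Omega E q -> A q.1.1) by [].
  by apply: filterS h => q hq; rewrite KbarE => -[/hq].
apply: cvgM; first apply: cvgM.
- apply: (@cvg_comp _ _ _ (fun q : X * Z * E => q.1.1) phi _ _ _ c1).
  by apply: (subspace_continuousP _ _).1 => //; move: Kp; rewrite KbarE => -[].
- apply: cvg_within_filter; apply: (@cvg_comp _ _ _ (fun q : X * Z * E => q.1.2) g); last exact: cg.
  by apply: (@cvg_comp _ _ _ fst snd); [exact: cvg_fst|exact: cvg_snd].
- apply: cvgB; first exact: cvg_cst.
  apply: cvg_within_filter; apply: (@cvg_comp _ _ _ snd (fun z : E => `|z|%R)); first exact: cvg_snd.
  exact: norm_continuous.
Qed.

Lemma integrable_Omega (phi : X -> R) : {within closure Omega, continuous phi} ->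
  (leb d).-integrable Omega (fun x : bX => (phi x)%:E).
Proof.
move=> cphi; have [C [C0 phiC]] := continuous_within_bounded (@closure_compact R d Omega hbounded) cphi.
have mO : measurable (Omega : set bX) by exact: borel_open.
have mphi := continuous_within_measurable (closed_closure (A := Omega)) cphi.
apply: (@le_integrable _ bX R (leb d) Omega mO _ (cst C%:E)).
- apply/measurable_EFinP; apply: measurable_funS mphi; first exact: measurable_closure.
  exact: subset_closure.
- move=> x Ox /=; rewrite lee_fin [leRHS]ger0_norm//; apply: phiC; exact: subset_closure.
- apply/integrableP; split; first exact: measurable_cst.
  by rewrite integral_cst//= lte_mul_pinfty//; exact: leb_Omega_fin.
Qed.

Lemma integrable_torus (g : Z -> R) : continuous g ->
  tor.-integrable setT (fun xi : bZ => (g xi)%:E).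
Proof.
move=> cg; have [C [C0 gC]] := continuous_within_bounded (@torus_compact R d) (continuous_subspaceT cg).
apply: (@le_integrable _ bZ R tor setT measurableT _ (cst C%:E)).
- by apply/measurable_EFinP; apply: continuous_within_measurable; [exact: closedT|exact: continuous_subspaceT].
- by move=> x Ox /=; rewrite lee_fin [leRHS]ger0_norm//; exact: gC.
- apply/integrableP; split; first exact: measurable_cst.
  by rewrite integral_cst//= [tor _]probability_setT mule1 ltry.
Qed.

Lemma pairing_test (y : young2 Omega E) (phi : X -> R) (g : Z -> R) :
  {within closure Omega, continuous phi} -> continuous g ->
  pairing (Smap (fun p : X * Z * E => phi p.1.1 * g p.1.2 * (1 - `|p.2|))%R) y =
  (\int[leb d]_(x in Omega) (phi x)%:E) * (\int[tor]_xi (g xi)%:E).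
Proof.
move=> cphi cg; have cf := test_continuous cphi cg.
rewrite /pairing [X in _ + X]integral0_eq ?adde0; last first.
  move=> x cx; apply: integral0_eq => xi _; apply: integral0_eq => z z1.
  by rewrite recession_Smap//= z1 subrr mulr0.
have [c cE] : exists c : R, \int[tor]_xi (g xi)%:E = c%:E.
  by exists (fine (\int[tor]_xi (g xi)%:E)); rewrite fineK//; apply: integrable_fin_num => //; exact: integrable_torus.
rewrite cE -integralZr//; last 2 first.
- by apply: borel_open.
- exact: integrable_Omega.
apply: eq_integral => x _; rewrite -cE -integralZl//; last exact: integrable_torus.
apply: eq_integral => xi _.
rewrite (eq_integral (cst (phi x * g xi)%:E)); last first.
  (* The weight is designed for this: (1 + |z|) (1 - |z| / (1 + |z|)) = 1, so the integrand no
     longer depends on z. *)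
  move=> z _; congr EFin; rewrite /Smap/= norm_compress.
  have h : (1 + `|z| != 0)%R by rewrite gt_eqF// ltr_pwDl.
  by field.
by rewrite integral_cst//= [X in _ * X]probability_setT mule1 EFinM.
Qed.

Lemma Sstar_sub (y : young2 Omega E) (mu : {charge set P -> \bar R}) :
  charge_eq mu (Sstar y) ->
  [/\ on_Kbar Omega mu, positive_charge mu
      & forall (phi : X -> R) (g : Z -> R),
          {within closure Omega, continuous phi} -> continuous g ->
          cintegral mu (Kbar Omega E)
            (fun p => phi p.1.1 * g p.1.2 * (1 - `|p.2|))%R =
          (\int[leb d]_(x in Omega) (phi x)%:E) * (\int[tor]_xi (g xi)%:E)].
Proof.
move=> muS; have [m mS] := young_measure hE hopen hbounded y.
have mum A : measurable A -> mu A = m A.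
  by move=> mA; rewrite muS//; exact: (esym (is_Sstar_eq mS mA)).
have mK := @measurable_Kbar R d Omega E.
split.
- by move=> A mA AK; rewrite mum//; exact: mS.1.
- by move=> A mA; rewrite mum.
- move=> phi g cphi cg; rewrite -(pairing_test y cphi cg) -mS.2; last exact: test_continuous.
  by rewrite (cintegral_positive _ mK mum) (@cintegral_positive _ _ _ _ m).
Qed.
End direct.

(** * The Young measure of a positive measure *)

Section converse.
Context {R : realType} {d : nat} (Omega : set 'rV[R]_d) (E : normedModType R).
Hypothesis hE : euclidean E.
Hypothesis hopen : open Omega.
Hypothesis hbounded : bounded_set Omega.
Local Open Scope ereal_scope.
Notation X := 'rV[R]_d.
Notation Z := (torus R d).
Notation bX := (borel 'rV[R]_d).
Notation bZ := (borel (torus R d)).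
Notation bE := (borel E).
Notation P := (borel ('rV[R]_d * torus R d * E)%type).
Notation tor := (torus_measure R d).

(** The inverse of [compress] on the open ball. Outside it the integrands below carry the factor
    [weight], which is 0 there. *)
Definition expand (z : E) : E := if (`|z| < 1)%R then ((1 - `|z|)^-1 *: z)%R else 0%R.

Lemma compress_expand (z : E) : (`|z| < 1)%R -> compress (expand z) = z.
Proof.
move=> z1; rewrite /compress /expand z1 normrZ gtr0_norm ?invr_gt0 ?subr_gt0// scalerA.
have h : (1 - `|z| != 0)%R by rewrite subr_eq0 gt_eqF.
rewrite (_ : (_ * _ = 1)%R) ?scale1r//; field.
by rewrite h/= subrK oner_eq0.
Qed.

Lemma norm_expand (z : E) : (`|z| < 1)%R -> ((1 - `|z|) * `|expand z| = `|z|)%R.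
Proof.
move=> z1; rewrite /expand z1 normrZ gtr0_norm ?invr_gt0 ?subr_gt0//.
by rewrite mulrA divff ?mul1r// subr_eq0 gt_eqF.
Qed.

Lemma measurable_expand : @measurable_fun _ _ bE bE setT expand.
Proof.
apply: (@measurability _ _ bE bE setT expand (@open E)) => //.
move=> _ [U oU <-]; rewrite setTI.
have oB : open (@uball R E).
  apply: (@open_comp _ _ (fun z : E => `|z|%R) [set x : R | (x < 1)%R]); last exact: open_lt.
  by move=> z _; exact: norm_continuous.
rewrite (_ : _ @^-1` _ = (@uball R E `&` (fun z => (1 - `|z|)^-1 *: z)%R @^-1` U) `|`
    (~` @uball R E `&` [set _ | U 0%R])); last first.
  apply/seteqP; split => [z|z [[z1]|[/negP z1]]]; rewrite /preimage/= /expand.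
  - by case: ifPn => z1 Uz; [left|right; split => //; exact/negP].
  - by rewrite z1.
  - by rewrite (negbTE z1).
apply: measurableU.
  apply: borel_open; rewrite openE => z [z1 Uz]; apply: filterI.
    exact: open_nbhs_nbhs.
  have c : ((1 - `|x|)^-1 *: x)%R @[x --> z] --> ((1 - `|z|)^-1 *: z)%R.
    apply: cvgZ cvg_id; apply: cvgV; first by rewrite subr_eq0 gt_eqF.
    by apply: cvgB; [exact: cvg_cst|exact: norm_continuous].
  by apply: c; exact: open_nbhs_nbhs.
apply: measurableI; first by apply: measurableC; exact: borel_open.
case: (pselect (U 0%R)) => U0.
  by rewrite (_ : [set _ | _] = setT)//; apply/seteqP; split.
by rewrite (_ : [set _ | _] = set0)//; apply/seteqP; split.
Qed.

Lemma measurable_normP : @measurable_fun _ _ P (measurableTypeR R) setT (fun p : X * Z * E => `|p.2|%R).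
Proof.
have h : @measurable_fun _ _ (bX * bZ * bE)%type _ setT (fun p => `|p.2|%R).
  exact: (measurableT_comp (@measurable_normE R E) measurable_snd).
exact: (measurableT_comp h (@measurable_fromP R d E)).
Qed.

(** Truncated at 0 to have values in [0, 1] on the whole space, as [weighted_pushforward] requires;
    on [Kbar] it is 1 - |z|. *)
Definition weight (p : X * Z * E) : R := Num.max 0%R (1 - `|p.2|)%R.

Lemma measurable_weight : @measurable_fun _ _ P _ setT weight.
Proof.
apply: measurable_maxr; first exact: measurable_cst.
by apply: measurable_funB; [exact: measurable_cst|exact: measurable_normP].
Qed.

Lemma weight01 p : (0 <= weight p <= 1)%R.
Proof. by apply/andP; split; rewrite /weight; [rewrite le_max lexx|rewrite ge_max ler01/= lerBlDr lerDl]. Qed.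

Lemma weightE p : Kbar Omega E p -> weight p = (1 - `|p.2|)%R.
Proof. by rewrite KbarE => -[_ p1]; apply/max_idPr; rewrite subr_ge0. Qed.

(** The source of the moment condition: |z| integrated against the expanded measure is bounded by
    the mass of m. *)
Lemma weight_expand_le1 p : (weight p * `|expand p.2| <= 1)%R.
Proof.
rewrite /weight; have [p1|p1] := ltP (`|p.2|)%R 1%R.
  by rewrite (max_idPr _) ?subr_ge0 ?(ltW p1)// norm_expand// ltW.
by rewrite (max_idPl _) ?subr_le0// mul0r ler01.
Qed.

Lemma null_snd {d1 d2} {T : measurableType d1} {Y : measurableType d2}
  (N : {finite_measure set (T * Y)%type -> \bar R}) : N [set p | ~ [set: Y] p.2] = 0.
Proof. by rewrite (_ : mkset _ = set0) ?measure0//; apply/seteqP; split => // p; exact. Qed.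

Lemma measurable_expandP :
  @measurable_fun _ _ P (bX * bZ * bE)%type setT (fun p => (p.1, expand p.2)).
Proof.
have h : @measurable_fun _ _ (bX * bZ * bE)%type (bX * bZ * bE)%type setT
    (fun p => (p.1, expand p.2)).
  apply/measurable_fun_pair; first exact: measurable_fst.
  exact: (measurableT_comp measurable_expand measurable_snd).
exact: (measurableT_comp h (@measurable_fromP R d E)).
Qed.

(** [M'] is kept besides [lam] and [rho]: its integrals are those of [semidirect lam rho], the
    measure for which nu^infinity must live on the sphere. *)
Lemma triple_disintegration (M : {finite_measure set (bX * bZ * bE)%type -> \bar R}) :
  exists (M' : {finite_measure set (bX * bZ)%type -> \bar R})
    (lam : {finite_measure set bX -> \bar R})
    (rho : X -> probability bZ R) (ki : X * Z -> probability bE R),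
  [/\ @mker R _ _ bX bZ rho, @mker R _ _ (bX * bZ)%type bE ki,
      forall u, nnm u -> \int[M']_p u p = \int[lam]_x \int[rho x]_xi u (x, xi),
      forall u, nnm u -> \int[lam]_x u x = \int[M]_p u p.1.1 &
      forall f, nnm f -> \int[M]_p f p = \int[M']_p \int[ki p]_z f (p, z)].
Proof.
have [ki [mki kiE]] := disintegrable_E hE (null_snd M).
have [M' M'E] := pushforward_finite M (measurable_fst (T1 := (bX * bZ)%type) (T2 := bE)).
have [rho [mrho rhoE]] := disintegrable_Z (null_snd M').
have [lam lamE] := pushforward_finite M' (measurable_fst (T1 := bX) (T2 := bZ)).
exists M', lam, rho, ki; split => //.
- by move=> u nu; rewrite rhoE// lamE//; exact: (nnm_mker_integral mrho nu).
- move=> u nu; rewrite lamE// M'E//.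
  exact: (nnm_comp (h := fst) measurable_fst nu).
- by move=> f nf; rewrite kiE// M'E//; exact: (nnm_mker_integral mki nf).
Qed.


(** * Construction of a Young measure from a positive measure with the right marginal *)

Section given_measure.
Variable m : {finite_measure set P -> \bar R}.
Hypothesis mK0 : m (~` Kbar Omega E) = 0.
Hypothesis mtest : forall (phi : X -> R) (g : Z -> R),
  {within closure Omega, continuous phi} -> continuous g ->
  \int[m]_(p in Kbar Omega E) (phi p.1.1 * g p.1.2 * (1 - `|p.2|))%:E =
  (\int[leb d]_(x in Omega) (phi x)%:E) * (\int[tor]_xi (g xi)%:E).

Lemma integral_off_Kbar (D : set P) (f g : P -> \bar R) :
  (forall p, D p -> Kbar Omega E p -> f p = g p) ->
  \int[m]_(p in D) f p = \int[m]_(p in D) g p.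
Proof.
move=> fg; apply: (integral_eq_off_null _ mK0).
  by apply: measurableC; exact: measurable_Kbar.
by move=> p Dp /contrapT; exact: fg.
Qed.

Lemma integral_Kbar (f : P -> \bar R) :
  \int[m]_(p in Kbar Omega E) f p = \int[m]_p f p.
Proof.
rewrite integral_set_indic; apply: integral_off_Kbar => p _ Kp.
by rewrite indicE mem_set// mul1e.
Qed.

(* The test functions of the hypothesis determine the weighted marginal, since
   indicators of open sets are limits of continuous functions. *)
Lemma weight_marginal (u : bX * bZ -> \bar R) : nnm u ->
  \int[m]_p ((weight p)%:E * u p.1) = \int[leb d]_(x in Omega) \int[tor]_xi u (x, xi).
Proof.
move=> nu.
have mfst : @measurable_fun _ _ P (bX * bZ)%type setT fst.
  exact: (measurableT_comp measurable_fst (@measurable_fromP R d E)).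
have [a aE] := weighted_pushforward m measurable_weight weight01 mfst.
have mO := measurable_Omega hopen.
have [b bE] : exists b : {finite_measure set (bX * bZ)%type -> \bar R},
    forall f, nnm f -> \int[b]_p f p = \int[leb d]_(x in Omega) \int[tor]_xi f (x, xi).
  apply: integral_like_finite_measure.
    apply: (@integral_like_nested R _ _ _ bX bZ (bX * bZ)%type (leb d) Omega (fun=> tor) (fun f p => f p)) => //.
    by move=> p; exact: (integral_like_eval id p).
  rewrite (eq_integral (cst 1)); last by move=> x _; rewrite (prob_integral1 (T := bZ)).
  by rewrite integral_cst// mul1e; exact: leb_Omega_fin.
suff ab : forall C, measurable C -> a C = b C.
  by rewrite -aE// -bE//; apply: eq_measure_integral => C mC _; exact: ab.
apply: measure_unique_generated; [exact: openI|exact: openI|exact: openT|exact: openT|].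
move=> U V oU oV.
have [u' uU] := @open_approx_pseudoMetric R X U oU.
have [v vV] := @open_approx_torus R d V oV.
have [_ f01 f0 f1] := indic_approx_prod uU vV.
have [cu u01 _ _] := uU; have [cv v01 _ _] := vV.
have mu' n : @measurable_fun _ _ bX (measurableTypeR R) setT (u' n).
  by apply: continuous_within_measurable; [exact: closedT|exact: continuous_subspaceT].
have mv n : @measurable_fun _ _ bZ (measurableTypeR R) setT (v n).
  by apply: continuous_within_measurable; [exact: closedT|exact: continuous_subspaceT].
have mf n : @measurable_fun _ _ (bX * bZ)%type (measurableTypeR R) setT (fun p => u' n p.1 * v n p.2)%R.
  apply: measurable_funM.
    exact: (measurableT_comp (mu' n) measurable_fst).
  exact: (measurableT_comp (mv n) measurable_snd).
have mB : measurable (U `*` V : set (bX * bZ)).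
  by apply: measurableX; exact: borel_open.
have cvg (n : {finite_measure set (bX * bZ)%type -> \bar R}) :
    \int[n]_x (u' i x.1 * v i x.2)%:E @[i --> \oo] --> n (U `*` V).
  rewrite -[X in n X]setIT; apply: indic_approx_cvg => //.
  by rewrite -ge0_fin_numE// fin_num_measure.
have fab i : \int[a]_x (u' i x.1 * v i x.2)%:E = \int[b]_x (u' i x.1 * v i x.2)%:E.
  have nf : @nnm R _ (bX * bZ)%type (fun x => (u' i x.1 * v i x.2)%:E).
    split; first by move=> x; rewrite lee_fin; have /andP[] := f01 i x.
    by apply/measurable_EFinP; exact: (mf i).
  rewrite aE// bE// -integral_Kbar.
  transitivity (\int[m]_(p in Kbar Omega E) (u' i p.1.1 * v i p.1.2 * (1 - `|p.2|))%:E).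
    apply: eq_integral => p; rewrite inE => Kp.
    by rewrite weightE// -EFinM mulrC.
  rewrite mtest//; last exact: continuous_subspaceT.
  rewrite -ge0_integralZr//.
  - apply: eq_integral => x _; rewrite -ge0_integralZl//.
    + by apply/measurable_EFinP; exact: (mv i).
    + by move=> xi _; rewrite lee_fin; have /andP[] := v01 i xi.
    + by rewrite lee_fin; have /andP[] := u01 i x.
  - apply/measurable_EFinP; exact: (measurable_funS measurableT _ (mu' i)).
  - by move=> x _; rewrite lee_fin; have /andP[] := u01 i x.
  - by apply: integral_ge0 => xi _; rewrite lee_fin; have /andP[] := v01 i xi.
have cb := cvg b; rewrite -(funext fab) in cb.
exact: (cvg_unique _ (cvg a) cb).
Qed.

Lemma weight_disintegration : exists k : X * Z -> probability bE R,
  @mker R _ _ (bX * bZ)%type bE k /\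
  forall f : bX * bZ * bE -> \bar R, nnm f ->
    \int[m]_p ((weight p)%:E * f (p.1, expand p.2)) =
    \int[leb d]_(x in Omega) \int[tor]_xi \int[k (x, xi)]_z f (x, xi, z).
Proof.
have [M ME] := weighted_pushforward m measurable_weight weight01 measurable_expandP.
have [k [mk kE]] := disintegrable_E hE (null_snd M).
exists k; split => // f nf; rewrite -ME// kE//.
have nk := nnm_mker_integral mk nf.
rewrite -(weight_marginal nk) ME//.
exact: (nnm_comp (h := fst) measurable_fst nk).
Qed.


Hypothesis hboundary : leb d (boundary Omega) = 0.

(** The moment of a Young measure is taken over the closure of [Omega], while the marginal identity
    speaks of [Omega]; the null boundary reconciles them. *)
Lemma integral_closure (f : bX -> \bar R) :
  \int[leb d]_(x in closure Omega) f x = \int[leb d]_(x in Omega) f x.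
Proof.
rewrite integral_set_indic [RHS]integral_set_indic.
apply: (@integral_eq_off_null _ _ bX (leb d) setT (boundary Omega)) => //.
  apply: measurableD; first exact: measurable_closure.
  by apply: borel_open; exact: open_interior.
move=> x _ nb; congr (_%:E * _); rewrite !indicE; congr (_%:R)%R; congr nat_of_bool.
apply/idP/idP; rewrite !inE; last exact: subset_closure.
move=> cx; apply: contrapT => nx; apply: nb; split => //.
by move/interior_subset.
Qed.

Lemma young_of_measure : exists (y : young2 Omega E),
  [/\ @mker R _ _ (bX * bZ)%type bE (y_nu y), @mker R _ _ bX bZ (y_rho y),
      @mker R _ _ (bX * bZ)%type bE (y_nuinf y) &
      forall h : P -> \bar R, nnm h -> \int[m]_p h p =
        lifted Omega (y_nu y) (y_lambda y) (y_rho y) (y_nuinf y) h].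
Proof.
have [k [mk kE]] := weight_disintegration.
have mS := @measurable_usphere R E.
have mcl := @measurable_closure R d Omega.
have mCS : measurable ([set p | @usphere R E p.2] : set (bX * bZ * bE)).
  by rewrite -[X in measurable X]setTI; exact: measurable_snd.
have mCP : measurable ([set p | @usphere R E p.2] : set P).
  by rewrite -[X in measurable X]setTI; exact: (@measurable_fromP R d E measurableT _ mCS).
have [M [ME _]] := restricted_pushforward m mCP (@measurable_fromP R d E).
have [M' [lam [rho [ki [mrho mki M'E lamE kiE]]]]] := triple_disintegration M.
have nnorm : @nnm R _ (bX * bZ * bE)%type (fun p => `|p.2|%:E).
  split; first by move=> p; rewrite lee_fin.
  by apply/measurable_EFinP; exact: (measurableT_comp (@measurable_normE R E) measurable_snd).
have n1 := nnm_mker_integral mk nnorm.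
have mD := @measurable_cylinder R d Omega.
have sd0 : semidirect lam rho set0 = 0.
  by apply: integral0_eq => x _; rewrite xsection0 measure0.
have f1 : weakstar_measurable (leb d \x tor)
    (closure Omega `*` [set: Z] : set (bX * bZ)) [set: E] k.
  by apply: mker_weakstar.
have f2 : completed_measurable_fun (leb d \x tor)
    (closure Omega `*` [set: Z] : set (bX * bZ)) (fun p => \int[k p]_z `|z|%:E).
  by apply: mker_completed => //; exact: n1.2.
(* The moment equals the integral over m of (1 - |z|) times the norm of the expanded point, which is
   at most the mass of m. *)
have f3 : \int[leb d \x tor]_(p in closure Omega `*` [set: Z]) \int[k p]_z `|z|%:E < +oo.
  have e3 := etrans (cylinder_integral Omega n1) (etrans (integral_closure _) (esym (kE _ nnorm))).
  rewrite [X in X < _]e3.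
  apply: (@le_lt_trans _ _ (\int[m]_p cst 1 p)).
    have nw : @nnm R _ P (fun p => (weight p)%:E * `|expand p.2|%:E).
      apply: nnmM; last exact: (nnm_comp measurable_expandP nnorm).
      split; last by apply/measurable_EFinP; exact: measurable_weight.
      by move=> p; rewrite lee_fin; have /andP[] := weight01 p.
    apply: ge0_le_integral => //; [by move=> p _; exact: nw.1|exact: nw.2|].
    by move=> p _; rewrite -EFinM lee_fin; exact: weight_expand_le1.
  by rewrite integral_cst// mul1e -ge0_fin_numE// fin_num_measure.
have f4 : lam (~` closure Omega) = 0.
  have mC : measurable (~` closure Omega : set bX) by exact: measurableC.
  have := lamE _ (nnm_indic mC); rewrite integral_indic// setIT => h; apply: (etrans h).
  rewrite ME; last exact: (nnm_comp (h := fun p : bX * bZ * bE => p.1.1)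
    (measurableT_comp measurable_fst measurable_fst) (nnm_indic mC)).
  transitivity (\int[m]_p cst 0 p); last by rewrite integral0.
  apply: integral_off_Kbar => p _; rewrite KbarE => -[cp _].
  by rewrite [\1_(~` _) _]indicE memNset ?mule0//; exact.
have f5 : weakstar_measurable lam (closure Omega : set bX) [set: Z] rho.
  by apply: mker_weakstar.
(* [M] does not charge the complement of the sphere, so almost every section of that complement is
   null for [ki]. *)
have f6 : (semidirect lam rho).-negligible
    [set p : bX * bZ | closure Omega p.1 /\ ki p (@usphere R E) != 1].
  have mN : measurable ([set p | ~ @usphere R E p.2] : set (bX * bZ * bE)).
    exact: (measurableC mCS).
  have [N [mN' N0 NE]] : exists N, [/\ measurable N, M' N = 0 &
      forall p, ~ N p -> ki p (xsection [set p | ~ @usphere R E p.2] p) = 0].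
    apply: null_sections => //.
    transitivity (\int[M]_p (\1_[set p : bX * bZ * bE | ~ @usphere R E p.2] p)%:E).
      rewrite kiE; last exact: nnm_indic.
      apply: eq_integral => p _.
      rewrite -[in LHS](setIT (xsection _ p)) -integral_indic//; last exact: measurable_xsection.
      by apply: eq_integral => z _; rewrite !indicE mem_xsection.
    rewrite ME; last exact: nnm_indic.
    apply: integral0_eq => p _; rewrite !indicE.
    case: (boolP (p \in [set p | @usphere R E p.2])); last by rewrite mul0e.
    by rewrite inE => Sp; rewrite memNset ?mule0//; exact.
  exists N; split => //.
    rewrite semidirectE//; have := M'E _ (nnm_indic mN'); rewrite integral_indic// setIT => <-.
    exact: N0.
  move=> p [_ kp]; apply: contrapT => /NE kp0; move/negP: kp; apply; apply/eqP.
  have := probability_setC (ki p) mS.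
  rewrite (_ : ~` _ = xsection [set p | ~ @usphere R E p.2] p); last first.
    by apply/seteqP; split => z; rewrite /xsection/= inE.
  rewrite kp0; have : ki p (@usphere R E) \is a fin_num by exact: fin_num_measure.
  move: (ki p (@usphere R E)) => [r| |]// _ [e].
  by congr EFin; apply/eqP; rewrite eq_sym -subr_eq0 -e.
have f7 : weakstar_measurable (semidirect lam rho)
    (closure Omega `*` [set: Z] : set (bX * bZ)) (@usphere R E) ki.
  by apply: mker_weakstar => //; exact: usphere_closed.
exists (Young2 f1 f2 f3 f4 f5 f6 f7); split => //= h nh.
rewrite /lifted -(kE _ (nnm_compress hE nh)).
have nclS : @nnm R _ (bX * bZ * bE)%type
    (fun p => (\1_(closure Omega) p.1.1)%:E * ((\1_(@usphere R E) p.2)%:E * h p)).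
  apply: nnmM; last exact: nnm_usphere.
  exact: (nnm_comp (h := fun p : bX * bZ * bE => p.1.1)
    (measurableT_comp measurable_fst measurable_fst) (nnm_indic mcl)).
have -> : \int[lam]_(x in closure Omega) \int[rho x]_xi
     \int[ki (x, xi)]_(z in @usphere R E) h (x, xi, z) =
   \int[m]_p ((\1_[set p | @usphere R E p.2] p)%:E *
     ((\1_(closure Omega) p.1.1)%:E * ((\1_(@usphere R E) p.2)%:E * h p))).
  rewrite -ME// kiE// M'E; last exact: (nnm_mker_integral mki nclS).
  rewrite integral_set_indic; apply: eq_integral => x _.
  rewrite indicE; case: (x \in closure Omega) => /=.
    rewrite mul1e; apply: eq_integral => xi _; rewrite integral_set_indic.
    by apply: eq_integral => z _; rewrite mul1e.
  rewrite mul0e; apply/esym/integral0_eq => xi _; apply: integral0_eq => z _.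
  by rewrite mul0e.
rewrite -ge0_integralD//; last 4 first.
- move=> p _; apply: mule_ge0; first by rewrite lee_fin; have /andP[] := weight01 p.
  by apply: mule_ge0; [rewrite lee_fin addr_ge0|exact: nh.1].
- apply: emeasurable_funM; first by apply/measurable_EFinP; exact: measurable_weight.
  exact: (nnm_comp measurable_expandP (nnm_compress hE nh)).2.
- by move=> p _; apply: mule_ge0; [rewrite lee_fin|exact: nclS.1].
- apply: emeasurable_funM; first by apply/measurable_EFinP; exact: measurable_indic.
  exact: (nnm_toP nclS).2.
(* A pointwise identity on [Kbar]. For |z| = 1 the weight is 0 and the sphere term is h. For |z| < 1
   the sphere term is 0, and (1 - |z|) (1 + |expand z|) = 1 - |z| + |z| = 1. *)
apply: integral_off_Kbar => -[[x xi] z] _; rewrite KbarE => -[/= cx z1].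
rewrite !indicE (mem_set cx) mul1e.
move: z1; rewrite le_eqVlt => /orP[/eqP z1|z1].
  rewrite !mem_set// !mul1e /weight/= z1 subrr (max_idPl _)// mul0e add0e.
  by [].
rewrite !memNset/=; [|by move=> h1; move: z1; rewrite h1 ltxx..].
rewrite mul0e adde0 compress_expand// muleA -EFinM /weight/= (max_idPr _) ?subr_ge0 ?ltW//.
by rewrite mulrDr mulr1 norm_expand// subrK mul1e.
Qed.

End given_measure.
End converse.

Theorem lemma3p5 (R : realType) (d : nat) (Omega : set 'rV[R]_d)
    (E : normedModType R) (hE : euclidean E)
    (hopen : open Omega) (hbounded : bounded_set Omega)
    (hboundary : leb d (boundary Omega) = 0) :
  [set mu | exists y : young2 Omega E, charge_eq mu (Sstar y)] =
  [set mu : {charge set (borel ('rV[R]_d * torus R d * E)%type) -> \bar R} |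
    [/\ on_Kbar Omega mu,
        positive_charge mu
      & forall (phi : 'rV[R]_d -> R) (g : torus R d -> R),
          {within closure Omega, continuous phi} -> continuous g ->
          cintegral mu (Kbar Omega E)
            (fun p => phi p.1.1 * g p.1.2 * (1 - `|p.2|)) =
          ((\int[leb d]_(x in Omega) (phi x)%:E) *
           (\int[torus_measure R d]_xi (g xi)%:E))%E]].
Proof.
apply/seteqP; split => mu.
  by move=> [y muy]; exact: (Sstar_sub hE hopen hbounded muy).
move=> [muK mupos mutest]; have [m mum] := positive_charge_measure mupos.
have mK := @measurable_Kbar R d Omega E.
have mK0 : m (~` Kbar Omega E) = 0%E.
  by rewrite -mum; [apply: muK; [exact: measurableC|rewrite setICl]|exact: measurableC].
have mtest (phi : 'rV[R]_d -> R) (g : torus R d -> R) :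
    {within closure Omega, continuous phi} -> continuous g ->
    (\int[m]_(p in Kbar Omega E) (phi p.1.1 * g p.1.2 * (1 - `|p.2|))%:E =
    (\int[leb d]_(x in Omega) (phi x)%:E) * (\int[torus_measure R d]_xi (g xi)%:E))%E.
  by move=> cphi cg; rewrite -(mutest _ _ cphi cg) (cintegral_positive _ mK mum).
have [y [mk mrho mki mE]] := young_of_measure hE hopen hbounded mK0 mtest hboundary.
exists y; apply: is_Sstar_eq => //.
exact: (is_Sstar_intro hE hopen hbounded mk mrho mki _ mE mum).
Qed.
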